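(* Let $A$ be an $n$-dimensional anticommutative Engel algebra over $\mathbf{k}$. (1) If $\dim A\le 4$, then $A$ has level not greater than two. (2) If $\dim A=5$, then $A$ has level $3$ if and only if it can be represented by $T^3$. (3) If $\dim A=6$, then $A$ has level $3$ if and only if it can be represented by $T^{2,2}(\epsilon_{23}^{4})$, $T^{2,2}(\epsilon_{24}^6)$ or $T^3$. (4) If $\dim A\ge 7$, then $A$ has level $3$ if and only if it can be represented by $\eta_3$, $T^{2,2}(\epsilon_{23}^{n-2})$, $T^{2,2}(\epsilon_{24}^n)$, $T^3$ or $T^{2,2,2}$.
   Context: $\mathbf{k}$ is a fixed algebraically closed field. An algebra is a $\mathbf{k}$-vector space with a bilinear multiplication (not necessarily associative). $A$ is anticommutative if $a^2=0$ for all $a\in A$; $A$ is Engel if there is $m>0$ with $(L_a)^m=0$ for all $a\in A$, where $L_a(b)=ab$. Degenerations and level. Fix an $n$-dimensional space $V$ with basis $e_1,\dots,e_n$ and let $\mathcal{A}_n=\mathrm{Hom}(V\otimes V,V)\cong\mathbf{k}^{n^3}$ (Zariski topology), with $GL(V)$ acting by $(g*\mu)(x\otimes y)=g\mu(g^{-1}x\otimes g^{-1}y)$. A structure $\mu\in\mathcal{A}_n$ represents $A$ if $A\cong(V,\mu)$. For $n$-dimensional algebras $A,B$ represented by $\mu,\chi$, write $A\to B$ ($A$ degenerates to $B$) if $\chi$ lies in the closure of the orbit $O(\mu)$; the degeneration is non-trivial if $A\not\cong B$. The level $lev(A)$ is the maximal $m$ such that there is a chain of non-trivial degenerations $A\to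 A_{m-1}\to\dots\to A_1\to A_0$ of $n$-dimensional algebras. Structures on $V$ (in dimension $n$; only the non-zero products $e_ie_j$ with $i<j$ are listed, all products not determined by these and anticommutativity are zero): $\eta_m$ ($n\ge 2m+1$): $e_{2i-1}e_{2i}=e_{2m+1}$, $1\le i\le m$; $T^{2,2}(\epsilon_{23}^{n-2})$ ($n\ge6$): $e_1e_2=e_{n-1}$, $e_1e_3=e_n$, $e_2e_3=e_{n-2}$; $T^{2,2}(\epsilon_{24}^{n})$ ($n\ge6$): $e_1e_2=e_{n-1}$, $e_1e_3=e_2e_4=e_n$; $T^3$ ($n\ge4$): $e_1e_2=e_3$, $e_1e_3=e_n$; $T^{2,2,2}$ ($n\ge7$): $e_1e_{i+1}=e_{i+n-3}$, $1\le i\le3$. *)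

(* Defs.v *)
From HB Require Import structures.
From mathcomp Require Import all_boot all_algebra.
From mathcomp Require Export mpoly.
Set Implicit Arguments.
Unset Strict Implicit.
Unset Printing Implicit Defensive.
Import GRing.Theory.
Local Open Scope ring_scope.

Record algebra (k : fieldType) := Algebra {
  alg_vect :> vectType k;
  alg_mul : {bilinear alg_vect -> alg_vect -> alg_vect}
}.

Section Algebras.
Variable k : fieldType.
Implicit Types A B : algebra k.

Definition anticommutative A := forall a : A, alg_mul A a a = 0.

Definition engel A :=
  exists2 m : nat, (0 < m)%N & forall a b : A, iter m (alg_mul A a) b = 0.

Definition alg_isomorphic A B :=
  exists f : {linear A -> B},
    bijective f /\ forall x y : A, f (alg_mul A x y) = alg_mul B (f x) (f y).

End Algebras.

(* [V] is ['rV[k]_n] and [V (x) V] is ['M[k]_n], with [x (x) y] being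
   [x^T *m y]; so Hom(V (x) V, V) is the space of matrices below, acting on
   the right of [mxvec (x^T *m y)]. *)
Notation structure k n := 'M[k]_(n * n, n).

Section Structures.
Variables (k : fieldType) (n : nat).
Implicit Types mu chi : structure k n.

Definition smul mu (x y : 'rV[k]_n) : 'rV[k]_n := mxvec (x^T *m y) *m mu.

Fact smul_is_bilinear mu :
  bilinear_for (GRing.Scale.Law.clone _ _ *:%R _)
               (GRing.Scale.Law.clone _ _ *:%R _) (smul mu).
Proof.
split=> [y|x] a u v; rewrite /smul.
- by rewrite linearP /= mulmxDl -scalemxAl linearP /= mulmxDl -scalemxAl.
- by rewrite mulmxDr -scalemxAr linearP /= mulmxDl -scalemxAl.
Qed.

HB.instance Definition _ mu :=
  bilinear_isBilinear.Build k 'rV[k]_n 'rV[k]_n 'rV[k]_n *:%R *:%R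
    (smul mu) (smul_is_bilinear mu).

Definition structure_algebra mu : algebra k :=
  @Algebra k 'rV[k]_n (smul mu).

Definition represents mu (A : algebra k) :=
  alg_isomorphic A (structure_algebra mu).

(* An element of GL(V) is [fun x => x *m g] with [g] invertible. *)
Definition orbit mu chi :=
  exists2 g : 'M[k]_n, g \in unitmx &
    forall x y, smul chi x y = smul mu (x *m invmx g) (y *m invmx g) *m g.

Definition zariski_closure (S : structure k n -> Prop) chi :=
  forall p : {mpoly k[n * n * n]},
    (forall mu, S mu -> p.@[fun i => mxvec mu 0 i] = 0) ->
    p.@[fun i => mxvec chi 0 i] = 0.

End Structures.

Section Level.
Variable k : fieldType.
Implicit Types A B : algebra k.

Definition degenerates A B :=
  exists (n : nat) (mu chi : structure k n),
    [/\ represents mu A, represents chi B & zariski_closure (orbit mu) chi].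

Definition degeneration_chain A (m : nat) :=
  exists C : nat -> algebra k, C m = A /\
    forall i, (i < m)%N ->
      degenerates (C i.+1) (C i) /\ ~ alg_isomorphic (C i.+1) (C i).

Definition has_level A (m : nat) :=
  degeneration_chain A m /\
  forall m', degeneration_chain A m' -> (m' <= m)%N.

End Level.

Section Examples.
Variables (k : fieldType) (n : nat).

(* [e_i], indexed from 1; it is 0 when [i] is not in 1..n *)
Definition bvec (i : nat) : 'rV[k]_n := \row_j (j.+1 == i)%:R.

(* The structure with [e_i e_j = e_l = - e_j e_i] for [(i, j, l)] in [s]. *)
Definition anticomm_structure (s : seq (nat * nat * nat)) : structure k n :=
  \sum_(t <- s) let: (i, j, l) := t in
    (mxvec ((bvec i)^T *m bvec j - (bvec j)^T *m bvec i))^T *m bvec l.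

Definition eta (m : nat) :=
  anticomm_structure [seq (2 * i - 1, 2 * i, 2 * m + 1)%N | i <- iota 1 m].

Definition T22_eps23 :=
  anticomm_structure [:: (1, 2, n - 1); (1, 3, n); (2, 3, n - 2)]%N.

Definition T22_eps24 :=
  anticomm_structure [:: (1, 2, n - 1); (1, 3, n); (2, 4, n)]%N.

Definition T3 := anticomm_structure [:: (1, 2, 3); (1, 3, n)]%N.

Definition T222 :=
  anticomm_structure [seq (1, i + 1, i + n - 3)%N | i <- iota 1 3].

Lemma smul_anticomm_structure s x y :
  smul (anticomm_structure s) x y =
  \sum_(t <- s) let: (i, j, l) := t in
    ((x *m (bvec i)^T) 0 0 * (y *m (bvec j)^T) 0 0
     - (x *m (bvec j)^T) 0 0 * (y *m (bvec i)^T) 0 0) *: bvec l.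
Proof.
have key (u v w z : 'rV[k]_n) : mxvec (u^T *m v) *m (mxvec (w^T *m z))^T =
    ((u *m w^T) 0 0 * (v *m z^T) 0 0)%:M.
  apply/rowP => a; rewrite ord1 !mxE eqxx mulr1n.
  rewrite (reindex _ (curry_mxvec_bij n n)) /=.
  rewrite mulr_suml; under [RHS]eq_bigr => i _ do rewrite mulr_sumr.
  rewrite pair_bigA /=; apply: eq_bigr => -[i j] _ /=.
  by rewrite mxE !mxvecE !mxE !big_ord1 !mxE mulrACA.
rewrite /smul /anticomm_structure mulmx_sumr; apply: eq_bigr => -[[i j] l] _.
by rewrite !linearB /= mulmxA mulmxBr !key -scalemx1 -[X in _ - X]scalemx1
  -scalerBl -scalemxAl mul1mx.
Qed.

End Examples.

(* Main.v *)
(** On structures, degeneration is a preorder, and two structures degenerating to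
    each other lie in one orbit: by quantifier elimination an orbit is
    constructible, and its closure is irreducible, so the orbit contains a
    nonempty open part of its closure.

    An anticommutative Engel algebra is then treated by the following
    dichotomies.  If a(ab) <> 0 for some a, b, a Jordan chain of L_a gives
    independent a, b, ab, a(ab), and a one-parameter degeneration leads to T^3
    (in dimension 4 the algebra is T^3).  If a(ab) = 0 identically, a(bc) is
    alternating, and if it is not zero then a, b, c, ab, ac, bc are independent,
    which leads to T^{2,2}(eps_23).  Finally, if A^2 lies in the annihilator, one
    looks at independent products xb, xc, xd (leading to T^{2,2,2}), at forms
    f(xy) of rank at least four (leading to T^{2,2}(eps_24), eta_3 or eta_2
    itself), at independent products ab, ac, bc, and otherwise A is 0, eta_1 or
    T^{2,2}.  So every algebra outside {0, eta_1, eta_2, T^{2,2}} degenerates to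
    one of the five algebras of the list, these degenerate to T^{2,2} or eta_2,
    and rank conditions show that algebras of the same level do not degenerate
    to each other; together with antisymmetry this determines the levels. *)
From HB Require Import structures.
From mathcomp Require Import all_boot all_algebra.
From mathcomp Require Import closed_field zify ring.
From Stdlib Require Import Classical.
Require Import Defs.
Set Implicit Arguments.
Unset Strict Implicit.
Unset Printing Implicit Defensive.
Import GRing.Theory.
Local Open Scope ring_scope.

(** * Polynomial functions and Zariski closures *)

(** The main difficulty is the upper bound on levels: a chain may pass through arbitrary structures,
    so degenerations must be excluded as well as produced. They are produced by scaling basis
    vectors: with weights q, the coefficient of X_l in X_i X_j is multiplied by t^(q_i+q_j-q_l), so
    at t = 0 only the part of weight q_i+q_j survives, and a product heavier than every basis vector
    needs no control. Each list of weights is chosen so that only the prescribed products are light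
    enough to matter. They are excluded by vanishing minors, polynomial conditions stable under base
    change. Antisymmetry uses no dimension of orbits. The Engel condition provides Jordan chains of
    L_a and forbids nonzero eigenvalues, which is why a is independent of its own chains. The
    dimension bounds count the independent vectors that a representative requires: T^{2,2} needs
    five, so in dimension 4 T^3 falls to level two. *)

Section PolynomialFunctions.
Variables (k : fieldType) (I T : Type) (X : I -> T -> k).

(** The coordinates [X] are arbitrary, so that one calculus of products, determinants and adjugates
    serves three settings: entries of a structure, the parameter of a line, and variables of a
    first-order formula. *)
Inductive polyfn : (T -> k) -> Prop :=
| polyfn_var i : polyfn (X i)
| polyfn_const c : polyfn (fun=> c)
| polyfn_add f g : polyfn f -> polyfn g -> polyfn (fun t => f t + g t)
| polyfn_mul f g : polyfn f -> polyfn g -> polyfn (fun t => f t * g t)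
| polyfn_ext f g : f =1 g -> polyfn f -> polyfn g.

Lemma polyfn_opp f : polyfn f -> polyfn (fun t => - f t).
Proof.
move=> pf; apply: (@polyfn_ext (fun t => -1 * f t)) => [t|]; rewrite ?mulN1r //.
by apply: polyfn_mul => //; apply: polyfn_const.
Qed.

Lemma polyfn_sub f g : polyfn f -> polyfn g -> polyfn (fun t => f t - g t).
Proof. by move=> pf pg; apply: polyfn_add => //; apply: polyfn_opp. Qed.

Lemma polyfn_sum J (r : seq J) (P : pred J) (f : J -> T -> k) :
  (forall j, P j -> polyfn (f j)) -> polyfn (fun t => \sum_(j <- r | P j) f j t).
Proof.
move=> pf; elim: r => [|j r IH].
  by apply: (@polyfn_ext (fun=> 0)) => [t|]; rewrite ?big_nil //; apply: polyfn_const.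
case: (boolP (P j)) => Pj.
  apply: (@polyfn_ext (fun t => f j t + \sum_(j <- r | P j) f j t)) => [t|].
    by rewrite big_cons Pj.
  by apply: polyfn_add => //; apply: pf.
by apply: polyfn_ext IH => t; rewrite big_cons (negPf Pj).
Qed.

Lemma polyfn_prod J (r : seq J) (P : pred J) (f : J -> T -> k) :
  (forall j, P j -> polyfn (f j)) -> polyfn (fun t => \prod_(j <- r | P j) f j t).
Proof.
move=> pf; elim: r => [|j r IH].
  by apply: (@polyfn_ext (fun=> 1)) => [t|]; rewrite ?big_nil //; apply: polyfn_const.
case: (boolP (P j)) => Pj.
  apply: (@polyfn_ext (fun t => f j t * \prod_(j <- r | P j) f j t)) => [t|].
    by rewrite big_cons Pj.
  by apply: polyfn_mul => //; apply: pf.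
by apply: polyfn_ext IH => t; rewrite big_cons (negPf Pj).
Qed.

Lemma polyfn_exp f m : polyfn f -> polyfn (fun t => f t ^+ m).
Proof.
move=> pf; elim: m => [|m IH].
  by apply: (@polyfn_ext (fun=> 1)) => [t|]; rewrite ?expr0 //; apply: polyfn_const.
apply: (@polyfn_ext (fun t => f t * f t ^+ m)) => [t|]; first by rewrite exprS.
exact: polyfn_mul.
Qed.

Definition polymx m n (M : T -> 'M[k]_(m, n)) :=
  forall i j, polyfn (fun t => M t i j).

Lemma polymx_const m n (A : 'M[k]_(m, n)) : polymx (fun=> A).
Proof. by move=> i j; apply: polyfn_const. Qed.

Lemma polymx_add m n (A B : T -> 'M[k]_(m, n)) :
  polymx A -> polymx B -> polymx (fun t => A t + B t).
Proof.
move=> pA pB i j; apply: (@polyfn_ext (fun t => A t i j + B t i j)).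
  by move=> t; rewrite mxE.
exact: polyfn_add.
Qed.

Lemma polymx_scale m n f (A : T -> 'M[k]_(m, n)) :
  polyfn f -> polymx A -> polymx (fun t => f t *: A t).
Proof.
move=> pf pA i j; apply: (@polyfn_ext (fun t => f t * A t i j)).
  by move=> t; rewrite mxE.
exact: polyfn_mul.
Qed.

Lemma polymx_mul m n p (A : T -> 'M[k]_(m, n)) (B : T -> 'M[k]_(n, p)) :
  polymx A -> polymx B -> polymx (fun t => A t *m B t).
Proof.
move=> pA pB i j; apply: (@polyfn_ext (fun t => \sum_h A t i h * B t h j)).
  by move=> t; rewrite mxE.
by apply: polyfn_sum => h _; apply: polyfn_mul; [apply: pA | apply: pB].
Qed.

Lemma polymx_tr m n (A : T -> 'M[k]_(m, n)) : polymx A -> polymx (fun t => (A t)^T).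
Proof.
move=> pA i j; apply: (@polyfn_ext (fun t => A t j i)); last exact: pA.
by move=> t; rewrite mxE.
Qed.

Lemma polymx_vec m n (A : T -> 'M[k]_(m, n)) :
  polymx A -> polymx (fun t => mxvec (A t)).
Proof.
move=> pA i j; rewrite (ord1 i); case/mxvec_indexP: j => {}i j.
by apply: (@polyfn_ext (fun t => A t i j)); [move=> t; rewrite mxvecE | apply: pA].
Qed.

Lemma polyfn_det n (A : T -> 'M[k]_n) : polymx A -> polyfn (fun t => \det (A t)).
Proof.
move=> pA; apply: polyfn_sum => s _; apply: polyfn_mul; first exact: polyfn_const.
by apply: polyfn_prod => i _; apply: pA.
Qed.

Lemma polymx_adj n (A : T -> 'M[k]_n) : polymx A -> polymx (fun t => \adj (A t)).
Proof.
move=> pA i j; apply: (@polyfn_ext (fun t => cofactor (A t) j i)).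
  by move=> t; rewrite mxE.
rewrite /cofactor; apply: polyfn_mul; first exact: polyfn_const.
apply: polyfn_det => a b; apply: (@polyfn_ext (fun t => A t (lift j a) (lift i b))).
  by move=> t; rewrite !mxE.
exact: pA.
Qed.

Lemma polymx_smul n (mu : T -> structure k n) x y :
  polymx mu -> polymx x -> polymx y -> polymx (fun t => smul (mu t) (x t) (y t)).
Proof.
move=> pmu px py; apply: polymx_mul => //; apply: polymx_vec.
by apply: polymx_mul => //; apply: polymx_tr.
Qed.

End PolynomialFunctions.

Lemma polyfn_comp (k : fieldType) (I T J U : Type) (X : I -> T -> k) (Y : J -> U -> k)
    (h : U -> T) F :
  (forall i, polyfn Y (fun u => X i (h u))) -> polyfn X F ->
  polyfn Y (fun u => F (h u)).
Proof.
move=> pX; elim=> {F} [i|c|f g _ IHf _ IHg|f g _ IHf _ IHg|f g fg _ IHf].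
- exact: pX.
- exact: polyfn_const.
- exact: polyfn_add.
- exact: polyfn_mul.
- by apply: polyfn_ext IHf => u.
Qed.

Definition entry (k : fieldType) m n (ij : 'I_m * 'I_n) (A : 'M[k]_(m, n)) :=
  A ij.1 ij.2.

Definition polyline (k : fieldType) := polyfn (fun (_ : unit) (t : k) => t).

Lemma polyline_horner (k : fieldType) F :
  polyline F -> exists P : {poly k}, forall t, P.[t] = F t.
Proof.
elim=> {F} [i|c|f g _ [P hP] _ [Q hQ]|f g _ [P hP] _ [Q hQ]|f g fg _ [P hP]].
- by exists 'X => t; rewrite hornerX.
- by exists c%:P => t; rewrite hornerC.
- by exists (P + Q) => t; rewrite hornerD hP hQ.
- by exists (P * Q) => t; rewrite hornerM hP hQ.
- by exists P => t; rewrite hP.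
Qed.

Section MatrixPolynomials.
Variables (k : fieldType) (m n : nat).
Let X := @entry k m n.

Lemma polyfn_mpoly F : polyfn X F ->
  exists p : {mpoly k[m * n]}, forall A, p.@[fun i => mxvec A 0 i] = F A.
Proof.
elim=> {F} [[i j]|c|f g _ [P hP] _ [Q hQ]|f g _ [P hP] _ [Q hQ]|f g fg _ [P hP]].
- by exists 'X_(mxvec_index i j) => A; rewrite mevalXU mxvecE.
- by exists c%:MP => A; rewrite mevalC.
- by exists (P + Q) => A; rewrite mevalD hP hQ.
- by exists (P * Q) => A; rewrite mevalM hP hQ.
- by exists P => A; rewrite hP.
Qed.

Lemma mpoly_polyfn (p : {mpoly k[m * n]}) :
  polyfn X (fun A => p.@[fun i => mxvec A 0 i]).
Proof.
apply: (@polyfn_ext _ _ _ _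
  (fun A => \sum_(e <- msupp p) p@_e * \prod_i mxvec A 0 i ^+ e i)).
  by move=> A; rewrite mevalE.
apply: polyfn_sum => e _; apply: polyfn_mul; first exact: polyfn_const.
apply: polyfn_prod => i _; apply: polyfn_exp; case/mxvec_indexP: i => i j.
apply: polyfn_ext (polyfn_var _ (i, j)) => A.
by rewrite mxvecE.
Qed.

End MatrixPolynomials.

Lemma zariski_closureP (k : fieldType) n (S : structure k n -> Prop) chi :
  zariski_closure S chi <->
  forall F, polyfn (@entry k (n * n) n) F -> (forall mu, S mu -> F mu = 0) ->
    F chi = 0.
Proof.
split=> [cS F pF SF|cS p Sp].
  have [p hp] := polyfn_mpoly pF; rewrite -hp.
  by apply: cS => mu /SF; rewrite hp.
exact: (cS _ (mpoly_polyfn p)).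
Qed.

Lemma zariski_closure_sub (k : fieldType) n (S : structure k n -> Prop) chi :
  S chi -> zariski_closure S chi.
Proof. by move=> Schi p; apply. Qed.

Section InfiniteField.
Variable k : closedFieldType.

Lemma nonroot (P : {poly k}) : P != 0 -> exists t, P.[t] != 0.
Proof. by case/closed_nonrootP => t; exists t. Qed.

(** If [F] and [D] were both nonzero polynomials, their product would have a nonroot, a parameter at
    which neither vanishes. *)
Lemma polyline_eq0 F D t0 : polyline F -> polyline D -> D t0 != 0 ->
  (forall t, D t != 0 -> F t = 0 :> k) -> forall t, F t = 0.
Proof.
move=> /polyline_horner[P hP] /polyline_horner[Q hQ] Dt0 FD t.
rewrite -hP; have [->|P0] := eqVneq P 0; first by rewrite horner0.
have Q0 : Q != 0 by apply: contraNneq Dt0 => Q0; rewrite -hQ Q0 horner0.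
have [u] := nonroot (mulf_neq0 P0 Q0).
rewrite hornerM hP hQ mulf_eq0 negb_or => /andP[Fu /FD Fu0].
by rewrite hP Fu0 eqxx in Fu.
Qed.

(** A polynomial vanishing on [S] vanishes along the path wherever [D] is nonzero, hence also at the
    exceptional parameter [t1]. Every degeneration produced by weights is such a limit. *)
Lemma zariski_closure_path n (S : structure k n -> Prop) (M : k -> structure k n)
    D t0 t1 :
  polymx (fun (_ : unit) (t : k) => t) M -> polyline D -> D t0 != 0 ->
  (forall t, D t != 0 -> S (M t)) -> zariski_closure S (M t1).
Proof.
move=> pM pD Dt0 SM; apply/zariski_closureP => F pF FS.
apply: (@polyline_eq0 (fun t => F (M t)) D t0) => // [|t Dt]; last exact/FS/SM.
by apply: polyfn_comp pF => -[i j]; apply: pM.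
Qed.

(** A third scalar separates the coefficients of t and t^2 when an identity is linearized, in every
    characteristic. *)
Lemma fresh_scalar : exists2 s : k, s != 0 & s != 1.
Proof.
have [|s] := @nonroot ('X * ('X - 1%:P)).
  by rewrite mulf_neq0 ?polyX_eq0 ?polyXsubC_eq0.
rewrite hornerM hornerXsubC hornerX mulf_eq0 negb_or subr_eq0 => /andP[s0 s1].
by exists s.
Qed.

End InfiniteField.

(** * Orbits and degenerations of structures *)

Section Tensors.
Variables (k : fieldType) (n : nat).
Implicit Types (mu chi : structure k n) (x y : 'rV[k]_n) (g : 'M[k]_n).

Lemma smul_delta mu i j : smul mu 'e_i 'e_j = row (mxvec_index i j) mu.
Proof. by rewrite /smul trmx_delta mul_delta_mx mxvec_delta -rowE. Qed.

Lemma smulZl mu a x y : smul mu (a *: x) y = a *: smul mu x y.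
Proof. exact: linearZl_LR. Qed.

Lemma smulZr mu a x y : smul mu x (a *: y) = a *: smul mu x y.
Proof. exact: linearZr_LR. Qed.

Lemma smulDl mu x y z : smul mu (x + y) z = smul mu x z + smul mu y z.
Proof. exact: linearDl. Qed.

Lemma smulDr mu x y z : smul mu x (y + z) = smul mu x y + smul mu x z.
Proof. exact: linearDr. Qed.

Lemma smulNl mu x y : smul mu (- x) y = - smul mu x y.
Proof. exact: linearNl. Qed.

Lemma smulNr mu x y : smul mu x (- y) = - smul mu x y.
Proof. exact: linearNr. Qed.

Lemma smulBl mu x y z : smul mu (x - y) z = smul mu x z - smul mu y z.
Proof. exact: linearBl. Qed.

Lemma smulBr mu x y z : smul mu x (y - z) = smul mu x y - smul mu x z.
Proof. exact: linearBr. Qed.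

Lemma smul0l mu x : smul mu 0 x = 0.
Proof. exact: linear0l. Qed.

Lemma smul0r mu x : smul mu x 0 = 0.
Proof. exact: linear0r. Qed.

Lemma smul_suml mu I r (P : pred I) (x : I -> 'rV[k]_n) y :
  smul mu (\sum_(i <- r | P i) x i) y = \sum_(i <- r | P i) smul mu (x i) y.
Proof. exact: linear_sumlz. Qed.

Lemma smul_sumr mu I r (P : pred I) x (y : I -> 'rV[k]_n) :
  smul mu x (\sum_(i <- r | P i) y i) = \sum_(i <- r | P i) smul mu x (y i).
Proof. exact: linear_sumr. Qed.

Lemma smul_expand mu (g g' h : 'M[k]_n) x y :
  smul mu (x *m g) (y *m g') *m h =
  \sum_i \sum_j (x 0 i * y 0 j) *: (smul mu ('e_i *m g) ('e_j *m g') *m h).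
Proof.
rewrite {1}[x]row_sum_delta {1}[y]row_sum_delta !mulmx_suml smul_suml mulmx_suml.
apply: eq_bigr => i _; rewrite smul_sumr mulmx_suml; apply: eq_bigr => j _.
by rewrite -!scalemxAl smulZl smulZr scalerA -scalemxAl.
Qed.

Lemma smul_expand1 mu x y :
  smul mu x y = \sum_i \sum_j (x 0 i * y 0 j) *: smul mu 'e_i 'e_j.
Proof.
have := smul_expand mu 1%:M 1%:M 1%:M x y; rewrite !mulmx1 => ->.
by apply: eq_bigr => i _; apply: eq_bigr => j _; rewrite !mulmx1.
Qed.

Lemma eq_structure mu chi :
  (forall i j, smul mu 'e_i 'e_j = smul chi 'e_i 'e_j) -> mu = chi.
Proof.
move=> mc; apply/row_matrixP => a; case/mxvec_indexP: a => i j.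
by rewrite -!smul_delta mc.
Qed.

(** [vec_mx (delta_mx 0 a)] is the matrix unit of the pair coded by [a], so the double sum selects
    one [c i j] without decoding [a]. *)
Definition of_tensor (c : 'I_n -> 'I_n -> 'rV[k]_n) : structure k n :=
  \matrix_(a, l) \sum_i \sum_j vec_mx (delta_mx 0 a) i j * c i j 0 l.

Lemma of_tensorE c i j l : of_tensor c (mxvec_index i j) l = c i j 0 l.
Proof.
rewrite mxE vec_mx_delta (bigD1 i) //= (bigD1 j) //= mxE !eqxx mul1r.
rewrite big1 => [|j' ne]; last by rewrite mxE (negPf ne) andbF mul0r.
rewrite big1 ?addr0 // => i' ne; rewrite big1 // => j' _.
by rewrite mxE (negPf ne) mul0r.
Qed.

Lemma smul_of_tensor c i j : smul (of_tensor c) 'e_i 'e_j = c i j.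
Proof. by apply/rowP => l; rewrite smul_delta mxE of_tensorE. Qed.

Lemma polymx_of_tensor I T (X : I -> T -> k) (c : T -> 'I_n -> 'I_n -> 'rV[k]_n) :
  (forall i j, polymx X (fun t => c t i j)) -> polymx X (fun t => of_tensor (c t)).
Proof.
move=> pc a l; case/mxvec_indexP: a => i j.
by apply: polyfn_ext (pc i j 0 l) => t; rewrite of_tensorE.
Qed.

Definition act g mu : structure k n :=
  of_tensor (fun i j => smul mu ('e_i *m invmx g) ('e_j *m invmx g) *m g).

Lemma smul_act g mu x y :
  smul (act g mu) x y = smul mu (x *m invmx g) (y *m invmx g) *m g.
Proof.
rewrite smul_expand1 smul_expand; apply: eq_bigr => i _; apply: eq_bigr => j _.
by rewrite smul_of_tensor.
Qed.

Lemma orbitP mu chi : orbit mu chi <-> exists2 g, g \in unitmx & chi = act g mu.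
Proof.
split=> -[g gU Dchi]; exists g => //; last by move=> x y; rewrite Dchi smul_act.
by apply: eq_structure => i j; rewrite Dchi smul_act.
Qed.

Lemma act1 mu : act 1%:M mu = mu.
Proof. by apply: eq_structure => i j; rewrite smul_act invmx1 !mulmx1. Qed.

Lemma actM g g' mu : g \in unitmx -> g' \in unitmx ->
  act (g *m g') mu = act g' (act g mu).
Proof.
move=> gU g'U; apply: eq_structure => i j; rewrite !smul_act !mulmxA.
have -> : invmx (g *m g') = invmx g' *m invmx g.
  have ggU : g *m g' \in unitmx by rewrite unitmx_mul gU.
  rewrite -[LHS]mulmx1 -(mulmxV gU) -[g in _ *m (g *m _)]mulmx1 -(mulmxV g'U).
  by rewrite !mulmxA -[_ *m g *m g']mulmxA mulVmx ?mul1mx.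
by rewrite !mulmxA.
Qed.

Lemma orbit_refl mu : orbit mu mu.
Proof. by apply/orbitP; exists 1%:M; rewrite ?unitmx1 ?act1. Qed.

Lemma orbit_sym mu chi : orbit mu chi -> orbit chi mu.
Proof.
case/orbitP => g gU ->; apply/orbitP; exists (invmx g); rewrite ?unitmx_inv //.
by rewrite -actM ?unitmx_inv // mulmxV // act1.
Qed.

Lemma orbit_trans mu chi rho : orbit mu chi -> orbit chi rho -> orbit mu rho.
Proof.
case/orbitP => g gU -> /orbitP[h hU ->]; apply/orbitP.
by exists (g *m h); rewrite ?unitmx_mul ?gU ?actM.
Qed.

Definition degen mu chi := zariski_closure (orbit mu) chi.

Lemma orbit_degen mu chi : orbit mu chi -> degen mu chi.
Proof. exact: zariski_closure_sub. Qed.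

(** [act g] is a linear automorphism of the space of structures preserving the orbit of [mu], hence
    its closure. *)
Lemma degen_act g mu chi : g \in unitmx -> degen mu chi -> degen mu (act g chi).
Proof.
move=> gU /zariski_closureP mc; apply/zariski_closureP => F pF F0.
apply: (mc (fun rho => F (act g rho))) => [|rho mr].
  apply: polyfn_comp pF => -[a l]; apply: polymx_of_tensor => i j.
  apply: polymx_mul; last exact: polymx_const.
  by apply: polymx_smul; try exact: polymx_const; move=> b m; apply: (polyfn_var _ (b, m)).
by apply: F0; apply: orbit_trans mr _; apply/orbitP; exists g.
Qed.

Lemma degen_trans mu chi rho : degen mu chi -> degen chi rho -> degen mu rho.
Proof.
move=> mc /zariski_closureP cr; apply/zariski_closureP => F pF F0.
apply: cr => // sigma /orbitP[g gU ->].
by move/zariski_closureP: (degen_act gU mc); apply.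
Qed.

End Tensors.

(** * Antisymmetry of degeneration *)

Section Irreducibility.
Variables (k : closedFieldType) (n : nat).
Implicit Types (mu chi : structure k n).

Lemma smul_scale a mu x y : smul (a *: mu) x y = a *: smul mu x y.
Proof. by rewrite /smul -scalemxAr. Qed.

Lemma act_scale a g mu : a != 0 -> g \in unitmx -> act (a *: g) mu = a^-1 *: act g mu.
Proof.
move=> a0 gU; apply: eq_structure => i j; rewrite smul_scale !smul_act invmxZ; last first.
  by rewrite unitmxE detZ unitrMl ?unitrX ?unitfE // -unitfE -unitmxE.
rewrite -!scalemxAr smulZl smulZr -!scalemxAl !scalerA; congr (_ *: _).
by rewrite mulfV // mul1r.
Qed.

(* The path [h] of base changes need not be invertible; [\adj h] replaces
   [h^-1], and the scalar [u] absorbs the resulting determinants at the ends. *)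
Lemma orbit_path mu chi1 chi2 : orbit mu chi1 -> orbit mu chi2 ->
  exists (M : k -> structure k n) (D : k -> k),
    [/\ polymx (fun (_ : unit) (t : k) => t) M, polyline D, D 0 != 0 /\ D 1 != 0,
        M 0 = chi1 /\ M 1 = chi2 & forall t, D t != 0 -> orbit mu (M t)].
Proof.
move=> /orbitP[g1 g1U ->] /orbitP[g2 g2U ->].
have pt : @polyline k (fun t => t) := polyfn_var (fun _ t => t) tt.
pose h t : 'M[k]_n := invmx g1 + t *: (invmx g2 - invmx g1).
pose u t : k := \det g1 + t * (\det g2 - \det g1).
have ph : polymx (fun (_ : unit) (t : k) => t) h.
  apply: polymx_add; first exact: polymx_const.
  by apply: polymx_scale; [exact: pt | exact: polymx_const].
have pu : polyline u.
  apply: polyfn_add; first exact: polyfn_const.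
  by apply: polyfn_mul; [exact: pt | exact: polyfn_const].
pose M t : structure k n := u t *: of_tensor (fun i j =>
   smul mu ('e_i *m h t) ('e_j *m h t) *m \adj (h t)).
pose D t : k := u t * \det (h t).
have MD t : D t != 0 -> M t = D t *: act (invmx (h t)) mu.
  rewrite mulf_eq0 negb_or => /andP[ut dt].
  have hU : h t \in unitmx by rewrite unitmxE unitfE.
  rewrite /D -scalerA; congr (_ *: _); apply: eq_structure => i j.
  rewrite smul_of_tensor smul_scale smul_act invmxK.
  by rewrite -[in LHS](mulKmx hU (\adj (h t))) mul_mx_adj mul_mx_scalar -scalemxAr.
have g1D : \det g1 != 0 by rewrite -unitfE -unitmxE.
have g2D : \det g2 != 0 by rewrite -unitfE -unitmxE.
have h0 : h 0 = invmx g1 by rewrite /h scale0r addr0.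
have h1 : h 1 = invmx g2 by rewrite /h scale1r addrC subrK.
have D0 : D 0 = 1 by rewrite /D h0 det_inv /u mul0r addr0 mulfV.
have D1 : D 1 = 1 by rewrite /D h1 det_inv /u mul1r addrC subrK mulfV.
exists M, D; split=> //.
- apply: polymx_scale => //; apply: polymx_of_tensor => i j.
  apply: polymx_mul; last exact: polymx_adj.
  apply: polymx_smul; first exact: polymx_const.
    by apply: polymx_mul => //; exact: polymx_const.
  by apply: polymx_mul => //; exact: polymx_const.
- by apply: polyfn_mul => //; apply: polyfn_det.
- by rewrite D0 D1 oner_neq0.
- by rewrite !MD ?D0 ?D1 ?oner_neq0 // h0 h1 !invmxK !scale1r.
move=> t Dt; apply/orbitP; exists ((D t)^-1 *: invmx (h t)).
  have : D t != 0 by [].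
  rewrite mulf_eq0 negb_or => /andP[_ dt].
  rewrite unitmxE detZ unitrMl ?unitrX ?unitfE ?invr_eq0 // -unitfE -unitmxE.
  by rewrite unitmx_inv unitmxE unitfE.
have hU : h t \in unitmx.
  by move: Dt; rewrite mulf_eq0 negb_or => /andP[_]; rewrite unitmxE unitfE.
by rewrite act_scale ?invr_eq0 ?unitmx_inv // invrK MD.
Qed.

(** Along a path joining [chi1] to [chi2], the functions [F1], [F2] and [D] are nonzero polynomials
    in one variable; a nonroot of their product gives the common point. *)
Lemma orbit_irreducible mu F1 F2 chi1 chi2 :
  polyfn (@entry k (n * n) n) F1 -> polyfn (@entry k (n * n) n) F2 ->
  orbit mu chi1 -> orbit mu chi2 -> F1 chi1 != 0 -> F2 chi2 != 0 ->
  exists2 chi, orbit mu chi & F1 chi != 0 /\ F2 chi != 0.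
Proof.
move=> pF1 pF2 m1 m2.
have [M [D [pM /polyline_horner[Q hQ] [D0 D1] [<- <-] MD]]] := orbit_path m1 m2.
have line F : polyfn (@entry k (n * n) n) F -> polyline (fun t => F (M t)).
  by move=> pF; apply: polyfn_comp pF => -[i j]; apply: pM.
have [P1 hP1] := polyline_horner (line _ pF1).
have [P2 hP2] := polyline_horner (line _ pF2).
have nz (P : {poly k}) t : P.[t] != 0 -> P != 0.
  by apply: contraNneq => ->; rewrite horner0.
rewrite -hP1 -hP2 => /nz P10 /nz P20; rewrite -hQ in D0; have Q0 := nz _ _ D0.
have [t] := nonroot (mulf_neq0 (mulf_neq0 P10 P20) Q0).
rewrite !hornerM !mulf_eq0 !negb_or => /andP[/andP[t1 t2]]; rewrite hQ => Dt.
by exists (M t); [apply: MD | rewrite -hP1 -hP2].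
Qed.

End Irreducibility.

(** * Orbits as definable sets, and antisymmetry by quantifier elimination *)

Section Antisymmetry.
Variables (k : closedFieldType) (n : nat).
Implicit Types (mu chi : structure k n) (e : seq k).
Local Notation N := (n * n * n)%N.

Lemma polyfn_term (F : seq k -> k) :
  polyfn (fun i (e : seq k) => e`_i) F ->
  exists t : GRing.term k, forall e, GRing.eval e t = F e.
Proof.
elim=> {F} [i|c|f g _ [P hP] _ [Q hQ]|f g _ [P hP] _ [Q hQ]|f g fg _ [P hP]].
- by exists (GRing.Var k i).
- by exists (GRing.Const c).
- by exists (GRing.Add P Q) => e /=; rewrite hP hQ.
- by exists (GRing.Mul P Q) => e /=; rewrite hP hQ.
- by exists P => e; rewrite hP.
Qed.

Definition definable (P : seq k -> Prop) :=
  exists f : GRing.formula k, forall e, GRing.holds e f <-> P e.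

Lemma definable_eq0 (F : seq k -> k) :
  polyfn (fun i (e : seq k) => e`_i) F -> definable (fun e => F e = 0).
Proof.
case/polyfn_term => t ht; exists (GRing.Equal t (GRing.Const 0)) => e /=.
by rewrite ht.
Qed.

Lemma definable_not P : definable P -> definable (fun e => ~ P e).
Proof. by case=> f hf; exists (GRing.Not f) => e /=; rewrite hf. Qed.

Lemma definable_and P Q : definable P -> definable Q -> definable (fun e => P e /\ Q e).
Proof. by case=> f hf [g hg]; exists (GRing.And f g) => e /=; rewrite hf hg. Qed.

Lemma definable_all (J : finType) (P : J -> seq k -> Prop) :
  (forall j, definable (P j)) -> definable (fun e => forall j, P j e).
Proof.
move=> dP; suff [f hf]: definable (fun e => forall j, j \in enum J -> P j e).
  by exists f => e; rewrite hf; split=> He j => [|_]; apply: He; rewrite ?mem_enum.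
elim: (enum J) => [|j r [f hf]]; first by exists (GRing.Bool true).
have [g hg] := dP j; exists (GRing.And g f) => e /=; rewrite hf hg.
split=> [[Pj Pr] i|He]; first by rewrite inE => /predU1P[->|/Pr].
by split=> [|i ir]; apply: He; rewrite inE ?eqxx ?ir ?orbT.
Qed.

Definition env mu : seq k := codom (fun i : 'I_N => mxvec mu 0 i).

Definition env_structure e : structure k n := vec_mx (\row_(i < N) e`_i).

Lemma nth_env mu (i : 'I_N) : (env mu)`_i = mxvec mu 0 i.
Proof.
rewrite /env /codom /image_mem (nth_map i) ?size_enum_ord //.
by rewrite nth_ord_enum.
Qed.

Lemma envK mu : env_structure (env mu) = mu.
Proof.
rewrite -[RHS]mxvecK; congr vec_mx; apply/rowP => i.
by rewrite mxE nth_env.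
Qed.

(** The formula states that some g with nonzero determinant satisfies chi(e_i g, e_j g) = mu(e_i,
    e_j) g, which avoids inverting g. Variables below N hold the entries of chi, the next n^2
    variables those of g, and the entries of [mu] are constants. *)
Lemma definable_orbit mu :
  exists f : GRing.formula k, forall chi, GRing.holds (env chi) f <-> orbit mu chi.
Proof.
pose g e : 'M[k]_n := vec_mx (\row_(i < n * n) e`_(N + i)).
pose L e i j := smul (env_structure e) ('e_i *m g e) ('e_j *m g e).
pose R e i j := smul mu 'e_i 'e_j *m g e.
have pS : polymx (fun i (e : seq k) => e`_i) env_structure.
  move=> a l; apply: polyfn_ext (polyfn_var _ (mxvec_index a l : nat)) => e.
  by rewrite !mxE.
have pg : polymx (fun i (e : seq k) => e`_i) g.
  move=> a l; apply: polyfn_ext (polyfn_var _ (N + mxvec_index a l)%N) => e.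
  by rewrite !mxE.
have [f hf] : definable (fun e => \det (g e) <> 0 /\
    forall ijl : 'I_n * 'I_n * 'I_n,
      (L e ijl.1.1 ijl.1.2 - R e ijl.1.1 ijl.1.2) 0 ijl.2 = 0).
  apply: definable_and.
    by apply/definable_not/definable_eq0/polyfn_det.
  apply: definable_all => -[[i j] l] /=; apply: definable_eq0.
  apply: (@polyfn_ext _ _ _ _ (fun e => L e i j 0 l - R e i j 0 l)).
    by move=> e; rewrite !mxE.
  apply: polyfn_sub.
    apply: polymx_smul => //; apply: polymx_mul => //; exact: polymx_const.
  by apply: polymx_mul => //; exact: polymx_const.
exists (foldr GRing.Exists f (iota N (n * n))) => chi.
have chiE e : {in [predC iota N (n * n)], GRing.same_env (env chi) e} ->
    env_structure e = chi.
  move=> ee; rewrite -[chi]envK; congr vec_mx; apply/rowP => i; rewrite !mxE ee //.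
  by rewrite inE mem_iota negb_and -ltnNge ltn_ord.
rewrite -GRing.foldExistsP; split=> [[e ee /hf[dg LR]]|/orbitP[h hU Dchi]].
  have gU : g e \in unitmx by rewrite unitmxE unitfE; apply/eqP.
  apply/orbitP; exists (g e) => //; apply: eq_structure => i j.
  have Lxy x y : smul chi (x *m g e) (y *m g e) = smul mu x y *m g e.
    have := smul_expand chi (g e) (g e) 1%:M x y; rewrite mulmx1 => ->.
    rewrite [smul mu x y]smul_expand1 mulmx_suml; apply: eq_bigr => a _.
    rewrite mulmx_suml; apply: eq_bigr => b _; rewrite -scalemxAl; congr (_ *: _).
    apply/rowP => l; have /eqP := LR (a, b, l).
    by rewrite /L /R /= chiE // mxE [X in _ + X]mxE subr_eq0 mulmx1 => /eqP.
  by rewrite smul_act -Lxy !mulmxKV.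
pose e := env chi ++ codom (fun i : 'I_(n * n) => mxvec h 0 i).
have size_env : size (env chi) = N by rewrite size_codom card_ord.
have ee : {in [predC iota N (n * n)], GRing.same_env (env chi) e}.
  move=> i; rewrite inE mem_iota negb_and -ltnNge -leqNgt => /orP[iN|Ni].
    by rewrite nth_cat size_env iN.
  rewrite !nth_default ?size_cat ?size_codom ?card_ord //.
  by apply: leq_trans Ni; apply: leq_addr.
have ge : g e = h.
  rewrite -[RHS]mxvecK; congr vec_mx; apply/rowP => i.
  rewrite mxE nth_cat size_env ltnNge leq_addr /= addKn.
  by rewrite /codom /image_mem (nth_map i) ?size_enum_ord // nth_ord_enum.
exists e => //; apply/hf; rewrite ge; split.
  by apply/eqP; rewrite -unitfE -unitmxE.
move=> [[i j] l] /=; rewrite /L /R ge chiE // Dchi smul_act !mulmxK //.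
by rewrite subrr mxE.
Qed.

(** [rterm] excludes inverses, so the value is polynomial in the entries; a variable outside the
    environment reads the default 0. *)
Lemma polyfn_eval (t : GRing.term k) : GRing.rterm t ->
  polyfn (@entry k (n * n) n) (fun mu => GRing.eval (env mu) t).
Proof.
elim: t => //=.
- move=> i _; have [iN|Ni] := ltnP i N; last first.
    apply: polyfn_ext (polyfn_const _ 0) => mu.
    by rewrite nth_default // size_codom card_ord.
  apply: (@polyfn_ext _ _ _ _ (fun mu => mxvec mu 0 (Ordinal iN))).
    by move=> mu; rewrite -nth_env.
  case/mxvec_indexP: (Ordinal iN) => a l.
  by apply: polyfn_ext (polyfn_var _ (a, l)) => mu; rewrite mxvecE.
- by move=> c _; apply: polyfn_const.
- by move=> m _; apply: polyfn_const.
- by move=> t IHt u IHu /andP[/IHt pt /IHu pu]; apply: polyfn_add.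
- by move=> t IHt /IHt; apply: polyfn_opp.
- move=> t IHt m /IHt pt.
  apply: polyfn_ext (polyfn_mul pt (polyfn_const _ m%:R)) => mu.
  by rewrite mulr_natr.
- by move=> t IHt u IHu /andP[/IHt pt /IHu pu]; apply: polyfn_mul.
by move=> t IHt m /IHt; apply: polyfn_exp.
Qed.

(** By induction on the formula. The difference of the two sides of an equation either vanishes on
    the orbit, hence on its closure ([D] is 1 and the value true), or is nonzero somewhere on the
    orbit (it is [D] and the value false). Connectives multiply the functions [D], and
    irreducibility keeps the product nonzero somewhere on the orbit. *)
Lemma qf_eval_generic mu (f : GRing.formula k) :
  GRing.qf_form f -> GRing.rformula f ->
  exists D b, [/\ polyfn (@entry k (n * n) n) D,
    exists2 chi, orbit mu chi & D chi != 0 &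
    forall chi, degen mu chi -> D chi != 0 -> GRing.qf_eval (env chi) f = b].
Proof.
elim: f => //=.
- move=> b _ _; exists (fun=> 1), b; split=> //; first exact: polyfn_const.
  by exists mu; rewrite ?oner_neq0 //; apply: orbit_refl.
- move=> t u _ /andP[rt ru].
  pose F chi := GRing.eval (env chi) t - GRing.eval (env chi) u.
  have pF : polyfn (@entry k (n * n) n) F by apply: polyfn_sub; apply: polyfn_eval.
  have [[chi mc Fc]|F0] := classic (exists2 chi, orbit mu chi & F chi != 0).
    exists F, false; split=> //; first by exists chi.
    by move=> rho _; rewrite /F subr_eq0 => /negPf.
  exists (fun=> 1), true; split=> //; first exact: polyfn_const.
    by exists mu; rewrite ?oner_neq0 //; apply: orbit_refl.
  move=> rho /zariski_closureP/(_ F pF) Frho _; rewrite -subr_eq0; apply/eqP.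
  apply: Frho => chi mc; apply/eqP/negPn/negP => Fc.
  by apply: F0; exists chi.
- move=> f IHf g IHg /andP[/IHf{}IHf /IHg{}IHg] /andP[/IHf[D [b [pD [x mx Dx] Db]]]].
  move=> /IHg[E [c [pE [y my Ey] Ec]]]; exists (fun x => D x * E x), (b && c).
  split=> [||z mz]; first exact: polyfn_mul.
    have [z mz [Dz Ez]] := orbit_irreducible pD pE mx my Dx Ey.
    by exists z; rewrite // mulf_neq0.
  by rewrite mulf_eq0 negb_or => /andP[Dz Ez]; rewrite Db ?Ec.
- move=> f IHf g IHg /andP[/IHf{}IHf /IHg{}IHg] /andP[/IHf[D [b [pD [x mx Dx] Db]]]].
  move=> /IHg[E [c [pE [y my Ey] Ec]]]; exists (fun x => D x * E x), (b || c).
  split=> [||z mz]; first exact: polyfn_mul.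
    have [z mz [Dz Ez]] := orbit_irreducible pD pE mx my Dx Ey.
    by exists z; rewrite // mulf_neq0.
  by rewrite mulf_eq0 negb_or => /andP[Dz Ez]; rewrite Db ?Ec.
- move=> f IHf g IHg /andP[/IHf{}IHf /IHg{}IHg] /andP[/IHf[D [b [pD [x mx Dx] Db]]]].
  move=> /IHg[E [c [pE [y my Ey] Ec]]]; exists (fun x => D x * E x), (b ==> c).
  split=> [||z mz]; first exact: polyfn_mul.
    have [z mz [Dz Ez]] := orbit_irreducible pD pE mx my Dx Ey.
    by exists z; rewrite // mulf_neq0.
  by rewrite mulf_eq0 negb_or => /andP[Dz Ez]; rewrite Db ?Ec.
move=> f IHf /IHf{}IHf /IHf[D [b [pD mD Db]]]; exists D, (~~ b); split=> //.
by move=> z mz Dz; rewrite Db.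
Qed.

(* By quantifier elimination, membership in the orbit of [mu] has a constant
   truth value on a nonempty open part of the closure; the orbit of [chi] meets
   this open part. *)
Lemma degen_antisym mu chi : degen mu chi -> degen chi mu -> orbit mu chi.
Proof.
move=> mc cm; have [f hf] := definable_orbit mu.
have rf := GRing.to_rform_rformula f.
pose q := GRing.quantifier_elim (@ClosedFieldQE.ex_elim k) (GRing.to_rform f).
have qP rho : reflect (orbit mu rho) (GRing.qf_eval (env rho) q).
  have okproj := ClosedFieldQE.holds_ex_elim (@GRing.solve_monicpoly k).
  have := GRing.quantifier_elim_rformP (@ClosedFieldQE.wf_ex_elim k) okproj (env rho) rf.
  by move/iffP; apply=> [/GRing.to_rformP/hf|/hf/GRing.to_rformP].
have /andP[qq rq] := GRing.quantifier_elim_wf (@ClosedFieldQE.wf_ex_elim k) rf.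
have [D [b [pD [x mx Dx] Db]]] := qf_eval_generic mu qq rq.
have b1 : b by rewrite -(Db _ (orbit_degen mx) Dx); apply/qP.
have [y cy Dy] : exists2 y, orbit chi y & D y != 0.
  apply: NNPP => D0; have /zariski_closureP/(_ D pD) Dx0 := degen_trans cm (orbit_degen mx).
  move: Dx; rewrite Dx0 ?eqxx // => y cy; apply/eqP/negPn/negP => Dy.
  by apply: D0; exists y.
have /qP my : GRing.qf_eval (env y) q.
  by rewrite (Db _ (degen_trans mc (orbit_degen cy)) Dy).
exact: orbit_trans my (orbit_sym cy).
Qed.

End Antisymmetry.

(** * One-parameter degenerations *)

Definition anticomm (k : fieldType) n (mu : structure k n) := forall x, smul mu x x = 0.

Lemma anticommC (k : fieldType) n (mu : structure k n) x y :
  anticomm mu -> smul mu x y = - smul mu y x.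
Proof.
move=> am; apply/eqP; rewrite -addr_eq0; have := am (x + y).
by rewrite smulDl !smulDr !am addr0 add0r => ->.
Qed.

Section Weights.
Variables (k : closedFieldType) (n : nat).
Implicit Types (mu chi : structure k n) (X : seq 'rV[k]_n) (s : seq (nat * nat * nat)).

(* The product prescribed by the table [s] for the vectors of 0-based ranks
   [i] and [j] of [X]; the table itself is 1-based. *)
Definition table_prod X s i j : 'rV[k]_n :=
  \sum_(t <- s) ((i.+1 == t.1.1) && (j.+1 == t.1.2))%:R *: X`_t.2.-1 -
  \sum_(t <- s) ((j.+1 == t.1.1) && (i.+1 == t.1.2))%:R *: X`_t.2.-1.

Lemma table_prodC X s i j : table_prod X s i j = - table_prod X s j i.
Proof. by rewrite opprB. Qed.

Lemma bvecE (i : 'I_n) : bvec k n i.+1 = 'e_i.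
Proof. by apply/rowP => j; rewrite !mxE. Qed.

Lemma anticomm_structure_delta s (i j : 'I_n) :
  (forall t, t \in s -> 0 < t.2 <= n)%N ->
  smul (anticomm_structure k n s) 'e_i 'e_j =
  table_prod [seq 'e_i | i : 'I_n] s i j.
Proof.
move=> sn; rewrite smul_anticomm_structure /table_prod -sumrB.
have coord (a : 'I_n) b : ('e_a *m (bvec k n b)^T) 0 0 = (a.+1 == b)%:R.
  rewrite mxE (bigD1 a) //= big1 ?addr0 => [|c ca]; last by rewrite !mxE (negPf ca) andbF mul0r.
  by rewrite !mxE !eqxx mul1r.
apply: eq_big_seq => -[[a b] l] /sn /= /andP[l0 ln].
have ll : (l.-1 < n)%N by rewrite prednK.
rewrite !coord -!natrM !mulnb -scalerBl; congr ((_ - _%:R) *: _).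
  by rewrite andbC.
rewrite (nth_map (Ordinal ll)) ?size_enum_ord //.
by rewrite (nth_ord_enum _ (Ordinal ll)) -bvecE /= prednK.
Qed.

Lemma invmx_uniq (A B : 'M[k]_n) : A *m B = 1%:M -> invmx A = B.
Proof.
by move=> AB; have [AU _] := mulmx1_unit AB; rewrite -[LHS]mulmx1 -AB mulKmx.
Qed.

Definition seqmx X : 'M[k]_n := \matrix_(i < n) X`_i.

Lemma delta_seqmx X i : 'e_i *m seqmx X = X`_i.
Proof. by rewrite -rowE rowK. Qed.

Lemma seqmx_unit X : size X = n -> free X -> seqmx X \in unitmx.
Proof.
move=> sX fX; rewrite -row_free_unit; apply: inj_row_free => v v0.
have /eqP tX := sX; have /freeP := fX : free (Tuple tX); move=> fX'.
apply/rowP => i; rewrite mxE; apply: (fX' (fun i => v 0 i)).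
by rewrite -[RHS]v0 mulmx_sum_row; apply: eq_bigr => j _; rewrite rowK.
Qed.

Lemma seqmxK X i : size X = n -> free X -> X`_i *m invmx (seqmx X) = bvec k n i.+1.
Proof.
move=> sX fX; have [ni|iN] := ltnP i n; last first.
  rewrite nth_default ?sX // mul0mx; apply/rowP => j; rewrite !mxE eqSS.
  by rewrite ltn_eqF // (leq_trans _ iN).
by rewrite -[i]/(val (Ordinal ni)) -delta_seqmx mulmxK ?seqmx_unit // bvecE.
Qed.

Lemma span_seqmx X (P : pred nat) v (l : 'I_n) : size X = n -> free X ->
  (v \in <<[seq X`_m | m <- iota 0 n & P m]>>)%VS -> ~~ P l ->
  (v *m invmx (seqmx X)) 0 l = 0.
Proof.
move=> sX fX; set r := map _ _ => vP Pl.
have {}vP : v \in <<in_tuple r>>%VS by [].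
rewrite (coord_span vP) mulmx_suml summxE big1 // => i _.
have := mem_tnth i (in_tuple r); rewrite (tnth_nth 0) => /mapP[m].
rewrite mem_filter => /andP[Pm _] ->.
rewrite -scalemxAl mxE seqmxK // mxE eqSS [_ == m]negbTE ?mulr0 //.
by apply: contraNneq Pl => ->.
Qed.

Lemma table_prod_coord s X (i j : 'I_n) : size X = n -> free X ->
  (forall t, t \in s -> 0 < t.2 <= n)%N ->
  table_prod X s i j *m invmx (seqmx X) = smul (anticomm_structure k n s) 'e_i 'e_j.
Proof.
move=> sX fX sn; rewrite anticomm_structure_delta // /table_prod mulmxBl !mulmx_suml.
have E t : t \in s -> X`_t.2.-1 *m invmx (seqmx X) = [seq 'e_i | i : 'I_n]`_t.2.-1.
  move=> /sn/andP[t0 tn]; have tt : (t.2.-1 < n)%N by rewrite prednK.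
  rewrite (nth_map (Ordinal tt)) ?size_enum_ord //.
  by rewrite (nth_ord_enum _ (Ordinal tt)) -bvecE seqmxK.
by congr (_ - _); apply: eq_big_seq => t /E Et; rewrite -scalemxAl Et.
Qed.

(** Both products are alternating, so a comparison modulo a symmetric family of subspaces need only
    be made for increasing indices. *)
Lemma table_prod_anticomm mu X s (i j : nat) (U : nat -> nat -> {vspace 'rV[k]_n}) :
  anticomm mu -> (forall a b, U a b = U b a) ->
  (forall a b, (a < b < n)%N -> smul mu X`_a X`_b - table_prod X s a b \in U a b) ->
  (i < n)%N -> (j < n)%N -> smul mu X`_i X`_j - table_prod X s i j \in U i j.
Proof.
move=> am UC UX ni nj; have [ij|ji|<-] := ltngtP i j.
- by rewrite UX ?ij.
- by rewrite anticommC // table_prodC -opprD memvN UC UX ?ji.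
by rewrite am /table_prod subrr subr0 mem0v.
Qed.

Lemma recognize mu X s : anticomm mu -> size X = n -> free X ->
  (forall t, t \in s -> 0 < t.2 <= n)%N ->
  (forall a b, (a < b < n)%N -> smul mu X`_a X`_b = table_prod X s a b) ->
  orbit mu (anticomm_structure k n s).
Proof.
move=> am sX fX sn sX'; apply/orbitP; exists (invmx (seqmx X)).
  by rewrite unitmx_inv seqmx_unit.
apply: eq_structure => i j; rewrite smul_act invmxK !delta_seqmx.
rewrite -(table_prod_coord _ _ sX fX sn); congr (_ *m _); apply/esym/eqP.
rewrite -subr_eq0 -memv0; apply: (table_prod_anticomm (U := fun _ _ => 0%VS)) => //.
by move=> a b /sX' ->; rewrite subrr mem0v.
Qed.

(* The degeneration is [t -> 0] in the bases [t ^ (q i) X_i]. *)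
Lemma weight_degen mu X s (q : nat -> nat) : anticomm mu -> size X = n -> free X ->
  (forall t, t \in s -> 0 < t.2 <= n)%N ->
  (forall t, t \in s ->
    [/\ 0 < t.1.1, 0 < t.1.2 & q t.2.-1 = q t.1.1.-1 + q t.1.2.-1])%N ->
  (forall a b, (a < b < n)%N -> smul mu X`_a X`_b - table_prod X s a b \in
    <<[seq X`_m | m <- iota 0 n & (q m < q a + q b)%N]>>%VS) ->
  degen mu (anticomm_structure k n s).
Proof.
move=> am sX fX sn sq sX'; set G := seqmx X.
have GU : G \in unitmx by apply: seqmx_unit.
pose c (i j : 'I_n) := smul mu X`_i X`_j *m invmx G.
pose chi := anticomm_structure k n s.
have ct (i j l : 'I_n) : (q i + q j <= q l)%N -> c i j 0 l = smul chi 'e_i 'e_j 0 l.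
  move=> ijl; apply/eqP; rewrite -subr_eq0 -(table_prod_coord _ _ sX fX sn); apply/eqP.
  have subE (A B : 'rV[k]_n) : A 0 l - B 0 l = (A - B) 0 l by rewrite !mxE.
  rewrite subE -mulmxBl; apply: (span_seqmx sX fX (P := fun m => (q m < q i + q j)%N));
    last by rewrite -leqNgt.
  apply: (table_prod_anticomm (U := fun a b =>
    <<[seq X`_m | m <- iota 0 n & (q m < q a + q b)%N]>>%VS)) => // a b.
  by rewrite addnC.
have t0 (i j l : 'I_n) : q l != (q i + q j)%N -> smul chi 'e_i 'e_j 0 l = 0.
  move=> ijl; rewrite anticomm_structure_delta // /table_prod.
  have E a b (t : nat * nat * nat) : t \in s -> q l != (q a + q b)%N ->
     ((((a.+1 == t.1.1) && (b.+1 == t.1.2))%:R : k) *: [seq 'e_i | i : 'I_n]`_t.2.-1) 0 l = 0.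
    move=> ts qab; rewrite mxE; case: andP => [[/eqP ta /eqP tb]|_]; last by rewrite mul0r.
    have /andP[t20 t2n] := sn _ ts; have tt : (t.2.-1 < n)%N by rewrite prednK.
    have [_ _] := sq _ ts; rewrite -ta -tb /= => qt.
    rewrite (nth_map (Ordinal tt)) ?size_enum_ord // (nth_ord_enum _ (Ordinal tt)) mxE.
    rewrite eqxx /= -val_eqE /= [_ == _]negbTE ?mulr0 //.
    by apply: contraNneq qab => ->; rewrite qt.
  rewrite mxE summxE [X in _ + X]mxE summxE !big1_seq ?subr0 // => t /andP[_ ts].
    by apply: E => //; rewrite addnC.
  exact: E.
(* This is [mu] in the scaled basis. Coefficients with [q l] above [q i + q j] vanish by [ct] and
   [t0], so setting them to 0 changes nothing and leaves no negative power of t. *)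
pose M t := of_tensor (fun i j => \row_l
  (if (q l <= q i + q j)%N then c i j 0 l * t ^+ (q i + q j - q l) else 0)).
have M0 : M 0 = chi.
  apply: eq_structure => i j; rewrite smul_of_tensor; apply/rowP => l; rewrite mxE.
  case: ltngtP => [lt|lt|eql].
  - rewrite t0 ?ltn_eqF // expr0n subn_eq0 leqNgt lt mulr0 //.
  - by rewrite t0 // gtn_eqF.
  by rewrite eql subnn expr0 mulr1 ct ?eql.
rewrite -/chi -M0; refine (@zariski_closure_path _ _ (orbit mu) M (fun t => t) 1 0 _ _ _ _).
- apply: polymx_of_tensor => i j a l; have [ijl|ijl] := leqP (q l) (q i + q j)%N.
    apply: (@polyfn_ext _ _ _ _ (fun t => c i j 0 l * t ^+ (q i + q j - q l)%N)).
      by move=> t; rewrite [RHS]mxE ijl.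
    apply: polyfn_mul; first exact: polyfn_const.
    exact/polyfn_exp/(polyfn_var (fun _ t => t) tt).
  by apply: polyfn_ext (polyfn_const _ 0) => t; rewrite mxE leqNgt ijl.
- exact: (polyfn_var (fun _ t => t) tt).
- exact: oner_neq0.
move=> t tn0; pose D : 'M[k]_n := diag_mx (\row_i t ^+ q i).
pose E : 'M[k]_n := diag_mx (\row_i t ^- q i).
have ED : E *m D = 1%:M.
  rewrite mulmx_diag; apply/matrixP => i j; rewrite !mxE; congr (_ *+ _).
  by rewrite mulVf // expf_neq0.
have gV : invmx (invmx G *m E) = D *m G.
  by apply: invmx_uniq; rewrite mulmxA -(mulmxA _ E) ED mulmx1 mulVmx.
apply/orbitP; exists (invmx G *m E).
  by rewrite unitmx_mul unitmx_inv GU; case/mulmx1_unit: ED.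
apply: eq_structure => i j; rewrite smul_of_tensor smul_act gV.
have dD (a : 'I_n) : ('e_a : 'rV[k]_n) *m D = t ^+ q a *: 'e_a.
  by rewrite -(rowE a D) row_diag_mx mxE.
rewrite !mulmxA !dD -!scalemxAl !delta_seqmx smulZl smulZr -!scalemxAl scalerA.
rewrite -/(c i j); move: (c i j) (ct i j) (t0 i j) => w wt w0.
apply/rowP => l; rewrite mul_mx_diag !mxE -exprD; case: leqP => ijl.
  by rewrite -[in RHS](subnK ijl) exprD mulrC -mulrA [w 0 l / _]mulrC mulVKf ?expf_neq0.
by rewrite wt ?(ltnW ijl) // w0 ?gtn_eqF // mul0r mulr0.
Qed.

End Weights.

(** * Closed conditions *)

Section ClosedConditions.
Variables (k : closedFieldType) (n : nat).
Implicit Types (mu chi : structure k n).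

Lemma degen_closed (J : Type) (F : J -> structure k n -> k) mu chi :
  (forall j, polyfn (@entry k (n * n) n) (F j)) ->
  (forall rho, orbit mu rho -> forall j, F j rho = 0) ->
  degen mu chi -> forall j, F j chi = 0.
Proof.
by move=> pF F0 /zariski_closureP mc j; apply: mc => // rho mr; apply: F0.
Qed.

Lemma polymx_smul_id x y :
  polymx (@entry k (n * n) n) (fun mu => smul mu x y).
Proof.
apply: polymx_smul; try exact: polymx_const.
by move=> a l; apply: (polyfn_var _ (a, l)).
Qed.

Lemma anticomm_degen mu chi : degen mu chi -> anticomm mu -> anticomm chi.
Proof.
move=> mc am x; apply/rowP => j; rewrite [RHS]mxE.
apply: (@degen_closed _ (fun j mu => smul mu x x 0 j)) mc j.
  by move=> j; apply: polymx_smul_id.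
by move=> rho /orbitP[g _ ->] j; rewrite smul_act am mul0mx mxE.
Qed.

(** The index is explicit because, for a fixed [m], nilpotency is a polynomial identity in the
    structure and passes to closures. *)
Definition engel_index m mu := forall a b, iter m (smul mu a) b = 0.

Lemma engel_degen m mu chi : degen mu chi -> engel_index m mu -> engel_index m chi.
Proof.
move=> mc em a b; apply/rowP => j; rewrite [RHS]mxE.
apply: (@degen_closed _ (fun j mu => iter m (smul mu a) b 0 j)) mc j.
  elim: m {em} => [|m IH] j /=; first exact: polyfn_const.
  apply: polymx_smul; [|exact: polymx_const|by move=> c l; rewrite (ord1 c)].
  by move=> c l; apply: (polyfn_var _ (c, l)).
move=> rho /orbitP[g gU ->] j.
suff -> : iter m (smul (act g mu) a) b =
    iter m (smul mu (a *m invmx g)) (b *m invmx g) *m g by rewrite em mul0mx mxE.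
elim: m {em} => [|m IH] /=; first by rewrite mulmxKV.
by rewrite IH smul_act mulmxK.
Qed.

Definition cube0 mu := forall x y z, smul mu x (smul mu y z) = 0.

Lemma cube0_degen mu chi : degen mu chi -> cube0 mu -> cube0 chi.
Proof.
move=> mc cm x y z; apply/rowP => j; rewrite [RHS]mxE.
apply: (@degen_closed _ (fun j mu => smul mu x (smul mu y z) 0 j)) mc j.
  move=> j; apply: polymx_smul; [|exact: polymx_const|exact: polymx_smul_id].
  by move=> c l; apply: (polyfn_var _ (c, l)).
by move=> rho /orbitP[g gU ->] j; rewrite !smul_act mulmxK // cm mul0mx mxE.
Qed.

(* All upper bounds on ranks (of the algebra square, of the left
   multiplications modulo the annihilator, of the forms [f (x y)]) are of this
   kind, for suitable index functions [a], [b], [c]. *)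
Definition det_cond r (a b c : nat -> nat -> nat) mu :=
  forall (x : nat -> 'rV[k]_n) (f : nat -> 'cV[k]_n),
    \det (\matrix_(i < r, j < r)
      (smul mu (x (a i j)) (x (b i j)) *m f (c i j)) 0 0) = 0.

Lemma det_cond_degen r a b c mu chi :
  degen mu chi -> det_cond r a b c mu -> det_cond r a b c chi.
Proof.
move=> mc cm x f.
apply: (@degen_closed unit (fun _ mu => \det (\matrix_(i < r, j < r)
      (smul mu (x (a i j)) (x (b i j)) *m f (c i j)) 0 0))) mc tt => [_|].
  apply: polyfn_det => i j.
  apply: (@polyfn_ext _ _ _ _ (fun mu =>
    (smul mu (x (a i j)) (x (b i j)) *m f (c i j)) 0 0)).
    by move=> rho; rewrite [RHS]mxE.
  by apply: polymx_mul; [apply: polymx_smul_id | apply: polymx_const].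
move=> rho /orbitP[g gU ->] _.
rewrite -[RHS](cm (fun i => x i *m invmx g) (fun j => g *m f j)).
by congr (\det _); apply/matrixP => i j; rewrite [LHS]mxE [RHS]mxE smul_act mulmxA.
Qed.

(* dim A^2 < r *)
Definition square_lt r := det_cond r (fun i _ => i.*2) (fun i _ => i.*2.+1) (fun _ j => j).
(* codim Ann A < r *)
Definition coann_lt r := det_cond r (fun i _ => i) (fun _ j => r + j)%N (fun _ j => j).
(* The forms [f (x y)] have rank < 4; the column shift makes the symplectic
   form diagonal. *)
Definition forms_lt4 := det_cond 4 (fun i _ => i) (fun _ j => (j + 2) %% 4)%N (fun _ _ => 0).
(** The cyclic products x0 x1, x1 x2, x2 x0 of any three vectors are linearly dependent. *)
Definition triple_dep := det_cond 3 (fun i _ => i) (fun i _ => i.+1 %% 3)%N (fun _ j => j).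

Lemma det_mulmx_small r s (A : 'M[k]_(r, s)) (B : 'M[k]_(s, r)) :
  (s < r)%N -> \det (A *m B) = 0.
Proof.
move=> sr; apply/eqP; apply: contraTT sr; rewrite -unitfE -unitmxE -leqNgt.
move=> /mxrank_unit {1}<-; apply: leq_trans (mxrankM_maxl _ _) _.
exact: rank_leq_col.
Qed.

Lemma det_diag_neq0 r (A : 'M[k]_r) :
  (forall i j, i != j -> A i j = 0) -> (forall i, A i i != 0) -> \det A != 0.
Proof.
move=> A0 Ai; have -> : A = diag_mx (\row_i A i i).
  apply/matrixP => i j; rewrite !mxE; have [->|/A0 ->] := eqVneq; first by rewrite mulr1n.
  by rewrite mulr0n.
by rewrite det_diag; apply/prodf_neq0 => i _; rewrite mxE.
Qed.

(** The tested matrix factors through a space of dimension [s], so its determinant of size [r]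
    vanishes. The bound for [coann_lt] has the same reason. *)
Lemma square_lt_bound r s mu (c : nat -> 'rV[k]_n -> 'rV[k]_n -> k) (w : nat -> 'rV[k]_n) :
  (s < r)%N -> (forall x y, smul mu x y = \sum_(i < s) c i x y *: w i) ->
  square_lt r mu.
Proof.
move=> sr E x f; rewrite -(det_mulmx_small (\matrix_(i < r, l < s)
   c l (x i.*2) (x i.*2.+1)) (\matrix_(l < s, j < r) (w l *m f j) 0 0) sr).
congr (\det _); apply/matrixP => i j; rewrite [LHS]mxE [RHS]mxE E mulmx_suml summxE.
by apply: eq_bigr => l _; rewrite -scalemxAl [LHS]mxE [X in _ = X * _]mxE [X in _ = _ * X]mxE.
Qed.

Lemma coann_lt_bound r s mu (c : nat -> 'rV[k]_n -> k) (w : nat -> 'rV[k]_n -> 'rV[k]_n) :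
  (s < r)%N -> (forall x y, smul mu x y = \sum_(i < s) c i x *: w i y) ->
  coann_lt r mu.
Proof.
move=> sr E x f; rewrite -(det_mulmx_small (\matrix_(i < r, l < s)
   c l (x i)) (\matrix_(l < s, j < r) (w l (x (r + j)%N) *m f j) 0 0) sr).
congr (\det _); apply/matrixP => i j; rewrite [LHS]mxE [RHS]mxE E mulmx_suml summxE.
by apply: eq_bigr => l _; rewrite -scalemxAl [LHS]mxE [X in _ = X * _]mxE [X in _ = _ * X]mxE.
Qed.

(** For a product c(x) w(y) - c(y) w(x), each form f(xy) is a sum of two rank-one terms. *)
Lemma forms_lt4_bound mu (c : 'rV[k]_n -> k) (w : 'rV[k]_n -> 'rV[k]_n) :
  (forall x y, smul mu x y = c x *: w y - c y *: w x) -> forms_lt4 mu.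
Proof.
move=> E x f.
rewrite -(det_mulmx_small (\matrix_(i < 4, l < 2)
   (if l == 0 then c (x i) else (w (x i) *m f 0%N) 0 0))
   (\matrix_(l < 2, j < 4)
   (if l == 0 then (w (x ((j + 2) %% 4)%N) *m f 0%N) 0 0 else - c (x ((j + 2) %% 4)%N))))
   //.
congr (\det _); apply/matrixP => i j; rewrite [LHS]mxE [RHS]mxE E !big_ord_recl big_ord0.
by rewrite mulmxBl -!scalemxAl !mxE /=; ring.
Qed.

Lemma triple_dep_bound mu (c : 'rV[k]_n -> k) (w : 'rV[k]_n -> 'rV[k]_n) :
  (forall x y, smul mu x y = c x *: w y - c y *: w x) -> triple_dep mu.
Proof.
move=> E x f.
(* The matrix [K] is singular: it kills the column of the values c(x_0), c(x_1), c(x_2). *)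
pose K := \matrix_(i < 3, j < 3)
  (c (x i) * (j == i.+1 %% 3 :> nat)%N%:R - c (x (i.+1 %% 3)%N) * (j == i)%:R).
have -> : \matrix_(i < 3, j < 3) (smul mu (x i) (x (i.+1 %% 3)%N) *m f j) 0 0 =
    K *m \matrix_(i < 3, j < 3) (w (x i) *m f j) 0 0.
  apply/matrixP => i j; rewrite [LHS]mxE [RHS]mxE E !big_ord_recl big_ord0.
  rewrite mulmxBl -!scalemxAl !mxE /=.
  by case: i => [[|[|[|//]]] lti] /=; ring.
rewrite det_mulmx [\det K](_ : _ = 0) ?mul0r //.
rewrite (expand_det_row _ 0) !big_ord_recl big_ord0 /cofactor.
rewrite !(expand_det_row _ 0) !big_ord_recl !big_ord0 /cofactor !det_mx11 !mxE /=.
by rewrite /bump /=; ring.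
Qed.

End ClosedConditions.

(** * Closed conditions on the examples *)

Section Values.
Variables (k : closedFieldType) (n : nat).
Local Notation b := (bvec k n).
Local Notation coo a x := ((x *m (bvec k n a)^T) 0 0).

Lemma bvec_dot a c : (0 < a <= n)%N -> coo c (b a) = (a == c)%:R.
Proof.
case: a => // a /andP[_ an].
rewrite (bvecE _ (Ordinal an)) -(rowE (Ordinal an) (b c)^T) !mxE.
by [].
Qed.

Lemma anticomm_anticomm_structure s : anticomm (anticomm_structure k n s).
Proof.
move=> x; rewrite smul_anticomm_structure big1 // => -[[i j] l] _.
by rewrite mulrC subrr scale0r.
Qed.

Definition table_ok (s : seq (nat * nat * nat)) := all (fun t => 0 < t.2 <= n)%N s.

Definition table_coef (s : seq (nat * nat * nat)) a c l : k :=
  \sum_(t <- s) (((a == t.1.1) && (c == t.1.2))%:R - ((a == t.1.2) && (c == t.1.1))%:R)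
     * (t.2 == l)%:R.

Lemma table_coefE s a c l : (0 < a <= n)%N -> (0 < c <= n)%N -> table_ok s ->
  (smul (anticomm_structure k n s) (b a) (b c) *m (b l)^T) 0 0 = table_coef s a c l.
Proof.
move=> an cn /allP sn; rewrite smul_anticomm_structure mulmx_suml summxE.
apply: eq_big_seq => -[[i j] m] /sn mn.
by rewrite -scalemxAl mxE !bvec_dot //= -!natrM !mulnb.
Qed.

(** The condition is tested on the basis vectors listed in [xs] and the coordinate functionals
    listed in [fs]. These lists are chosen so that the tested matrix is diagonal with nonzero
    diagonal. *)
Lemma det_cond_fails r (p q c : nat -> nat -> nat) s (xs fs : seq nat) : table_ok s ->
  all (fun a => 0 < a <= n)%N xs ->
  (forall i j : 'I_r, p i j < size xs /\ q i j < size xs)%N ->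
  (forall i j : 'I_r,
     (table_coef s (nth 0 xs (p i j)) (nth 0 xs (q i j)) (nth 0 fs (c i j)) != 0%R)
     = (i == j))%N ->
  ~ det_cond r p q c (anticomm_structure k n s).
Proof.
move=> sok xsn pqs sE /(_ (fun i => b (nth 0 xs i)%N) (fun j => (b (nth 0 fs j)%N)^T)) /eqP.
have xn m : (m < size xs)%N -> (0 < nth 0 xs m <= n)%N.
  by move=> mx; apply: (allP xsn); apply: mem_nth.
apply/negP; apply: det_diag_neq0 => [i j ij|i]; rewrite mxE table_coefE ?xn //.
- by apply/eqP/negbFE; rewrite sE (negPf ij).
- by case: (pqs i j).
- by case: (pqs i j).
- by rewrite sE eqxx.
- by case: (pqs i i).
by case: (pqs i i).
Qed.

Ltac unfold_minor :=
  rewrite /table_coef ?big_cons ?big_nil /= ?eqxx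
    ?(mulr0, mul0r, mulr1, subr0, sub0r, addr0, add0r, subrr, oppr_eq0, oner_eq0, eqxx).

Lemma eta1_square : (3 <= n)%N -> ~ square_lt 1 (eta k n 1).
Proof.
move=> n3; apply: (@det_cond_fails _ _ _ _ _ [:: 1; 2]%N [:: 3]%N).
- by rewrite /table_ok /= n3.
- by rewrite /=; lia.
- by move=> i j; rewrite !ord1.
by move=> i j; rewrite !ord1; unfold_minor.
Qed.

Lemma eta2_coann : (5 <= n)%N -> ~ coann_lt 4 (eta k n 2).
Proof.
move=> n5; apply: (@det_cond_fails _ _ _ _ _ [:: 1; 2; 3; 4; 2; 1; 4; 3]%N [:: 5; 5; 5; 5]%N).
- by rewrite /table_ok /= n5.
- by rewrite /=; lia.
- by move=> [[|[|[|[|//]]]] ?] [[|[|[|[|//]]]] ?].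
by move=> [[|[|[|[|//]]]] ?] [[|[|[|[|//]]]] ?]; unfold_minor.
Qed.

Lemma eta2_forms : (5 <= n)%N -> ~ forms_lt4 (eta k n 2).
Proof.
move=> n5; apply: (@det_cond_fails _ _ _ _ _ [:: 1; 3; 2; 4]%N [:: 5]%N).
- by rewrite /table_ok /= n5.
- by rewrite /=; lia.
- by move=> [[|[|[|[|//]]]] ?] [[|[|[|[|//]]]] ?].
by move=> [[|[|[|[|//]]]] ?] [[|[|[|[|//]]]] ?]; unfold_minor.
Qed.

Lemma eta3_coann : (7 <= n)%N -> ~ coann_lt 4 (eta k n 3).
Proof.
move=> n7; apply: (@det_cond_fails _ _ _ _ _ [:: 1; 2; 3; 4; 2; 1; 4; 3]%N [:: 7; 7; 7; 7]%N).
- by rewrite /table_ok /= n7.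
- by rewrite /=; lia.
- by move=> [[|[|[|[|//]]]] ?] [[|[|[|[|//]]]] ?].
by move=> [[|[|[|[|//]]]] ?] [[|[|[|[|//]]]] ?]; unfold_minor.
Qed.

Lemma eta3_coann5 : (7 <= n)%N -> ~ coann_lt 5 (eta k n 3).
Proof.
move=> n7; apply: (@det_cond_fails _ _ _ _ _
  [:: 1; 2; 3; 4; 5; 2; 1; 4; 3; 6]%N [:: 7; 7; 7; 7; 7]%N).
- by rewrite /table_ok /= n7.
- by rewrite /=; lia.
- by move=> [[|[|[|[|[|//]]]]] ?] [[|[|[|[|[|//]]]]] ?].
by move=> [[|[|[|[|[|//]]]]] ?] [[|[|[|[|[|//]]]]] ?]; unfold_minor.
Qed.

Lemma eta3_forms : (7 <= n)%N -> ~ forms_lt4 (eta k n 3).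
Proof.
move=> n7; apply: (@det_cond_fails _ _ _ _ _ [:: 1; 3; 2; 4]%N [:: 7]%N).
- by rewrite /table_ok /= n7.
- by rewrite /=; lia.
- by move=> [[|[|[|[|//]]]] ?] [[|[|[|[|//]]]] ?].
by move=> [[|[|[|[|//]]]] ?] [[|[|[|[|//]]]] ?]; unfold_minor.
Qed.

Definition T22 := anticomm_structure k n [:: (1, 2, n - 1); (1, 3, n)]%N.

Lemma eqn_sub (a c d : nat) : (c < n)%N -> (d < n)%N -> (n - c == n - d)%N = (c == d).
Proof. lia. Qed.

Lemma eqn_subl d : (d < n)%N -> (n == n - d)%N = (d == 0)%N.
Proof. lia. Qed.

Lemma eqn_subr d : (d < n)%N -> (n - d == n)%N = (d == 0)%N.
Proof. lia. Qed.

Lemma T22_square : (5 <= n)%N -> ~ square_lt 2 T22.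
Proof.
move=> n5; apply: (@det_cond_fails _ _ _ _ _ [:: 1; 2; 1; 3]%N [:: n - 1; n]%N).
- by rewrite /table_ok /=; lia.
- by rewrite /=; lia.
- by move=> [[|[|//]] ?] [[|[|//]] ?].
by move=> [[|[|//]] ?] [[|[|//]] ?];
   unfold_minor; rewrite ?eqn_subl ?eqn_subr //; try lia; unfold_minor.
Qed.

Lemma eps23_square2 : (6 <= n)%N -> ~ square_lt 2 (T22_eps23 k n).
Proof.
move=> nN; apply: (@det_cond_fails _ _ _ _ _ [:: 1; 2; 1; 3]%N [:: n - 1; n]%N).
- by rewrite /table_ok /=; lia.
- by rewrite /=; lia.
- by move=> [[|[|//]] ?] [[|[|//]] ?].
by move=> [[|[|//]] ?] [[|[|//]] ?];
   unfold_minor; rewrite ?eqn_sub ?eqn_subl ?eqn_subr //; try lia; unfold_minor.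
Qed.

Lemma eps23_square3 : (6 <= n)%N -> ~ square_lt 3 (T22_eps23 k n).
Proof.
move=> nN; apply: (@det_cond_fails _ _ _ _ _ [:: 1; 2; 1; 3; 2; 3]%N [:: n - 1; n; n - 2]%N).
- by rewrite /table_ok /=; lia.
- by rewrite /=; lia.
- by move=> [[|[|[|//]]] ?] [[|[|[|//]]] ?].
by move=> [[|[|[|//]]] ?] [[|[|[|//]]] ?];
   unfold_minor; rewrite ?eqn_sub ?eqn_subl ?eqn_subr //; try lia; unfold_minor.
Qed.

Lemma eps23_triple : (6 <= n)%N -> ~ triple_dep (T22_eps23 k n).
Proof.
move=> nN; apply: (@det_cond_fails _ _ _ _ _ [:: 1; 2; 3]%N [:: n - 1; n - 2; n]%N).
- by rewrite /table_ok /=; lia.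
- by rewrite /=; lia.
- by move=> [[|[|[|//]]] ?] [[|[|[|//]]] ?].
by move=> [[|[|[|//]]] ?] [[|[|[|//]]] ?];
   unfold_minor; rewrite ?eqn_sub ?eqn_subl ?eqn_subr //; try lia; unfold_minor.
Qed.

Lemma eps24_square2 : (6 <= n)%N -> ~ square_lt 2 (T22_eps24 k n).
Proof.
move=> nN; apply: (@det_cond_fails _ _ _ _ _ [:: 1; 2; 1; 3]%N [:: n - 1; n]%N).
- by rewrite /table_ok /=; lia.
- by rewrite /=; lia.
- by move=> [[|[|//]] ?] [[|[|//]] ?].
by move=> [[|[|//]] ?] [[|[|//]] ?];
   unfold_minor; rewrite ?eqn_sub ?eqn_subl ?eqn_subr //; try lia; unfold_minor.
Qed.

Lemma eps24_coann : (6 <= n)%N -> ~ coann_lt 4 (T22_eps24 k n).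
Proof.
move=> nN; apply: (@det_cond_fails _ _ _ _ _ [:: 1; 2; 3; 4; 3; 4; 1; 2]%N [:: n; n; n; n]%N).
- by rewrite /table_ok /=; lia.
- by rewrite /=; lia.
- by move=> [[|[|[|[|//]]]] ?] [[|[|[|[|//]]]] ?].
by move=> [[|[|[|[|//]]]] ?] [[|[|[|[|//]]]] ?];
   unfold_minor; rewrite ?eqn_sub ?eqn_subl ?eqn_subr //; try lia; unfold_minor.
Qed.

Lemma eps24_forms : (6 <= n)%N -> ~ forms_lt4 (T22_eps24 k n).
Proof.
move=> nN; apply: (@det_cond_fails _ _ _ _ _ [:: 1; 2; 3; 4]%N [:: n]%N).
- by rewrite /table_ok /=; lia.
- by rewrite /=; lia.
- by move=> [[|[|[|[|//]]]] ?] [[|[|[|[|//]]]] ?].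
by move=> [[|[|[|[|//]]]] ?] [[|[|[|[|//]]]] ?];
   unfold_minor; rewrite ?eqn_sub ?eqn_subl ?eqn_subr //; try lia; unfold_minor.
Qed.

Lemma T3_square2 : (4 <= n)%N -> ~ square_lt 2 (T3 k n).
Proof.
move=> nN; apply: (@det_cond_fails _ _ _ _ _ [:: 1; 2; 1; 3]%N [:: 3; n]%N).
- by rewrite /table_ok /=; lia.
- by rewrite /=; lia.
- by move=> [[|[|//]] ?] [[|[|//]] ?].
have n3 : (n == 3)%N = false by lia.
by move=> [[|[|//]] ?] [[|[|//]] ?]; unfold_minor; rewrite ?[(3 == n)%N]eq_sym ?n3; unfold_minor.
Qed.

Lemma T222E : (7 <= n)%N ->
  T222 k n = anticomm_structure k n [:: (1, 2, n - 2); (1, 3, n - 1); (1, 4, n)]%N.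
Proof.
move=> n7; rewrite /T222 /=; congr (anticomm_structure _ _ [:: (_, _, _); (_, _, _); (_, _, _)]);
  lia.
Qed.

Lemma T222_square2 : (7 <= n)%N -> ~ square_lt 2 (T222 k n).
Proof.
move=> nN; rewrite T222E //.
apply: (@det_cond_fails _ _ _ _ _
  [:: 1; 2; 1; 3]%N [:: n - 2; n - 1]%N).
- by rewrite /table_ok /=; lia.
- by rewrite /=; lia.
- by move=> [[|[|//]] ?] [[|[|//]] ?].
by move=> [[|[|//]] ?] [[|[|//]] ?];
   unfold_minor; rewrite ?eqn_sub ?eqn_subl ?eqn_subr //; try lia; unfold_minor.
Qed.

Lemma T222_square3 : (7 <= n)%N -> ~ square_lt 3 (T222 k n).
Proof.
move=> nN; rewrite T222E //.
apply: (@det_cond_fails _ _ _ _ _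
  [:: 1; 2; 1; 3; 1; 4]%N [:: n - 2; n - 1; n]%N).
- by rewrite /table_ok /=; lia.
- by rewrite /=; lia.
- by move=> [[|[|[|//]]] ?] [[|[|[|//]]] ?].
by move=> [[|[|[|//]]] ?] [[|[|[|//]]] ?];
   unfold_minor; rewrite ?eqn_sub ?eqn_subl ?eqn_subr //; try lia; unfold_minor.
Qed.

Lemma T222_coann : (7 <= n)%N -> ~ coann_lt 4 (T222 k n).
Proof.
move=> nN; rewrite T222E //.
apply: (@det_cond_fails _ _ _ _ _
  [:: 1; 2; 3; 4; 2; 1; 1; 1]%N [:: n - 2; n - 2; n - 1; n]%N).
- by rewrite /table_ok /=; lia.
- by rewrite /=; lia.
- by move=> [[|[|[|[|//]]]] ?] [[|[|[|[|//]]]] ?].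
by move=> [[|[|[|[|//]]]] ?] [[|[|[|[|//]]]] ?];
   unfold_minor; rewrite ?eqn_sub ?eqn_subl ?eqn_subr //; try lia; unfold_minor.
Qed.

Lemma T3_cube : (4 <= n)%N -> ~ cube0 (T3 k n).
Proof.
move=> n4 /(_ (b 1) (b 1) (b 2)).
have E2 : smul (T3 k n) (b 1) (b 2) = b 3.
  rewrite smul_anticomm_structure !big_cons big_nil !bvec_dot /= ?eqxx; try lia.
  by rewrite !(oppr0, mulr0, mul0r, mulr1, subr0, scale1r, scale0r, addr0, add0r).
have E3 : smul (T3 k n) (b 1) (b 3) = b n.
  rewrite smul_anticomm_structure !big_cons big_nil !bvec_dot /= ?eqxx; try lia.
  by rewrite !(oppr0, mulr0, mul0r, mulr1, subr0, scale1r, scale0r, addr0, add0r).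
rewrite E2 E3 => bn; have := @bvec_dot n n.
rewrite bn mul0mx mxE eqxx leqnn (leq_trans _ n4) // => /(_ isT)/eqP.
by rewrite eq_sym oner_eq0.
Qed.

(** The square is spanned by the vectors [b t.2]; none of them occurs as a factor in the table, so
    multiplying again gives zero. *)
Lemma cube0_table s : table_ok s ->
  all (fun t => all (fun u => (t.2 != u.1.1) && (t.2 != u.1.2)) s) s ->
  cube0 (anticomm_structure k n s).
Proof.
move=> /allP sok /allP ss x y z; rewrite smul_anticomm_structure big1_seq //.
have z0 a : all (fun t => t.2 != a) s -> coo a (smul (anticomm_structure k n s) y z) = 0.
  move=> /allP sa; rewrite smul_anticomm_structure mulmx_suml summxE big1_seq //.
  move=> [[i j] l] /andP[_ ts]; rewrite -scalemxAl mxE bvec_dot ?(sok _ ts) //.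
  by rewrite (negPf (sa _ ts)) mulr0.
move=> [[i j] l] /andP[_ ts]; rewrite !z0 ?mulr0 ?subrr ?scale0r //.
  by apply/allP => u /ss/allP/(_ _ ts)/andP[].
by apply/allP => u /ss/allP/(_ _ ts)/andP[].
Qed.

Lemma square_lt_table r s : (size s < r)%N -> square_lt r (anticomm_structure k n s).
Proof.
move=> sr; pose t0 := (0, 0, 0)%N.
apply: (square_lt_bound (c := fun i x y =>
  coo (nth t0 s i).1.1 x * coo (nth t0 s i).1.2 y -
  coo (nth t0 s i).1.2 x * coo (nth t0 s i).1.1 y)
  (w := fun i => b (nth t0 s i).2)) sr _ => x y.
rewrite smul_anticomm_structure (big_nth t0) big_mkord.
by apply: eq_bigr => i _; case: (nth _ _ _) => -[].
Qed.

Lemma square_lt_eta m : square_lt 2 (eta k n m).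
Proof.
apply: (square_lt_bound (s := 1) (w := fun _ => b (2 * m + 1)%N)
  (c := fun _ x y => \sum_(i <- iota 1 m)
     (coo (2 * i - 1)%N x * coo (2 * i)%N y - coo (2 * i)%N x * coo (2 * i - 1)%N y))) => //.
move=> x y; rewrite big_ord1 smul_anticomm_structure big_map scaler_suml.
by apply: eq_bigr.
Qed.

(** Since all factors have their index in [L], the left factor may be replaced by its coordinates on
    [L], which gives at most [size L] terms c_i(x) w_i(y). *)
Lemma coann_lt_table r s (L : seq nat) : (size L < r)%N -> uniq L ->
  all (fun a => 0 < a <= n)%N L ->
  all (fun t => (t.1.1 \in L) && (t.1.2 \in L)) s ->
  coann_lt r (anticomm_structure k n s).
Proof.
move=> Lr uL /allP Ln /allP sL.
apply: (coann_lt_bound (c := fun i x => coo (nth 0%N L i) x)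
   (w := fun i y => smul (anticomm_structure k n s) (b (nth 0%N L i)) y)) Lr _ => x y.
rewrite -(big_mkord xpredT (fun i => coo (nth 0%N L i) x *:
  smul (anticomm_structure k n s) (b (nth 0%N L i)) y)).
rewrite -(big_nth 0%N xpredT (fun a => coo a x *:
  smul (anticomm_structure k n s) (b a) y)).
rewrite smul_anticomm_structure.
under [RHS]eq_bigr => a _ do rewrite smul_anticomm_structure scaler_sumr.
rewrite exchange_big; apply: eq_big_seq => -[[i j] l] /sL/= /andP[iL jL].
have pick c : c \in L -> \sum_(a <- L) coo a x * coo c (b a) = coo c x.
  move=> cL; rewrite (bigD1_seq c) //= bvec_dot ?Ln // eqxx mulr1 big1_seq ?addr0 //.
  by move=> a /andP[ac aL]; rewrite bvec_dot ?Ln // (negPf ac) mulr0.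
under eq_bigr => a _ do rewrite scalerA mulrBr !mulrA.
by rewrite -scaler_suml sumrB -!mulr_suml !pick.
Qed.

(** When every listed product has e_1 as left factor, the multiplication takes the shape c(x) w(y) -
    c(y) w(x) required by [forms_lt4_bound] and [triple_dep_bound]. *)
Lemma row_table s x y : all (fun t => t.1.1 == 1%N) s ->
  smul (anticomm_structure k n s) x y =
  coo 1 x *: (\sum_(t <- s) coo t.1.2 y *: b t.2) -
  coo 1 y *: (\sum_(t <- s) coo t.1.2 x *: b t.2).
Proof.
move=> /allP s1; rewrite smul_anticomm_structure !scaler_sumr -sumrB.
apply: eq_big_seq => -[[i j] l] /s1 /= /eqP ->.
by rewrite !scalerA -scalerBl [coo j x * _]mulrC.
Qed.

End Values.

(** * Criteria for degenerations to the examples *)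

Section Free.
Variables (k : fieldType) (n : nat).
Local Notation V := 'rV[k]_n.
Implicit Types (X Y A B : seq V).

(** Coefficients are indexed by all natural numbers, so that for an explicit list the sum unfolds
    without ordinals. *)
Definition lincomb (c : nat -> k) X : V := \sum_(i < size X) c i *: X`_i.

Lemma lincomb_cons c v X : lincomb c (v :: X) = c 0%N *: v + lincomb (c \o S) X.
Proof. by rewrite /lincomb big_ord_recl. Qed.

Lemma lincomb_nil c : lincomb c [::] = 0.
Proof. by rewrite /lincomb big_ord0. Qed.

Lemma free_coef X c : free X -> lincomb c X = 0 -> forall i, (i < size X)%N -> c i = 0.
Proof.
move=> fX cX i iX; have /freeP {}fX : free (in_tuple X) by [].
exact: (fX (fun i => c i) cX (Ordinal iX)).
Qed.

Lemma coef_free X :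
  (forall c, lincomb c X = 0 -> forall i, (i < size X)%N -> c i = 0) -> free X.
Proof.
move=> H; suff : free (in_tuple X) by []; apply/freeP => c c0 i.
have E (j : 'I_(size X)) : c j = (if insub (j : nat) is Some j' then c j' else 0).
  by rewrite valK.
rewrite E; apply: (H (fun j => if insub j is Some j' then c j' else 0)) => //.
by rewrite -[RHS]c0; apply: eq_bigr => j _; rewrite -E.
Qed.

Lemma mem_lincomb X v : v \in <<X>>%VS -> exists c, v = lincomb c X.
Proof.
move=> vX; have {}vX : v \in <<in_tuple X>>%VS by [].
exists (fun j => if insub j is Some j' then coord (in_tuple X) j' v else 0).
by rewrite {1}(coord_span vX); apply: eq_bigr => j _; rewrite valK.
Qed.

Lemma lincomb_mem c X (U : {vspace V}) :
  (forall v, v \in X -> v \in U) -> lincomb c X \in U.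
Proof.
by move=> XU; apply: memv_suml => i _; apply/memvZ/XU/mem_nth/ltn_ord.
Qed.

Lemma free_cat_coef A B : free B ->
  (forall c, lincomb c A \in <<B>>%VS -> forall i, (i < size A)%N -> c i = 0) ->
  free (A ++ B).
Proof.
move=> fB H; rewrite cat_free fB andTb; apply/andP; split.
  by apply: coef_free => c c0; apply: H; rewrite c0 mem0v.
apply/directv_addP/eqP; rewrite -subv0; apply/subvP => v.
rewrite memv_cap => /andP[/mem_lincomb[c ->] cB]; rewrite memv0 /lincomb big1 // => i _.
by rewrite (H c cB i) ?scale0r.
Qed.

Lemma free2P (u v : V) : free [:: u; v] -> forall a b, a *: u + b *: v = 0 -> a = 0 /\ b = 0.
Proof.
move=> f a b ab; have := free_coef (c := nth 0 [:: a; b]) f.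
rewrite !lincomb_cons lincomb_nil /= addr0 => /(_ ab) H.
by split; [apply: (H 0%N) | apply: (H 1%N)].
Qed.

Lemma free3P (u v w : V) : free [:: u; v; w] ->
  forall a b c, a *: u + (b *: v + c *: w) = 0 -> [/\ a = 0, b = 0 & c = 0].
Proof.
move=> f a b c abc; have := free_coef (c := nth 0 [:: a; b; c]) f.
rewrite !lincomb_cons lincomb_nil /= addr0 => /(_ abc) H.
by split; [apply: (H 0%N) | apply: (H 1%N) | apply: (H 2%N)].
Qed.

Lemma dim_rV : \dim {:V} = n.
Proof. by rewrite dimvf dim_matrix mul1r. Qed.

Lemma free_size X : free X -> (size X <= n)%N.
Proof.
by move=> /eqP fX; rewrite -fX -[leqRHS]dim_rV dimvS ?subvf.
Qed.

(** The new vectors form a basis of a complement inside [U], which keeps them in the annihilator or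
    in the kernel of a functional. They go between [A] and [B] because the tables name factors by
    the first indices and many products by the last ones. *)
Lemma complete_in A B (U : {vspace V}) :
  free (A ++ B) -> (<<A ++ B>> + U)%VS = fullv ->
  exists Z, [/\ size (A ++ Z ++ B) = n, free (A ++ Z ++ B) & forall z, z \in Z -> z \in U].
Proof.
move=> fAB ABU; pose W := (U :\: <<A ++ B>>)%VS.
have bW := vbasisP W; pose Z : seq V := vbasis W.
have P : perm_eq (Z ++ (A ++ B)) (A ++ Z ++ B) by rewrite perm_catCA.
have fZ : free (Z ++ (A ++ B)).
  rewrite cat_free (basis_free bW) fAB /=; apply/directv_addP.
  by rewrite (span_basis bW) capv_diff.
have full : <<Z ++ (A ++ B)>>%VS = fullv.
  by rewrite span_cat (span_basis bW) addv_diff addvC.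
exists Z; split; first 1 last.
- by rewrite -(perm_free P).
- by move=> z /vbasis_mem; apply/subvP/diffvSl.
rewrite -(perm_size P); move/eqP: (fZ) => <-.
by rewrite full dim_rV.
Qed.

Lemma complete A B : free (A ++ B) ->
  exists Z, size (A ++ Z ++ B) = n /\ free (A ++ Z ++ B).
Proof.
move=> fAB; have [|Z [sZ fZ _]] := complete_in (U := fullv) fAB.
  by apply/eqP; rewrite eqEsubv subvf addvSr.
by exists Z.
Qed.

End Free.

(** * Weighted degenerations to the listed algebras, annihilators and functionals *)

Section Criteria.
Variables (k : closedFieldType) (n : nat).
Local Notation V := 'rV[k]_n.
Implicit Types (mu chi : structure k n) (X Y A B : seq V).

Lemma span_full X (P : pred nat) v : size X = n -> free X ->
  (forall l, (l < n)%N -> P l) -> v \in <<[seq X`_m | m <- iota 0 n & P m]>>%VS.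
Proof.
move=> sX fX Pl; rewrite (_ : [seq X`_m | m <- iota 0 n & P m] = X).
  suff -> : <<X>>%VS = fullv by apply: memvf.
  by apply/eqP; rewrite eqEdim subvf dim_rV (eqP fX) sX leqnn.
rewrite (_ : [seq m <- iota 0 n | P m] = iota 0 n); last first.
  by apply/all_filterP/allP => l; rewrite mem_iota => /andP[_ /Pl].
by have := mkseq_nth 0 X; rewrite /mkseq sX.
Qed.

Lemma lincomb_full X v : size X = n -> free X -> exists c, v = lincomb c X.
Proof.
move=> sX fX; apply: mem_lincomb; suff -> : <<X>>%VS = fullv by apply: memvf.
by apply/eqP; rewrite eqEdim subvf dim_rV (eqP fX) sX leqnn.
Qed.

Lemma nth_tail A B i : size (A ++ B) = n -> (i < size B)%N ->
  (A ++ B)`_(n - size B + i) = B`_i.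
Proof.
rewrite size_cat nth_cat => sAB iB.
have -> : (n - size B)%N = size A by lia.
by rewrite ltnNge leq_addr /= addKn.
Qed.

(** Indices beyond [W] get the default weight 4, the largest one. A pair of total weight above 4
    imposes no condition, in particular any pair with an index beyond [W]. *)
Lemma weight_degen4 mu X s (W : seq nat) : anticomm mu -> size X = n -> free X ->
  all (fun w => 0 < w <= 4)%N W ->
  all (fun t => [&& 0 < t.2 <= n, 0 < t.1.1, 0 < t.1.2 &
     nth 4 W t.2.-1 == nth 4 W t.1.1.-1 + nth 4 W t.1.2.-1])%N s ->
  (forall a b, (a < b)%N -> (b < size W)%N -> (nth 4 W a + nth 4 W b <= 4)%N ->
    smul mu X`_a X`_b = table_prod X s a b) ->
  degen mu (anticomm_structure k n s).
Proof.
move=> am sX fX /allP W4 /allP sW XX.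
have W04 a : (0 < nth 4 W a <= 4)%N.
  by have [aW|Wa] := ltnP a (size W); [apply/W4/mem_nth | rewrite nth_default].
apply: (@weight_degen _ _ mu X s (nth 4%N W)) => // [t /sW|t /sW|a b /andP[ab bn]].
- by case/and4P.
- by case/and4P => _ ? ? /eqP.
have [small|big] := leqP (nth 4 W a + nth 4 W b) 4; last first.
  by apply: span_full => // l _; apply: leq_ltn_trans big; case/andP: (W04 l).
rewrite XX ?subrr ?mem0v // ltnNge; apply: contraTN small => Wb.
by rewrite [nth _ _ b]nth_default // -ltnNge -addn1 addnC leq_add2r; case/andP: (W04 a).
Qed.

Lemma table_prod_nil X a b : table_prod X [::] a b = 0.
Proof. by rewrite /table_prod !big_nil subrr. Qed.

Lemma table_prod_cons X t s a b : table_prod X (t :: s) a b =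
  (((a.+1 == t.1.1) && (b.+1 == t.1.2))%:R - ((b.+1 == t.1.1) && (a.+1 == t.1.2))%:R)
    *: X`_t.2.-1 + table_prod X s a b.
Proof. by rewrite /table_prod !big_cons scalerBl opprD -!addrA (addrCA (- _)). Qed.

Definition table_prodE :=
  (table_prod_cons, table_prod_nil, subr0, sub0r, scale1r, scale0r, addr0, add0r, oppr0).

Lemma nth_last1 A u : size (A ++ [:: u]) = n -> (A ++ [:: u])`_n.-1 = u.
Proof.
by rewrite size_cat addn1 => sA; rewrite nth_cat (_ : n.-1 = size A) ?ltnn ?subnn //;
  exact: (congr1 predn (esym sA)).
Qed.

Lemma T3_degen mu a b : anticomm mu ->
  free [:: a; b; smul mu a b; smul mu a (smul mu a b)] ->
  (4 <= n)%N /\ degen mu (T3 k n).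
Proof.
move=> am fY; have /= n4 := free_size fY; split=> //.
have [Z [sX fX]] := complete (A := [:: a; b; smul mu a b])
  (B := [:: smul mu a (smul mu a b)]) fY.
have := sX; rewrite catA => /nth_last1; rewrite -catA /= => last.
(* With weights 1, 2, 3 for a, b, ab, only ab (weight 3) and a(ab) (weight 4) are light enough to be
   constrained. *)
apply: (@weight_degen4 _ _ _ [:: 1; 2; 3]%N am sX fX) => //.
  have q4 : nth 4%N [:: 1; 2; 3]%N n.-1 = 4%N by rewrite nth_default //=; lia.
  by rewrite /= q4; lia.
by move=> [|[|[|?]]] [|[|[|?]]] //= _ _ _; rewrite !table_prodE /= ?eqxx // last.
Qed.

Lemma eta1_degen mu a b : anticomm mu -> free [:: a; b; smul mu a b] ->
  (3 <= n)%N /\ degen mu (eta k n 1).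
Proof.
move=> am fY; have /= n3 := free_size fY; split=> //.
have [Z [sX fX]] := complete (A := [:: a; b; smul mu a b]) (B := [::]) fY.
apply: (@weight_degen4 _ _ _ [:: 1; 3; 4]%N am sX fX) => //; first by rewrite /= n3.
by move=> [|[|[|?]]] [|[|[|?]]] //= _ _ _; rewrite !table_prodE /= ?eqxx.
Qed.

Lemma T22_degen mu a b c : anticomm mu ->
  free [:: a; b; c; smul mu a b; smul mu a c] -> (5 <= n)%N /\ degen mu (T22 k n).
Proof.
move=> am fY; have /= n5 := free_size fY; split=> //.
have [Z [sX fX]] := complete (A := [:: a; b; c])
  (B := [:: smul mu a b; smul mu a c]) fY.
have := @nth_tail ([:: a; b; c] ++ Z) [:: smul mu a b; smul mu a c].
rewrite -catA => tail.
have t1 := tail 0%N sX isT; have t2 := tail 1%N sX isT.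
have n1 : (n - 2 + 0 = (n - 1).-1)%N by lia.
have n2 : (n - 2 + 1 = n.-1)%N by lia.
rewrite /= n1 in t1; rewrite /= n2 in t2.
(* The products ab and ac have weight 4, while bc has weight 6 and disappears. *)
apply: (@weight_degen4 _ _ _ [:: 1; 3; 3]%N am sX fX) => //.
  by rewrite /= !nth_default /=; lia.
by move=> [|[|[|?]]] [|[|[|?]]] //= _ _ _; rewrite !table_prodE /= ?eqxx.
Qed.

Lemma eps23_degen mu a b c : anticomm mu ->
  free [:: a; b; c; smul mu b c; smul mu a b; smul mu a c] ->
  (6 <= n)%N /\ degen mu (T22_eps23 k n).
Proof.
move=> am fY; have /= n6 := free_size fY; split=> //.
have [Z [sX fX]] := complete (A := [:: a; b; c])
  (B := [:: smul mu b c; smul mu a b; smul mu a c]) fY.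
have := @nth_tail ([:: a; b; c] ++ Z) [:: smul mu b c; smul mu a b; smul mu a c].
rewrite -catA => tail.
have t0 := tail 0%N sX isT; have t1 := tail 1%N sX isT; have t2 := tail 2%N sX isT.
have n0 : (n - 3 + 0 = (n - 2).-1)%N by lia.
have n1 : (n - 3 + 1 = (n - 1).-1)%N by lia.
have n2 : (n - 3 + 2 = n.-1)%N by lia.
rewrite /= n0 in t0; rewrite /= n1 in t1; rewrite /= n2 in t2.
(* Equal weights keep all three products ab, ac and bc at weight 4. *)
apply: (@weight_degen4 _ _ _ [:: 2; 2; 2]%N am sX fX) => //.
  by rewrite /= !nth_default /=; lia.
by move=> [|[|[|?]]] [|[|[|?]]] //= _ _ _; rewrite !table_prodE /= ?eqxx.
Qed.

Lemma T222_degen mu a b c d : anticomm mu ->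
  free [:: a; b; c; d; smul mu a b; smul mu a c; smul mu a d] ->
  (7 <= n)%N /\ degen mu (T222 k n).
Proof.
move=> am fY; have /= n7 := free_size fY; split=> //; rewrite T222E //.
have [Z [sX fX]] := complete (A := [:: a; b; c; d])
  (B := [:: smul mu a b; smul mu a c; smul mu a d]) fY.
have := @nth_tail ([:: a; b; c; d] ++ Z) [:: smul mu a b; smul mu a c; smul mu a d].
rewrite -catA => tail.
have t0 := tail 0%N sX isT; have t1 := tail 1%N sX isT; have t2 := tail 2%N sX isT.
have n0 : (n - 3 + 0 = (n - 2).-1)%N by lia.
have n1 : (n - 3 + 1 = (n - 1).-1)%N by lia.
have n2 : (n - 3 + 2 = n.-1)%N by lia.
rewrite /= n0 in t0; rewrite /= n1 in t1; rewrite /= n2 in t2.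
(* Only products with the light vector a stay at weight 4; those among b, c, d have weight 6. *)
apply: (@weight_degen4 _ _ _ [:: 1; 3; 3; 3]%N am sX fX) => //.
  by rewrite /= !nth_default /=; lia.
by move=> [|[|[|[|?]]]] [|[|[|[|?]]]] //= _ _ _; rewrite !table_prodE /= ?eqxx.
Qed.

Definition annv mu : {vspace V} := lker (linfun (mulmxr
  (\matrix_(i < n) mxvec (\matrix_(j < n) smul mu 'e_i 'e_j)))).

Lemma annvP mu x : reflect (forall y, smul mu x y = 0) (x \in annv mu).
Proof.
rewrite memv_ker lfunE /=.
have -> : x *m (\matrix_(i < n) mxvec (\matrix_(j < n) smul mu 'e_i 'e_j)) =
    mxvec (\matrix_(j < n) smul mu x 'e_j).
  rewrite mulmx_sum_row; under eq_bigr => i _ do rewrite rowK -linearZ.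
  rewrite -linear_sum; congr mxvec; apply/row_matrixP => j; rewrite rowK linear_sum.
  rewrite {2}[x]row_sum_delta smul_suml; apply: eq_bigr => i _.
  by rewrite linearZ /= rowK smulZl.
apply: (iffP eqP) => [x0 y|x0]; last first.
  rewrite (_ : \matrix_j _ = 0) ?linear0 //; apply/row_matrixP => j.
  by rewrite rowK x0 row0.
have {}x0 : \matrix_(j < n) smul mu x 'e_j = 0 by apply: (can_inj mxvecK); rewrite x0 linear0.
rewrite [y]row_sum_delta smul_sumr big1 // => j _.
by rewrite smulZr -[smul _ _ _](rowK (fun j => smul mu x 'e_j)) x0 row0 scaler0.
Qed.

Definition ev (f : 'cV[k]_n) (x : V) : k := (x *m f) 0 0.

Lemma evD f x y : ev f (x + y) = ev f x + ev f y.
Proof. by rewrite /ev mulmxDl mxE. Qed.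

Lemma evN f x : ev f (- x) = - ev f x.
Proof. by rewrite /ev mulNmx mxE. Qed.

Lemma evB f x y : ev f (x - y) = ev f x - ev f y.
Proof. by rewrite evD evN. Qed.

Lemma evZ f a x : ev f (a *: x) = a * ev f x.
Proof. by rewrite /ev -scalemxAl mxE. Qed.

Lemma ev0 f : ev f 0 = 0.
Proof. by rewrite /ev mul0mx mxE. Qed.

Lemma ev_lincomb f c X : ev f (lincomb c X) = \sum_(i < size X) c i * ev f X`_i.
Proof.
rewrite /ev mulmx_suml summxE; apply: eq_bigr => i _.
by rewrite -scalemxAl mxE.
Qed.

Definition kerv (f : 'cV[k]_n) : {vspace V} := lker (linfun (mulmxr f)).

Lemma kervP f x : (x \in kerv f) = (ev f x == 0).
Proof.
rewrite memv_ker lfunE /= /ev; apply/eqP/eqP => [->|x0]; first by rewrite mxE.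
by apply/matrixP => i j; rewrite !ord1 x0 mxE.
Qed.

Lemma dual X (c : nat -> k) : free X ->
  exists f, forall i, (i < size X)%N -> ev f X`_i = c i.
Proof.
move=> fX; have [Z []] := complete (A := X) (B := [::]) (eq_ind_r free fX (cats0 X)).
rewrite cats0 => sZ fZ; exists (invmx (seqmx (X ++ Z)) *m \col_i c i) => i iX.
have iN : (i < n)%N by apply: leq_trans (eq_leq sZ); rewrite size_cat ltn_addr.
have := seqmxK i sZ fZ; rewrite nth_cat iX /ev mulmxA => ->.
by rewrite (bvecE _ (Ordinal iN)) -(rowE (Ordinal iN) (\col_i c i)) !mxE.
Qed.

Lemma ker_span X f l0 (P : pred nat) v : size X = n -> free X ->
  (forall l, (l < n)%N -> ev f X`_l = (l == l0)%:R) ->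
  (forall l, (l < n)%N -> l != l0 -> P l) -> ev f v = 0 ->
  v \in <<[seq X`_m | m <- iota 0 n & P m]>>%VS.
Proof.
move=> sX fX fE Pl; have [c ->] := lincomb_full v sX fX.
rewrite ev_lincomb => cf; apply: memv_suml => i _; 
  have iN : (i < n)%N := leq_trans (ltn_ord i) (eq_leq sX).
have [il0|ne] := eqVneq (i : nat) l0; last first.
  apply/memvZ/memv_span/map_f; rewrite mem_filter mem_iota iN andbT.
  by rewrite Pl.
have ci : c i = 0.
  move: cf; rewrite (bigD1 i) //= fE // il0 eqxx mulr1 big1 ?addr0 // => j ji.
  rewrite fE; last exact: leq_trans (ltn_ord j) (eq_leq sX).
  by rewrite -il0 val_eqE (negPf ji) mulr0.
by rewrite ci scale0r mem0v.
Qed.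

End Criteria.

(** * Symplectic families of the forms f (x y) *)

Section Symplectic.
Variables (k : closedFieldType) (n : nat).
Local Notation V := 'rV[k]_n.
Variable mu : structure k n.
Hypothesis am : anticomm mu.
Implicit Types (A B E X Z : seq V) (f : 'cV[k]_n).

(** The vectors of [B] annihilate everything, so only products within [A] are compared with the
    table. *)
Lemma recognize_ann A B s : size (A ++ B) = n -> free (A ++ B) ->
  (forall x, x \in B -> x \in annv mu) ->
  all (fun t => [&& 0 < t.2 <= n, t.1.1 <= size A & t.1.2 <= size A])%N s ->
  (forall a b, (a < b < size A)%N -> smul mu A`_a A`_b = table_prod (A ++ B) s a b) ->
  orbit mu (anticomm_structure k n s).
Proof.
move=> sX fX BA /allP ok AA; apply: (recognize am sX fX) => [t /ok/and3P[]//|a b].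
move=> /andP[ab bn]; have [bA|Ab] := ltnP b (size A).
  by rewrite !nth_cat bA (ltn_trans ab bA) AA ?ab.
rewrite anticommC // (annvP mu _ _) ?oppr0; last first.
  rewrite nth_cat ltnNge Ab /=; apply/BA/mem_nth.
  by rewrite ltn_subLR // -size_cat; apply: leq_trans bn (eq_leq (esym sX)).
rewrite /table_prod !big1_seq ?subrr // => t /andP[_ /ok/and3P[_ t1 t2]].
  by rewrite [X in X && _]gtn_eqF ?scale0r // ltnS (leq_trans t1 Ab).
by rewrite [X in _ && X]gtn_eqF ?andbF ?scale0r // ltnS (leq_trans t2 Ab).
Qed.

Definition form f x y := ev f (smul mu x y).

Lemma formC f x y : form f x y = - form f y x.
Proof. by rewrite /form anticommC // evN. Qed.

Lemma formxx f x : form f x x = 0.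
Proof. by rewrite /form am ev0. Qed.

Lemma formDl f x y z : form f (x + y) z = form f x z + form f y z.
Proof. by rewrite /form smulDl evD. Qed.

Lemma formDr f x y z : form f x (y + z) = form f x y + form f x z.
Proof. by rewrite /form smulDr evD. Qed.

Lemma formNl f x y : form f (- x) y = - form f x y.
Proof. by rewrite /form smulNl evN. Qed.

Lemma formNr f x y : form f x (- y) = - form f x y.
Proof. by rewrite /form smulNr evN. Qed.

Lemma formZl f a x y : form f (a *: x) y = a * form f x y.
Proof. by rewrite /form smulZl evZ. Qed.

Lemma formZr f a x y : form f x (a *: y) = a * form f x y.
Proof. by rewrite /form smulZr evZ. Qed.

Definition formE := (formDl, formDr, formNl, formNr, formZl, formZr, formxx).

Lemma form_ann f x y : x \in annv mu -> form f x y = 0.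
Proof. by move=> /annvP xA; rewrite /form xA ev0. Qed.

Lemma form_lincomb f c E y : form f (lincomb c E) y = \sum_(i < size E) c i * form f E`_i y.
Proof.
rewrite /form smul_suml /ev mulmx_suml summxE; apply: eq_bigr => i _.
by rewrite smulZl -scalemxAl mxE.
Qed.

(* [E] is a list of consecutive hyperbolic pairs of [form f]. *)
Definition sympl f E := forall i j, (i < j < size E)%N ->
  form f E`_i E`_j = ((j == i.+1) && ~~ odd i)%:R.

Definition partner i := if odd i then i.-1 else i.+1.

Lemma sympl_partner f E i j : sympl f E -> ~~ odd (size E) -> (i < size E)%N -> (j < size E)%N ->
  (form f E`_i E`_(partner j) != 0) = (i == j).
Proof.
move=> sE oE iE jE; have pE : (partner j < size E)%N by rewrite /partner; case: ifP; lia.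
have bR (c : bool) : (c%:R != 0 :> k) = c by case: c; rewrite ?oner_neq0 ?eqxx.
have [ip|pi|->] := ltngtP i (partner j).
- rewrite sE ?ip // bR; rewrite /partner in ip pE *.
  by move: ip pE; case: ifP => oj ip pE; lia.
- rewrite formC oppr_eq0 sE ?pi // bR; rewrite /partner in pi pE *.
  by move: pi pE; case: ifP => oj ip pE; lia.
by rewrite formxx eqxx /partner; case: ifP => oj; lia.
Qed.

(** Pairing a relation with the partner of a vector of [E] isolates the coefficient of that vector,
    because annihilator elements pair to zero. *)
Lemma sympl_free f E B : sympl f E -> ~~ odd (size E) -> free B ->
  (forall x, x \in B -> x \in annv mu) -> free (E ++ B).
Proof.
move=> sE oE fB BA; apply: free_cat_coef => // c /mem_lincomb[d cd] i iE.
have cA : lincomb c E \in annv mu by rewrite cd; apply: lincomb_mem.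
have := form_ann f E`_(partner i) cA; rewrite form_lincomb (bigD1 (Ordinal iE)) //=.
rewrite big1 => [|j ji]; last first.
  have := sympl_partner sE oE (ltn_ord j) iE.
  by rewrite -val_eqE /= in ji; rewrite (negPf ji) => /negbFE/eqP ->; rewrite mulr0.
move/eqP; rewrite addr0 mulf_eq0 => /orP[/eqP //|].
by have := sympl_partner sE oE iE iE; rewrite eqxx => /negPf ->.
Qed.

(* Replacing [e] by its projection on the kernel of [f] along a vector [q] of
   the annihilator does not change the products. *)
Definition proj_ker f q (e : V) := e - ev f e *: q.

Lemma ev_proj_ker f q e : ev f q = 1 -> ev f (proj_ker f q e) = 0.
Proof. by move=> q1; rewrite evB evZ q1 mulr1 subrr. Qed.

Lemma smul_proj_ker f q x y : q \in annv mu ->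
  smul mu (proj_ker f q x) (proj_ker f q y) = smul mu x y.
Proof.
move=> /annvP qA; rewrite smulBl smulZl qA scaler0 subr0 smulBr smulZr.
by rewrite [smul mu x q]anticommC // qA oppr0 scaler0 subr0.
Qed.

Lemma ev_nth_cat f A q Z l : (forall x, x \in A -> ev f x = 0) ->
  (forall x, x \in Z -> ev f x = 0) -> ev f q = 1 ->
  ev f (A ++ q :: Z)`_l = (l == size A)%:R.
Proof.
move=> A0 Z0 q1; rewrite nth_cat; have [lA|Al|->] := ltngtP l (size A).
- by rewrite A0 // mem_nth.
- rewrite -[(l - _)%N]prednK ?subn_gt0 //=.
  by have [lZ|Zl] := ltnP (l - size A).-1 (size Z);
    [rewrite Z0 ?mem_nth | rewrite nth_default ?ev0].
by rewrite subnn.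
Qed.

Lemma kerv_complement f A q B : ev f q = 1 -> (<<A ++ q :: B>> + kerv f)%VS = fullv.
Proof.
move=> q1; apply/eqP; rewrite eqEsubv subvf; apply/subvP => v _.
rewrite -[v](subrK (ev f v *: q)) addrC memv_add ?kervP ?ev_proj_ker //.
by apply/memvZ/memv_span; rewrite mem_cat mem_head orbT.
Qed.

Lemma table_prod_eta m X a b : (a < b)%N ->
  table_prod X [seq (2 * i - 1, 2 * i, 2 * m + 1)%N | i <- iota 1 m] a b =
  [&& b == a.+1, ~~ odd a & b < m.*2]%N%:R *: X`_m.*2.
Proof.
move=> ab; have m2 : ((2 * m + 1).-1 = m.*2)%N by lia.
rewrite /table_prod !big_map /= m2 -!scaler_suml -scalerBl; congr (_ *: _).
rewrite [X in _ - X]big1_seq ?subr0 => [|i]; last first.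
  by rewrite mem_iota => im; case: eqP; case: eqP => //= ? ?; lia.
case: and3P => [[/eqP -> oa bm]|ne].
  rewrite (bigD1_seq (a.+2)./2) ?iota_uniq //=; last by rewrite mem_iota; lia.
  rewrite big1 ?addr0 => [|i ine]; last first.
    by case: eqP; case: eqP => //= ? ?; move/eqP: ine; lia.
  by have -> : (a.+1 == 2 * a.+2./2 - 1)%N && (a.+2 == 2 * a.+2./2)%N by lia.
rewrite big1_seq // => i /andP[_]; rewrite mem_iota => im.
case: eqP; case: eqP => //= ? ?; case: ne; split; lia.
Qed.

(** The family, projected to the kernel of [f], gets weight 2, [q] weight 4, and a complement inside
    the kernel weight 3. A product of two members has weight 4, so only its coordinate along [q],
    which is its value under [f], survives; all other products are heavier than 4. *)
Lemma eta_degen m f E q : size E = m.*2 -> sympl f E ->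
  q \in annv mu -> ev f q = 1 -> (m.*2 < n)%N /\ degen mu (eta k n m).
Proof.
move=> sE syE qA q1; pose F := map (proj_ker f q) E.
have sF : size F = m.*2 by rewrite size_map.
have syF : sympl f F.
  move=> i j /andP[ij jF]; rewrite sF -sE in jF.
  rewrite !(nth_map 0) ?(ltn_trans ij) //.
  by rewrite /form smul_proj_ker // -/(form _ _ _) syE ?ij.
have F0 x : x \in F -> ev f x = 0 by case/mapP => e _ ->; apply: ev_proj_ker.
have q0 : q != 0 by apply: contra_eq_neq q1 => ->; rewrite ev0 eq_sym oner_neq0.
have fFq : free (F ++ [:: q]).
  apply: sympl_free syF _ _ _ => [||x]; rewrite ?sF ?odd_double ?seq1_free //.
  by rewrite inE => /eqP ->.
have mn : (m.*2 < n)%N by have := free_size fFq; rewrite size_cat sF addn1.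
split=> //; have [||Z [sX fX Z0]] := @complete_in _ _ (F ++ [:: q]) [::] (kerv f).
- by rewrite cats0.
- by rewrite -catA; apply: kerv_complement.
have Zf x : x \in Z -> ev f x = 0 by move=> /Z0; rewrite kervP => /eqP.
rewrite cats0 -catA /= in sX fX.
pose Q i := (if i < m.*2 then 2 else if i == m.*2 then 4 else 3)%N.
have Q2 i : (i < m.*2)%N -> Q i = 2%N by rewrite /Q => ->.
have Qm : Q m.*2 = 4%N by rewrite /Q ltnn eqxx.
apply: (@weight_degen _ _ mu (F ++ q :: Z) _ Q) => //.
- by move=> t /mapP[i _ ->] /=; lia.
- move=> t /mapP[i]; rewrite mem_iota => im -> /=; split; try lia.
  by rewrite (_ : (2 * m + 1).-1 = m.*2)%N ?Qm ?Q2 //; lia.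
move=> a b /andP[ab bn]; have [bm|mb] := ltnP b m.*2; last first.
  have Q4 i : (2 <= Q i <= 4)%N by rewrite /Q; case: ifP => // _; case: ifP.
  have Qb : (3 <= Q b)%N by rewrite /Q [(b < _)%N]ltnNge mb /=; case: ifP.
  by apply: span_full => // l _; have := Q4 l; have := Q4 a; lia.
have Xq : (F ++ q :: Z)`_m.*2 = q by rewrite nth_cat sF ltnn subnn.
rewrite table_prod_eta // Xq bm andbT !nth_cat sF bm (ltn_trans ab bm).
apply: (@ker_span _ _ _ f m.*2) => // [l _|l ln lm|].
- by rewrite ev_nth_cat ?sF.
- by rewrite /Q bm (ltn_trans ab bm); case: ifP => //; rewrite (negPf lm).
by rewrite evB evZ q1 mulr1 -/(form f _ _) syF ?ab ?sF // subrr.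
Qed.

End Symplectic.

(** * Algebras whose square lies in the annihilator *)

Section Quadruples.
Variables (k : closedFieldType) (n : nat).
Local Notation V := 'rV[k]_n.
Variable mu : structure k n.
Hypothesis am : anticomm mu.
Implicit Types (A B E X Z : seq V) (f : 'cV[k]_n) (x y d e : V).
Local Notation w := (form mu).

(** Two orthogonal hyperbolic pairs (e1, e3) and (e2, e4), ordered as in T^{2,2}(eps_24), where e1
    e3 = e2 e4. Such a quadruple exists when the form has rank at least four. *)
Record quad f (e1 e2 e3 e4 : V) : Prop := Quad {
  quad12 : w f e1 e2 = 0;
  quad13 : w f e1 e3 = 1;
  quad14 : w f e1 e4 = 0;
  quad23 : w f e2 e3 = 0;
  quad24 : w f e2 e4 = 1;
  quad34 : w f e3 e4 = 0 }.

Lemma quad_sympl f e1 e2 e3 e4 : quad f e1 e2 e3 e4 -> sympl mu f [:: e1; e3; e2; e4].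
Proof.
case=> q12 q13 q14 q23 q24 q34 i j /andP[].
move: i j => [|[|[|[|i]]]] [|[|[|[|j]]]] //= _ _.
by rewrite formC // q23 oppr0.
Qed.

(** The weights are 3, 3, 4, 4 for the quadruple, 6 for p = e1 e2, 7 for q = e1 e3 and 5 for the
    rest. Then e1 e2 is exactly p. A product of weight 7 matters only through its coordinate along
    q, which is [f] because all other basis vectors lie in its kernel. The product e3 e4 is too
    heavy. As f(p) = 0 and p is nonzero, p and q are independent. *)
Lemma eps24_degen f e1 e2 e3 e4 : cube0 mu -> quad f e1 e2 e3 e4 ->
  smul mu e1 e2 != 0 -> (6 <= n)%N /\ degen mu (T22_eps24 k n).
Proof.
move=> cm Q p0; pose q := smul mu e1 e3; pose p := smul mu e1 e2.
have sqA x y : smul mu x y \in annv mu.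
  by apply/annvP => z; rewrite anticommC // cm oppr0.
have q1 : ev f q = 1 by apply: quad13 Q.
pose g := proj_ker f q.
have gS x y : smul mu (g x) (g y) = smul mu x y by apply: smul_proj_ker => //; apply: sqA.
have gf x : ev f (g x) = 0 by apply: ev_proj_ker.
have gQ : quad f (g e1) (g e2) (g e3) (g e4).
  by case: Q => *; split; rewrite /form gS.
have pf : ev f p = 0 by apply: quad12 Q.
pose A := [:: g e1; g e2; g e3; g e4].
have fpq : free [:: p; q].
  rewrite free_cons seq1_free; apply/andP; split; last first.
    by apply: contra_eq_neq q1 => ->; rewrite ev0 eq_sym oner_neq0.
  apply/negP => /mem_lincomb[c]; rewrite lincomb_cons lincomb_nil addr0 => pc.
  have := ev_lincomb f c [:: q]; rewrite big_ord1 /= lincomb_cons lincomb_nil addr0 -pc pf q1.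
  by rewrite mulr1 => c0; move: p0; rewrite -/p pc -c0 scale0r eqxx.
have P : perm_eq ([:: g e1; g e3; g e2; g e4] ++ [:: p; q]) (A ++ [:: p; q]).
  rewrite perm_cat2r /A perm_cons -![g _ :: _ :: _](cat1s) //.
  by rewrite -(cat1s (g e3)) -(cat1s (g e2)) perm_catCA.
have fX : free (A ++ [:: p; q]).
  rewrite -(perm_free P); apply: (sympl_free am (quad_sympl gQ)) => // x.
  by rewrite !inE => /orP[] /eqP ->; apply: sqA.
have /= n6 := free_size fX; split=> //.
have [|Z [sX {}fX Z0]] := complete_in (U := kerv f) fX.
  by rewrite -(cat1s p [:: q]) catA; apply: kerv_complement.
have := @nth_tail _ n (A ++ Z) [:: p; q]; rewrite -catA => tail.
have t0 := tail 0%N sX isT; have t1 := tail 1%N sX isT.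
have n0 : (n - 2 + 0 = (n - 1).-1)%N by lia.
have n1 : (n - 2 + 1 = n.-1)%N by lia.
rewrite n0 in t0; rewrite n1 in t1.
pose W i := (if i == (n - 1).-1 then 6 else if i == n.-1 then 7 else nth 5 [:: 3; 3; 4; 4] i)%N.
have W7 i : (3 <= W i <= 7)%N.
  by rewrite /W; do 2![case: ifP => // _]; move: i => [|[|[|[|i]]]] //=; rewrite nth_nil.
have Ws i : (i < 4)%N -> W i = nth 5%N [:: 3; 3; 4; 4]%N i.
  by move=> i4; rewrite /W !ifF //; lia.
have W4 i : (4 <= i)%N -> (5 <= W i)%N.
  by move=> i4; rewrite /W; do 2![case: ifP => // _]; rewrite nth_default.
have Wp : W (n - 1).-1 = 6%N by rewrite /W eqxx.
have Wq : W n.-1 = 7%N by rewrite /W ifF ?eqxx //; lia.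
have X0 l : (l < n)%N -> ev f (A ++ Z ++ [:: p; q])`_l = (l == n.-1)%:R.
  move=> ln; have sn : size (A ++ Z ++ [:: p]) = n.-1.
    by move: sX; rewrite !size_cat /=; lia.
  have -> : A ++ Z ++ [:: p; q] = (A ++ Z ++ [:: p]) ++ [:: q] by rewrite -!catA.
  rewrite -sn; apply: ev_nth_cat => // x.
  rewrite !mem_cat => /or3P[||]; last by rewrite inE => /eqP ->.
    by rewrite !inE => /or4P[] /eqP ->.
  by move=> /Z0; rewrite kervP => /eqP.
apply: (@weight_degen _ _ mu (A ++ Z ++ [:: p; q]) _ W) => //.
- by move=> t; rewrite !inE => /or3P[] /eqP -> /=; lia.
- by move=> t; rewrite !inE => /or3P[] /eqP -> /=; rewrite ?Wp ?Wq ?Ws.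
move=> a b /andP[ab bn]; have [b4|bge4] := ltnP b 4; last first.
  apply: span_full => // l _; have := W7 l; have := W7 a; have := W4 b bge4; lia.
have inker v : (W a + W b = 7)%N -> ev f v = 0 ->
    v \in <<[seq (A ++ Z ++ [:: p; q])`_m | m <- iota 0 n & (W m < W a + W b)%N]>>%VS.
  move=> ab7 vf; apply: (@ker_span _ _ _ f n.-1) => // l ln lne; rewrite ab7 /W.
  rewrite (negPf lne); case: ifP => // _.
  by move: l {ln lne} => [|[|[|[|l]]]] //=; rewrite nth_nil.
have nthX i : (i < 4)%N -> (A ++ Z ++ [:: p; q])`_i = A`_i.
  by move=> i4; rewrite nth_cat i4.
case: gQ => q12 q13 q14 q23 q24 q34; rewrite /form in q12 q13 q14 q23 q24 q34.
rewrite !nthX ?(ltn_trans ab) //.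
move: a b ab bn b4 inker => [|[|[|[|?]]]] [|[|[|[|?]]]] // _ bn _ inker.
- by rewrite !table_prodE /= t0 /= gS subrr mem0v.
- by apply: inker; rewrite ?Ws // !table_prodE /= t1 /= evB q13 q1 subrr.
- by apply: inker; rewrite ?Ws // !table_prodE /= q14.
- by apply: inker; rewrite ?Ws // !table_prodE /= q23.
- by apply: inker; rewrite ?Ws // !table_prodE /= t1 /= evB q24 q1 subrr.
by apply: span_full => // l _; rewrite (Ws 2%N) // (Ws 3%N) //=; have := W7 l; lia.
Qed.

End Quadruples.

Section CubeZero.
Variables (k : closedFieldType) (n : nat).
Local Notation V := 'rV[k]_n.
Variable mu : structure k n.
Hypotheses (am : anticomm mu) (cm : cube0 mu).
Implicit Types (A B E X Z : seq V) (f : 'cV[k]_n) (x y d e : V).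
Local Notation w := (form mu).
Local Notation quad := (quad mu).

Lemma smul_annv x y : smul mu x y \in annv mu.
Proof. by apply/annvP => z; rewrite anticommC // cm oppr0. Qed.

(** * Forms whose hyperbolic quadruples all satisfy e1 e2 = 0 *)

Section NoEps24.
Variable f : 'cV[k]_n.
Hypothesis quad0 : forall e1 e2 e3 e4, quad f e1 e2 e3 e4 -> smul mu e1 e2 = 0.

Lemma quad_swap e1 e2 e3 e4 : quad f e1 e2 e3 e4 -> quad f e2 e1 e4 e3.
Proof.
case=> q12 q13 q14 q23 q24 q34.
by split=> //; rewrite formC // (q12, q34) oppr0.
Qed.

Lemma quad_rot e1 e2 e3 e4 : quad f e1 e2 e3 e4 -> quad f e3 e2 (- e1) e4.
Proof.
case=> q12 q13 q14 q23 q24 q34; split; rewrite ?formE // ?q14 ?oppr0 //.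
- by rewrite formC // q23 oppr0.
- by rewrite formC // q13 opprK.
- by rewrite formC // q12 opprK.
Qed.

Lemma quad_shear e1 e2 e3 e4 d d' : quad f e1 e2 e3 e4 ->
  w f d e3 = 0 -> w f d e4 = 0 -> w f d' e3 = 0 -> w f d' e4 = 0 ->
  w f d e2 + w f e1 d' + w f d d' = 0 -> quad f (e1 + d) (e2 + d') e3 e4.
Proof.
case=> q12 q13 q14 q23 q24 q34 d3 d4 d3' d4' dd; split; rewrite ?formE //.
- by rewrite q12 add0r addrCA addrA.
- by rewrite q13 d3 addr0.
- by rewrite q14 d4 addr0.
- by rewrite q23 d3' addr0.
by rewrite q24 d4' addr0.
Qed.

(** The hypothesis on e1 e2 is applied to the images of the quadruple under symplectic moves. *)
Lemma quad_prods e1 e2 e3 e4 : quad f e1 e2 e3 e4 ->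
  [/\ smul mu e1 e2 = 0, smul mu e2 e3 = 0, smul mu e1 e4 = 0, smul mu e3 e4 = 0 &
      smul mu e2 e4 = smul mu e1 e3].
Proof.
move=> Q; have p12 := quad0 Q.
have p32 := quad0 (quad_rot Q).
have p41 := quad0 (quad_rot (quad_swap Q)).
have p43 := quad0 (quad_rot (quad_swap (quad_rot Q))).
have p23 : smul mu e2 e3 = 0 by rewrite anticommC // p32 oppr0.
have p14 : smul mu e1 e4 = 0 by rewrite anticommC // p41 oppr0.
split=> //; first by rewrite anticommC // p43 oppr0.
(* For this quadruple the first product expands to e1 e3 - e2 e4, as e1 e4 and e2 e3 vanish. *)
have Q' : quad f (e1 + e2) (e3 - e4) e3 e2.
  case: Q => q12 q13 q14 q23 q24 q34.
  have q32 : w f e3 e2 = 0 by rewrite formC // q23 oppr0.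
  have q42 : w f e4 e2 = -1 by rewrite formC // q24.
  have q43 : w f e4 e3 = 0 by rewrite formC // q34 oppr0.
  split; rewrite ?formE // ?q12 ?q13 ?q14 ?q23 ?q24 ?q34 ?q32 ?q42 ?q43; ring.
have := quad0 Q'; rewrite smulDl !smulBr p14 p23 subr0 sub0r => /eqP.
by rewrite subr_eq0 => /eqP.
Qed.

(** Adding [d] to e2 gives another quadruple, so e1 (e2 + d) = 0. No condition on the pairing of [d]
    with e2 is required. *)
Lemma quad_perp e1 e2 e3 e4 d : quad f e1 e2 e3 e4 ->
  w f d e1 = 0 -> w f d e3 = 0 -> w f d e4 = 0 -> smul mu e1 d = 0.
Proof.
move=> Q d1 d3 d4; have := quad0 (@quad_shear e1 e2 e3 e4 0 d Q _ _ d3 d4 _).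
rewrite !smulDl !smul0l addr0 smulDr (quad0 Q) add0r; apply.
- by rewrite /w smul0l ev0.
- by rewrite /w smul0l ev0.
by rewrite (formC am f e1) d1 /w !smul0l !ev0 oppr0 !addr0.
Qed.

(** The space is the sum of the span of the quadruple and its orthogonal [perp], and the formula is
    checked on each pair of pieces. Products of the quadruple with [perp] vanish by [quad_perp];
    products inside [perp] are compared with q through new quadruples. *)
Lemma quad_product e1 e2 e3 e4 x y : quad f e1 e2 e3 e4 ->
  smul mu x y = w f x y *: smul mu e1 e3.
Proof.
move=> Q; set q := smul mu e1 e3.
have [p12 p23 p14 p34 p24] := quad_prods Q.
pose perp d := [/\ w f d e1 = 0, w f d e2 = 0, w f d e3 = 0 & w f d e4 = 0].
have perp0 d : perp d -> [/\ smul mu e1 d = 0, smul mu e2 d = 0, smul mu e3 d = 0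
    & smul mu e4 d = 0].
  case=> d1 d2 d3 d4; split.
  - exact: quad_perp Q d1 d3 d4.
  - exact: quad_perp (quad_swap Q) d2 d4 d3.
  - by apply: quad_perp (quad_rot Q) d3 _ d4; rewrite formNr d1 oppr0.
  by apply: quad_perp (quad_rot (quad_swap Q)) d4 _ d3; rewrite formNr d2 oppr0.
have perpP d d' : perp d -> perp d' -> smul mu d d' = w f d d' *: q.
  move=> [d1 d2 d3 d4] [d1' d2' d3' d4'].
  (* If d and d' are orthogonal, e1 and e2 can be shifted by them simultaneously, and (e1 + d)(e2 +
     d') = 0 reduces to d d' = 0. *)
  have [dd0|dd0] := eqVneq (w f d d') 0.
    rewrite dd0 scale0r.
    have [Q1 [Q2 Q3 Q4]] : quad f (e1 + d) (e2 + d') e3 e4 /\ 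
      [/\ smul mu e1 d' = 0, smul mu e2 d = 0 & True].
      split; last by split; [case: (perp0 d') | case: (perp0 d) |].
      by apply: quad_shear; rewrite // d2 dd0 (formC am f e1) d1' oppr0 !addr0.
    have := quad0 Q1; rewrite smulDl !smulDr p12 Q2 !add0r.
    by rewrite (anticommC d e2) // Q3 oppr0 add0r.
  (* Otherwise d and a multiple of d' replace the pair (e2, e4), whose product equals e1 e3. *)
  have Qd : quad f e1 d e3 ((w f d d')^-1 *: d').
    case: Q => q12 q13 q14 q23 q24 q34; split; rewrite ?formE //.
    - by rewrite formC // d1 oppr0.
    - by rewrite (formC am f e1) d1' oppr0 mulr0.
    - by rewrite mulVf.
    by rewrite (formC am f e3) d3' oppr0 mulr0.
  have [_ _ _ _] := quad_prods Qd; rewrite -/q smulZr => <-.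
  by rewrite scalerA mulfV // scale1r.
(* [D] is the orthogonal projection onto [perp]. *)
pose D x := x - w f x e3 *: e1 - w f x e4 *: e2 + w f x e1 *: e3 + w f x e2 *: e4.
case: (Q) => q12 q13 q14 q23 q24 q34.
have q21 : w f e2 e1 = 0 by rewrite formC // q12 oppr0.
have q31 : w f e3 e1 = -1 by rewrite formC // q13.
have q41 : w f e4 e1 = 0 by rewrite formC // q14 oppr0.
have q32 : w f e3 e2 = 0 by rewrite formC // q23 oppr0.
have q42 : w f e4 e2 = -1 by rewrite formC // q24.
have q43 : w f e4 e3 = 0 by rewrite formC // q34 oppr0.
have perpD u : perp (D u).
  by split; rewrite /D !formE // ?q12 ?q13 ?q14 ?q21 ?q23 ?q24 ?q31 ?q32 ?q34 ?q41 ?q42 ?q43;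
    ring.
pose ok u v := smul mu u v = w f u v *: q.
have okD u v z : ok u v -> ok u z -> ok u (v + z).
  by rewrite /ok smulDr formDr scalerDl => -> ->.
have okZ u v a : ok u v -> ok u (a *: v).
  by rewrite /ok smulZr formZr -scalerA => ->.
have okC u v : ok u v -> ok v u.
  by rewrite /ok => uv; rewrite anticommC // uv formC // scaleNr opprK.
have okN u v : ok u v -> ok u (- v).
  by rewrite /ok smulNr formNr scaleNr => ->.
have xD u : u = w f u e3 *: e1 + w f u e4 *: e2 - w f u e1 *: e3 - w f u e2 *: e4 + D u.
  by apply/rowP => j; rewrite /D !mxE; ring.
have okxx u : ok u u by rewrite /ok am formxx // scale0r.
have okall u : ok u e1 -> ok u e2 -> ok u e3 -> ok u e4 ->
   (forall d, perp d -> ok u d) -> forall v, ok u v.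
  move=> u1 u2 u3 u4 ud v; rewrite [v]xD; apply: (okD); last exact: ud.
  by apply: (okD); [apply: (okD); [apply: (okD)|apply: okN]|apply: okN]; apply: okZ.
have ok12 : ok e1 e2 by rewrite /ok q12 scale0r.
have ok13 : ok e1 e3 by rewrite /ok q13 scale1r.
have ok14 : ok e1 e4 by rewrite /ok q14 scale0r.
have ok23 : ok e2 e3 by rewrite /ok q23 scale0r.
have ok24 : ok e2 e4 by rewrite /ok q24 scale1r.
have ok34 : ok e3 e4 by rewrite /ok q34 scale0r.
have okd d : perp d -> [/\ ok e1 d, ok e2 d, ok e3 d & ok e4 d].
  move=> pd; have [s1 s2 s3 s4] := perp0 d pd; case: pd => d1 d2 d3 d4.
  by split; rewrite /ok (s1, s2, s3, s4) formC // (d1, d2, d3, d4) oppr0 scale0r.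
suff H u v : ok u v by apply: H.
have [ok11 ok22 ok33 ok44] := And4 (okxx e1) (okxx e2) (okxx e3) (okxx e4).
have [ok21 ok31 ok41] := And3 (okC _ _ ok12) (okC _ _ ok13) (okC _ _ ok14).
have [ok32 ok42 ok43] := And3 (okC _ _ ok23) (okC _ _ ok24) (okC _ _ ok34).
apply: (okall) => [||||d pd]; apply: (okC).
- by apply: (okall) => // d /okd[].
- by apply: (okall) => // d /okd[].
- by apply: (okall) => // d /okd[].
- by apply: (okall) => // d /okd[].
have [d1 d2 d3 d4] := okd d pd.
by apply: (okall) => [||||d' pd']; [apply: okC..|apply: perpP].
Qed.

End NoEps24.

Lemma quad_sub4 f e1 e2 e3 e4 x : quad f e1 e2 e3 e4 ->
  exists a1 a2 a3 a4, let d := x - (a1 *: e1 + a2 *: e2 + a3 *: e3 + a4 *: e4) in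
  [/\ w f d e1 = 0, w f d e2 = 0, w f d e3 = 0 & w f d e4 = 0].
Proof.
case=> q12 q13 q14 q23 q24 q34.
have q21 : w f e2 e1 = 0 by rewrite formC // q12 oppr0.
have q31 : w f e3 e1 = -1 by rewrite formC // q13.
have q41 : w f e4 e1 = 0 by rewrite formC // q14 oppr0.
have q32 : w f e3 e2 = 0 by rewrite formC // q23 oppr0.
have q42 : w f e4 e2 = -1 by rewrite formC // q24.
have q43 : w f e4 e3 = 0 by rewrite formC // q34 oppr0.
exists (w f x e3), (w f x e4), (- w f x e1), (- w f x e2) => /=.
by split; rewrite !formE // ?q12 ?q13 ?q14 ?q21 ?q23 ?q24 ?q31 ?q32 ?q34 ?q41 ?q42 ?q43;
  ring.
Qed.

(** If e1 e2 is nonzero for some quadruple of [f], the target is T^{2,2}(eps_24). Otherwise every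
    product is f(xy) q. A nonzero pairing inside the orthogonal of the quadruple adds a third
    hyperbolic pair and leads to eta_3; if there is none, the orthogonal lies in the annihilator and
    the algebra is eta_2. *)
Lemma quad_case f e1 e2 e3 e4 : quad f e1 e2 e3 e4 ->
  [\/ (6 <= n)%N /\ degen mu (T22_eps24 k n), (7 <= n)%N /\ degen mu (eta k n 3) |
      (5 <= n)%N /\ orbit mu (eta k n 2)].
Proof.
move=> Q.
have [[a1 [a2 [a3 [a4 [Qa a12]]]]]|no] :=
  classic (exists a1 a2 a3 a4, quad f a1 a2 a3 a4 /\ smul mu a1 a2 != 0).
  by constructor 1; apply: eps24_degen Qa a12.
have quad0 a1 a2 a3 a4 : quad f a1 a2 a3 a4 -> smul mu a1 a2 = 0.
  move=> Qa; apply/eqP/negPn/negP => a12.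
  by apply: no; exists a1, a2, a3, a4.
pose q := smul mu e1 e3; have q1 : ev f q = 1 by apply: quad13 Q.
have xy x y : smul mu x y = w f x y *: q by apply: quad_product Q => //; apply: quad0.
have qA : q \in annv mu by apply: smul_annv.
pose perp d := [/\ w f d e1 = 0, w f d e2 = 0, w f d e3 = 0 & w f d e4 = 0].
have [[d [d' [pd [pd' dd]]]]|no2] :=
  classic (exists d d', perp d /\ perp d' /\ w f d d' != 0).
  constructor 2; pose E := [:: e1; e3; e2; e4; d; (w f d d')^-1 *: d'].
  have syE : sympl mu f E.
    have r u v : w f u v = 0 -> w f v u = 0 by move=> uv; rewrite formC // uv oppr0.
    case: Q => q12 q13 q14 /r q32 q24 q34.
    case: pd pd' => [/r d1 /r d2 /r d3 /r d4] [/r d1' /r d2' /r d3' /r d4'].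
    move=> i j /andP[]; move: i j => [|[|[|[|[|[|i]]]]]] [|[|[|[|[|[|j]]]]]] //= _ _.
    - by rewrite formZr d1' mulr0.
    - by rewrite formZr d3' mulr0.
    - by rewrite formZr d2' mulr0.
    - by rewrite formZr d4' mulr0.
    by rewrite formZr mulVf.
  by have [] := @eta_degen _ _ _ am 3 f E q erefl syE qA q1.
constructor 3; have syE := quad_sympl am Q.
have q0 : q != 0 by apply: contra_eq_neq q1 => ->; rewrite ev0 eq_sym oner_neq0.
pose A := [:: e1; e3; e2; e4].
have fAq : free (A ++ [:: q]).
  apply: (sympl_free am syE); rewrite ?seq1_free // => x.
  by rewrite inE => /eqP ->.
have n5 : (5 <= n)%N := free_size fAq; split=> //.
have [||Z [sX fX ZA]] := @complete_in _ _ (A ++ [:: q]) [::] (annv mu).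
- by rewrite cats0.
- apply/eqP; rewrite eqEsubv subvf; apply/subvP => x _.
  have [a1 [a2 [a3 [a4 pd]]]] := quad_sub4 x Q.
  rewrite -[x](subrK (a1 *: e1 + a2 *: e2 + a3 *: e3 + a4 *: e4)) addrC.
  apply: memv_add; last first.
    apply/annvP => y; rewrite xy; have [b1 [b2 [b3 [b4 pd']]]] := quad_sub4 y Q.
    rewrite -[y](subrK (b1 *: e1 + b2 *: e2 + b3 *: e3 + b4 *: e4)).
    move: pd pd'; set d := x - _; set d' := y - _ => pd pd'.
    have dd : w f d d' = 0.
      by apply/eqP/negPn/negP => dd; apply: no2; exists d, d'.
    case: (pd) => d1 d2 d3 d4.
    by rewrite [w f d (_ + _)]formDr dd !(formDr, formZr) d1 d2 d3 d4 !mulr0 !addr0 scale0r.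
  by do !apply: memvD; apply/memvZ/memv_span; rewrite !inE eqxx ?orbT.
rewrite cats0 -catA in sX fX.
apply: (recognize_ann am sX fX) => [x||].
- by rewrite inE => /predU1P[->|/ZA].
- by rewrite /= n5.
case: Q => q12 q13 q14 q23 q24 q34.
have q32 : w f e3 e2 = 0 by rewrite formC // q23 oppr0.
move=> a b /andP[]; rewrite xy.
move: a b => [|[|[|[|a]]]] [|[|[|[|b]]]] //= _ _; rewrite !table_prodE /= ?eqxx;
 by rewrite ?(q12, q13, q14, q23, q24, q34, q32) ?scale0r ?scale1r.
Qed.

(** * Algebras all of whose forms f (x y) have rank at most two *)

Section NoQuad.
Hypothesis noquad : forall f e1 e2 e3 e4, ~ quad f e1 e2 e3 e4.

(** This is the vanishing of the Pfaffian of x, b, c, d. If the projections of c and d orthogonal to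
    the hyperbolic plane (x, b) paired nontrivially, they would complete it to a quadruple. *)
Lemma noquad_pfaffian f x b c d : w f x b = 1 ->
  w f c d = w f x c * w f b d - w f b c * w f x d.
Proof.
move=> xb; have bx : w f b x = -1 by rewrite formC // xb.
pose p u := u - w f x u *: b + w f b u *: x.
have px u : w f x (p u) = 0 by rewrite /p !formE // xb; ring.
have pb u : w f b (p u) = 0 by rewrite /p !formE // bx; ring.
have := @noquad f x (p c) b ((w f (p c) (p d))^-1 *: p d).
have [pcd _|pcd []] := eqVneq (w f (p c) (p d)) 0; last first.
  split; rewrite ?formZr ?px ?pb ?mulr0 ?mulVf //.
  by rewrite formC // pb oppr0.
move: pcd; rewrite /p !formE // (formC am f c b) (formC am f c x) xb bx => pcd.
by apply/eqP; rewrite -subr_eq0; apply/eqP; rewrite -[RHS]pcd; ring.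
Qed.

Lemma separating_functional x y : x != 0 -> y != 0 -> exists f, ev f x = 1 /\ ev f y != 0.
Proof.
move=> x0 y0; have [fxy|] := boolP (free [:: x; y]).
  have [f fE] := dual (fun=> 1) fxy; exists f.
  by rewrite (fE 0%N isT : ev f x = 1) (fE 1%N isT : ev f y = 1) oner_neq0.
rewrite (perm_free (permEl (perm_catC [:: x] [:: y]))) free_cons seq1_free x0 andbT negbK.
move=> /mem_lincomb[c]; rewrite lincomb_cons lincomb_nil addr0 => yc.
have [f fE] := dual (fun=> 1) (etrans (seq1_free x) x0); exists f.
have f1 : ev f x = 1 := fE 0%N isT.
split=> //; rewrite yc evZ f1 mulr1; apply: contraNneq y0 => c0.
by rewrite yc c0 scale0r.
Qed.

Lemma not_free2 x y : x != 0 -> ~ free [:: x; y] -> exists a, y = a *: x.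
Proof.
move=> x0 /negP; rewrite (perm_free (permEl (perm_catC [:: x] [:: y]))) free_cons seq1_free x0.
rewrite andbT negbK => /mem_lincomb[c]; rewrite lincomb_cons lincomb_nil addr0 => yc.
by exists (c 0%N).
Qed.

Lemma not_free3 x y z : free [:: x; y] -> ~ free [:: x; y; z] ->
  exists a b, z = a *: x + b *: y.
Proof.
move=> fxy /negP; rewrite (perm_free (permEl (perm_catC [:: x; y] [:: z]))) free_cons fxy.
rewrite andbT negbK => /mem_lincomb[c]; rewrite !lincomb_cons lincomb_nil addr0 => zc.
by exists (c 0%N), (c 1%N).
Qed.

(** A functional equal to 1 on xb and nonzero on d d' would contradict the Pfaffian identity. *)
Lemma common_centralizer x b d d' : smul mu x b != 0 ->
  smul mu x d = 0 -> smul mu b d = 0 -> smul mu x d' = 0 -> smul mu b d' = 0 ->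
  smul mu d d' = 0.
Proof.
move=> xb xd bd xd' bd'; apply/eqP/negPn/negP => dd.
have [f [fx]] := separating_functional xb dd; rewrite -/(w f d d') (noquad_pfaffian d d' fx).
by rewrite /w xd bd ev0 !mul0r subrr eqxx.
Qed.

(** After b and c are changed so that bc = 0, every vector d can be corrected by a combination of x,
    b, c so as to be killed by all three. The Pfaffian identity forces the coefficients to be
    compatible. Corrected vectors multiply to zero with each other, hence lie in the annihilator,
    and the table of T^{2,2} can be read off. *)
Lemma T22_case x b c : free [:: smul mu x b; smul mu x c] ->
  (forall x b c d, ~ free [:: smul mu x b; smul mu x c; smul mu x d]) ->
  (forall a b c, ~ free [:: smul mu a b; smul mu a c; smul mu b c]) ->
  (5 <= n)%N /\ orbit mu (T22 k n).
Proof.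
move=> fbc no3 nocyc.
have [b' [c' [fbc' bc0]]] : exists b' c',
    free [:: smul mu x b'; smul mu x c'] /\ smul mu b' c' = 0.
  have [a1 [a2 bcE]] := not_free3 fbc (@nocyc x b c).
  (* With bc = a1 xb + a2 xc, the new product is bc - a1 xb - a2 xc, and the products with x do not
     change. *)
  exists (b - a2 *: x), (c + a1 *: x).
  rewrite !smulBr !smulDr !smulZr !am !scaler0 subr0 addr0; split=> //.
  rewrite !smulBl !smulZl !am scaler0 subr0 bcE (anticommC b x) // scalerN.
  move: (smul mu x b) (smul mu x c) => u v.
  by apply/rowP => j; rewrite !mxE; ring.
move: b' c' fbc' bc0 {fbc} => {}b {}c fbc bc0.
have [u0 v0] : smul mu x b != 0 /\ smul mu x c != 0.
  by split; apply: (free_not0 fbc); rewrite !inE eqxx ?orbT.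
have sub3 d : exists a1 a2 a3, let d' := d - (a1 *: x + a2 *: b + a3 *: c) in
    [/\ smul mu x d' = 0, smul mu b d' = 0 & smul mu c d' = 0].
  have [s [t xd]] := not_free3 fbc (@no3 x b c d).
  pose d1 := d - (s *: b + t *: c).
  have xd1 : smul mu x d1 = 0 by rewrite /d1 smulBr smulDr !smulZr xd subrr.
  have pf1 f : w f x b = 1 -> w f c d1 = w f x c * w f b d1.
    by move=> fb; rewrite (noquad_pfaffian c d1 fb) {3}/w bc0 ev0 mul0r subr0.
  have pf2 f : w f x c = 1 -> w f b d1 = w f x b * w f c d1.
    move=> fc; rewrite (noquad_pfaffian b d1 fc) [w f c b]formC // {3}/w bc0 ev0 oppr0.
    by rewrite mul0r subr0.
  have [a1 [a2 cd]] : exists a1 a2, smul mu c d1 = a1 *: smul mu x b + a2 *: smul mu x c.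
    apply: (not_free3 fbc) => fcd; have [f fE] := dual (nth 0 [:: 1; 0; 1]) fcd.
    have f0 : w f x b = 1 := fE 0%N isT; have f1 : w f x c = 0 := fE 1%N isT.
    have f2 : w f c d1 = 1 := fE 2%N isT.
    by have := pf1 f f0; rewrite f1 f2 mul0r => /eqP; rewrite oner_eq0.
  have [b1 [b2 bd]] : exists b1 b2, smul mu b d1 = b1 *: smul mu x b + b2 *: smul mu x c.
    apply: (not_free3 fbc) => fcd; have [f fE] := dual (nth 0 [:: 0; 1; 1]) fcd.
    have f0 : w f x b = 0 := fE 0%N isT; have f1 : w f x c = 1 := fE 1%N isT.
    have f2 : w f b d1 = 1 := fE 2%N isT.
    by have := pf2 f f1; rewrite f0 f2 mul0r => /eqP; rewrite oner_eq0.
  have ev_cd f : w f c d1 = a1 * w f x b + a2 * w f x c by rewrite /w cd evD !evZ.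
  have ev_bd f : w f b d1 = b1 * w f x b + b2 * w f x c by rewrite /w bd evD !evZ.
  (* Prescribing the values (1,0), (0,1) and (1,1) on xb and xc turns the Pfaffian identities into
     a1 = 0, b2 = 0 and a2 = b1. *)
  have values r1 r2 : exists f, w f x b = r1 /\ w f x c = r2.
    have [f fE] := dual (nth 0 [:: r1; r2]) fbc; exists f.
    by split; [apply: (fE 0%N) | apply: (fE 1%N)].
  have a10 : a1 = 0.
    have [f [f1 f2]] := values 1 0.
    by have := pf1 f f1; rewrite ev_cd f1 f2 mulr1 mulr0 mul0r addr0.
  have b20 : b2 = 0.
    have [f [f1 f2]] := values 0 1.
    by have := pf2 f f2; rewrite ev_bd f1 f2 mulr1 mulr0 mul0r add0r.
  have a2b1 : a2 = b1.
    have [f [f1 f2]] := values 1 1.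
    by have := pf1 f f1; rewrite ev_cd ev_bd f1 f2 a10 b20 !mulr1 mul1r add0r addr0.
  (* Now b d1 = a2 xb and c d1 = a2 xc, so adding a2 x to d1 cancels both products, since bx = -xb
     and cx = -xc. *)
  exists (- a2), s, t => /=.
  have -> : d - (- a2 *: x + s *: b + t *: c) = d1 + a2 *: x.
    by apply/rowP => j; rewrite !mxE; ring.
  clearbody d1; rewrite !smulDr !smulZr am xd1 cd bd a10 b20 a2b1.
  rewrite (anticommC b x) // (anticommC c x) //.
  by rewrite !scale0r !add0r !addr0 scaler0 !scalerN !subrr.
pose A := [:: x; b; c]; pose B := [:: smul mu x b; smul mu x c].
have fAB : free (A ++ B).
  apply: free_cat_coef => // h; rewrite !lincomb_cons lincomb_nil addr0 /= => hB.
  have BA v : v \in B -> v \in annv mu.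
    by rewrite !inE => /orP[] /eqP ->; apply: smul_annv.
  have /annvP hA : h 0%N *: x + (h 1%N *: b + h 2%N *: c) \in annv mu.
    by have [e ->] := mem_lincomb hB; apply: lincomb_mem.
  have := hA x; rewrite anticommC // !smulDr !smulZr am scaler0 add0r => /eqP.
  rewrite oppr_eq0 => /eqP/(free2P fbc)[h1 h2]; move: (hA b); rewrite h1 h2 !scale0r !addr0.
  rewrite smulZl => /eqP; rewrite scaler_eq0 (negPf u0) orbF => /eqP h0.
  by move=> [|[|[|i]]].
have /= n5 := free_size fAB; split=> //.
have [|Z [sX fX ZA]] := complete_in (U := annv mu) fAB.
  apply/eqP; rewrite eqEsubv subvf; apply/subvP => d _.
  have [a1 [a2 [a3 pd]]] := sub3 d.
  rewrite -[d](subrK (a1 *: x + a2 *: b + a3 *: c)) addrC.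
  apply: memv_add.
    by do !apply: memvD; apply/memvZ/memv_span; rewrite !inE eqxx ?orbT.
  apply/annvP => y; have [b1 [b2 [b3 pd']]] := sub3 y.
  rewrite -[y](subrK (b1 *: x + b2 *: b + b3 *: c)).
  move: (d - _) (y - _) pd pd' => d1 d2 [xd bd cd] [xd' bd' cd'].
  rewrite smulDr (common_centralizer u0 xd bd xd' bd') add0r anticommC // !smulDl !smulZl.
  by rewrite xd bd cd !scaler0 !addr0 oppr0.
have := @nth_tail _ n (A ++ Z) B; rewrite -catA => tail.
have t0 := tail 0%N sX isT; have t1 := tail 1%N sX isT.
have n0 : (n - 2 + 0 = (n - 1).-1)%N by lia.
have n1 : (n - 2 + 1 = n.-1)%N by lia.
rewrite /= n0 in t0; rewrite /= n1 in t1.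
apply: (recognize_ann am sX fX) => [y||].
- by rewrite mem_cat => /orP[/ZA //|]; rewrite !inE => /orP[] /eqP ->; apply: smul_annv.
- by rewrite /=; lia.
move=> i j /andP[]; move: i j => [|[|[|i]]] [|[|[|j]]] //= _ _;
  by rewrite !table_prodE /= ?t0 ?t1 ?bc0.
Qed.

(** All products xd are multiples of xb and all bd of bx, so each d can be corrected to be killed by
    x and b; corrected vectors then lie in the annihilator. *)
Lemma eta1_case x b : smul mu x b != 0 ->
  (forall x b c, ~ free [:: smul mu x b; smul mu x c]) ->
  (3 <= n)%N /\ orbit mu (eta k n 1).
Proof.
move=> u0 no2.
have v0 : smul mu b x != 0 by rewrite anticommC // oppr_eq0.
have sub2 d : exists a1 a2, let d' := d - (a1 *: x + a2 *: b) in
    smul mu x d' = 0 /\ smul mu b d' = 0.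
  have [s xd] := not_free2 u0 (@no2 x b d); have [t bd] := not_free2 v0 (@no2 b x d).
  exists t, s; rewrite /= !smulBr !smulDr !smulZr !am xd bd scaler0 add0r.
  by rewrite scaler0 addr0 !subrr.
pose A := [:: x; b]; pose B := [:: smul mu x b].
have fAB : free (A ++ B).
  apply: free_cat_coef => [|h]; first by rewrite seq1_free.
  rewrite !lincomb_cons lincomb_nil addr0 /= => hB.
  have BA v : v \in B -> v \in annv mu by rewrite inE => /eqP ->; apply: smul_annv.
  have /annvP hA : h 0%N *: x + h 1%N *: b \in annv mu.
    by have [e ->] := mem_lincomb hB; apply: lincomb_mem.
  have := hA b; rewrite smulDl !smulZl am scaler0 addr0 => /eqP.
  rewrite scaler_eq0 (negPf u0) orbF => /eqP h0.
  have := hA x; rewrite smulDl !smulZl am scaler0 add0r => /eqP.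
  rewrite scaler_eq0 (negPf v0) orbF => /eqP h1.
  by move=> [|[|i]].
have /= n3 := free_size fAB; split=> //.
have [||Z [sX fX ZA]] := @complete_in _ _ (A ++ B) [::] (annv mu).
- by rewrite cats0.
- apply/eqP; rewrite eqEsubv subvf; apply/subvP => d _.
  have [a1 [a2 pd]] := sub2 d.
  rewrite -[d](subrK (a1 *: x + a2 *: b)) addrC.
  apply: memv_add.
    by do !apply: memvD; apply/memvZ/memv_span; rewrite !inE eqxx ?orbT.
  apply/annvP => y; have [b1 [b2 pd']] := sub2 y.
  rewrite -[y](subrK (b1 *: x + b2 *: b)).
  move: (d - _) (y - _) pd pd' => d1 d2 [xd bd] [xd' bd'].
  rewrite smulDr (common_centralizer u0 xd bd xd' bd') add0r anticommC // !smulDl !smulZl.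
  by rewrite xd bd !scaler0 !addr0 oppr0.
rewrite cats0 -catA in sX fX.
apply: (recognize_ann am sX fX) => [y||].
- by rewrite inE => /predU1P[->|/ZA //]; apply: smul_annv.
- by rewrite /= n3.
by move=> i j /andP[]; move: i j => [|[|i]] [|[|j]] //= _ _; rewrite !table_prodE.
Qed.

End NoQuad.

(** A combination of a, b, c lying in the span of the products is in the annihilator; multiplying it
    by a and then by b kills its coefficients. *)
Lemma cube0_eps23 a b c : free [:: smul mu a b; smul mu a c; smul mu b c] ->
  (6 <= n)%N /\ degen mu (T22_eps23 k n).
Proof.
move=> fP; apply: (@eps23_degen _ _ mu a b c am).
have fB : free [:: smul mu b c; smul mu a b; smul mu a c].
  by rewrite (perm_free (permEl (perm_catC [:: smul mu b c] _))).
apply: (@free_cat_coef _ _ [:: a; b; c] [:: smul mu b c; smul mu a b; smul mu a c]) => // h.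
rewrite !lincomb_cons lincomb_nil addr0 /= => hB.
have /annvP hA : h 0%N *: a + (h 1%N *: b + h 2%N *: c) \in annv mu.
  have [e ->] := mem_lincomb hB; apply: lincomb_mem => v.
  by rewrite !inE => /or3P[] /eqP ->; apply: smul_annv.
have := hA a; rewrite anticommC // !smulDr !smulZr am scaler0 add0r => /eqP.
have := @free3P _ _ _ _ _ fP (h 1%N) (h 2%N) 0.
rewrite scale0r addr0 oppr_eq0 => H /eqP/H[h1 h2 _].
have := hA b; rewrite h1 h2 !scale0r !addr0 smulZl => h0.
have := @free3P _ _ _ _ _ fP (h 0%N) 0 0; rewrite !scale0r !addr0 => /(_ h0)[h00 _ _].
by move=> [|[|[|i]]].
Qed.

Lemma cube0_T222 x b c d : free [:: smul mu x b; smul mu x c; smul mu x d] ->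
  (7 <= n)%N /\ degen mu (T222 k n).
Proof.
move=> fP; apply: (@T222_degen _ _ mu x b c d am).
apply: (@free_cat_coef _ _ [:: x; b; c; d]) => // h.
rewrite !lincomb_cons lincomb_nil addr0 /= => hB.
have /annvP hA : h 0%N *: x + (h 1%N *: b + (h 2%N *: c + h 3%N *: d)) \in annv mu.
  have [e ->] := mem_lincomb hB; apply: lincomb_mem => v.
  by rewrite !inE => /or3P[] /eqP ->; apply: smul_annv.
have := hA x; rewrite anticommC // !smulDr !smulZr am scaler0 add0r => /eqP.
rewrite oppr_eq0 => /eqP/(free3P fP)[h1 h2 h3].
have := hA b; rewrite h1 h2 h3 !scale0r !addr0 smulZl => h0.
have := @free3P _ _ _ _ _ fP (h 0%N) 0 0; rewrite !scale0r !addr0 => /(_ h0)[h00 _ _].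
by move=> [|[|[|[|i]]]].
Qed.

Inductive cube0_class : Prop :=
| Class0 of mu = 0
| Class_eta1 of (3 <= n)%N & orbit mu (eta k n 1)
| Class_eta2 of (5 <= n)%N & orbit mu (eta k n 2)
| Class_T22 of (5 <= n)%N & orbit mu (T22 k n)
| Class_eta3 of (7 <= n)%N & degen mu (eta k n 3)
| Class_eps23 of (6 <= n)%N & degen mu (T22_eps23 k n)
| Class_eps24 of (6 <= n)%N & degen mu (T22_eps24 k n)
| Class_T222 of (7 <= n)%N & degen mu (T222 k n).

(** The order of the tests matters: recognizing T^{2,2} uses the failure of all three preceding
    ones. *)
Theorem cube0_classification : cube0_class.
Proof.
have [[x [b [c [d fr]]]]|no3] :=
  classic (exists x b c d, free [:: smul mu x b; smul mu x c; smul mu x d]).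
  by have [] := cube0_T222 fr; apply: Class_T222.
have [[f [e1 [e2 [e3 [e4 Q]]]]]|noQ] :=
  classic (exists f e1 e2 e3 e4, quad f e1 e2 e3 e4).
  by case: (quad_case Q) => -[]; [apply: Class_eps24 | apply: Class_eta3 | apply: Class_eta2].
have noquad f e1 e2 e3 e4 : ~ quad f e1 e2 e3 e4.
  by move=> Q; apply: noQ; exists f, e1, e2, e3, e4.
have [[a [b [c fr]]]|nocyc] :=
  classic (exists a b c, free [:: smul mu a b; smul mu a c; smul mu b c]).
  by have [] := cube0_eps23 fr; apply: Class_eps23.
have [[x [b [c fr]]]|no2] :=
  classic (exists x b c, free [:: smul mu x b; smul mu x c]).
  have [] := T22_case noquad fr; last exact: Class_T22.
    by move=> y a d e fr'; apply: no3; exists y, a, d, e.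
  by move=> a d e fr'; apply: nocyc; exists a, d, e.
have [[x [b xb]]|no1] := classic (exists x b, smul mu x b != 0).
  have [] := eta1_case noquad xb.
    by move=> y a d fr; apply: no2; exists y, a, d.
  exact: Class_eta1.
apply: Class0; apply: eq_structure => i j; rewrite [RHS]/smul mulmx0.
by apply/eqP/negPn/negP => ij; apply: no1; exists 'e_i, 'e_j.
Qed.

End CubeZero.

(** * Algebras whose square does not lie in the annihilator *)

Section Engel.
Variables (k : closedFieldType) (n : nat).
Local Notation V := 'rV[k]_n.
Variable mu : structure k n.
Variable m : nat.
Hypotheses (am : anticomm mu) (em : engel_index m mu).
Implicit Types (A B E X Z : seq V) (f : 'cV[k]_n) (x y d e : V).
Local Notation "x ** y" := (smul mu x y) (at level 40, left associativity).

Lemma engel_eigen x y lam : x ** y = lam *: y -> y != 0 -> lam = 0.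
Proof.
move=> xy y0; have H r : iter r (smul mu x) y = lam ^+ r *: y.
  elim: r => [|r IH]; first by rewrite scale1r.
  by rewrite iterS IH smulZr xy scalerA exprSr.
move: (H m); rewrite em => /esym/eqP; rewrite scaler_eq0 (negPf y0) orbF expf_eq0.
by case/andP => _ /eqP.
Qed.

Lemma iter_lincomb r a c X : iter r (smul mu a) (lincomb c X) =
  lincomb c (map (iter r (smul mu a)) X).
Proof.
have add x y : iter r (smul mu a) (x + y) = iter r (smul mu a) x + iter r (smul mu a) y.
  by elim: (r) => // j IH; rewrite !iterS IH smulDr.
have scale t x : iter r (smul mu a) (t *: x) = t *: iter r (smul mu a) x.
  by elim: (r) => // j IH; rewrite !iterS IH smulZr.
have zero : iter r (smul mu a) 0 = 0 by elim: (r) => // j IH; rewrite iterS IH smul0r.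
elim: X c => [|x X IH] c /=; first by rewrite !lincomb_nil zero.
by rewrite !lincomb_cons add scale IH.
Qed.

Lemma iter0_ge a b r j : iter r (smul mu a) b = 0 -> (r <= j)%N ->
  iter j (smul mu a) b = 0.
Proof.
move=> b0 /subnK <-; rewrite iterD b0; elim: (j - r)%N => // i IH.
by rewrite iterS IH smul0r.
Qed.

(** The chain is independent by nilpotency. If a were in its span, a a = 0 would leave only the top
    term, a = c_r L_a^r b. Then z = L_a^(r-1) b satisfies z a = -(c_r)^(-1) a, a nonzero eigenvalue
    of L_z, against the Engel condition. *)
Lemma jordan_free a b r : (0 < r)%N -> iter r (smul mu a) b != 0 ->
  iter r.+1 (smul mu a) b = 0 -> free (a :: traject (smul mu a) b r.+1).
Proof.
move=> r0 br br1; set T := traject (smul mu a) b r.+1.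
have sT : size T = r.+1 by rewrite size_traject.
have nthT i : (i <= r)%N -> T`_i = iter i (smul mu a) b.
  by move=> ir; rewrite (set_nth_default b) ?sT // nth_traject.
clearbody T.
have coef c : lincomb c T = 0 -> forall i, (i <= r)%N -> c i = 0.
  move=> c0; elim/ltn_ind => i IH ir.
  have : iter (r - i) (smul mu a) (lincomb c T) = 0.
    by rewrite c0; elim: (r - i)%N => // j IHj; rewrite iterS IHj smul0r.
  have iT : (i < size T)%N by rewrite sT.
  rewrite iter_lincomb /lincomb size_map (bigD1 (Ordinal iT)) //= big1 ?addr0.
    rewrite (nth_map 0) // nthT // -iterD subnK // => /eqP.
    by rewrite scaler_eq0 (negPf br) orbF => /eqP.
  move=> j; rewrite -val_eqE /= => ji; have jr : (j <= r)%N by rewrite -ltnS -sT.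
  rewrite (nth_map 0) // nthT // -iterD; have [lt|gt|eq] := ltngtP j i.
  - by rewrite IH ?scale0r.
  - by rewrite (iter0_ge br1) ?scaler0 //; lia.
  by rewrite eq eqxx in ji.
have fT : free T by apply: coef_free => c c0 i; rewrite sT ltnS; apply: coef.
rewrite free_cons fT andbT; apply/negP => /mem_lincomb[c ac].
have a0 : a != 0.
  by apply: contraNneq br => a0; rewrite -(prednK r0) iterS a0 smul0l eqxx.
(* The coefficients of a a along the chain: those of a shifted by one, the last one lost because
   L_a^(r+1) b = 0. *)
pose d i := if i is j.+1 then (if (j < r)%N then c j else 0) else 0.
have d0 : lincomb d T = 0.
  rewrite -(am a) [X in _ = _ ** X]ac.
  have -> : a ** lincomb c T = lincomb c (map (smul mu a) T).
    exact: (iter_lincomb 1).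
  rewrite /lincomb size_map sT big_ord_recl /= scale0r add0r [RHS]big_ord_recr /=.
  rewrite (nth_map 0) ?sT // nthT // -iterS br1 scaler0 addr0.
  apply: eq_bigr => j _; rewrite /= ltn_ord (nth_map 0) ?sT //; last exact: ltnW (ltn_ord j).
  by rewrite !nthT // ltnW.
have cr : a = c r *: iter r (smul mu a) b.
  rewrite {1}ac /lincomb sT big_ord_recr /= nthT // big1 ?add0r // => j _.
  by have := coef d d0 j.+1 (ltn_ord j); rewrite /d ltn_ord => ->; rewrite scale0r.
have c0 : c r != 0 by apply: contraNneq a0 => cr0; rewrite cr cr0 scale0r.
pose z := iter r.-1 (smul mu a) b.
have za : z ** a = (- (c r)^-1) *: a.
  rewrite anticommC // /z -iterS prednK // [in RHS]cr scaleNr scalerA mulVf //.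
  by rewrite scale1r.
by have /eqP := engel_eigen za a0; rewrite oppr_eq0 invr_eq0 (negPf c0).
Qed.

(** Replacing b by its image under a suitable power of L_a shortens a longer chain to exactly the
    length required. *)
Lemma jordan_exists a b r : (0 < r)%N -> iter r (smul mu a) b != 0 ->
  exists b', iter r (smul mu a) b' != 0 /\ iter r.+1 (smul mu a) b' = 0.
Proof.
move=> r0 br; have ex : exists j, iter (j + r) (smul mu a) b == 0.
  by exists m; rewrite (@iter0_ge a b m) ?em ?leq_addr.
case: (ex_minnP ex) => -[|j] /eqP j0 jmin; first by rewrite j0 eqxx in br.
exists (iter j (smul mu a) b); rewrite -!iterD addnC; split.
  by apply/negP => /jmin; rewrite ltnn.
by rewrite -addnC addnS -addSn.
Qed.

Lemma alternating x y z : (forall a b, a ** (a ** b) = 0) ->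
  x ** (y ** z) = - (y ** (x ** z)).
Proof.
move=> sq0; apply/eqP; rewrite -addr_eq0; have := sq0 (x + y) z.
by rewrite !smulDl !smulDr !sq0 add0r addr0 => ->.
Qed.

(** Linearizing a(ab) = 0 makes x(yz) alternating, so W = a(bc) equals c(ab) and -b(ac). Multiplying
    a relation by a, b and c in turn reduces it to multiples of W, which is nonzero. *)
Lemma square0_eps23 a b c : (forall x y, x ** (x ** y) = 0) -> a ** (b ** c) != 0 ->
  (6 <= n)%N /\ degen mu (T22_eps23 k n).
Proof.
move=> sq0 w0; apply: (@eps23_degen _ _ mu a b c am); set W := a ** (b ** c) in w0.
have sq0' x y : x ** (y ** x) = 0 by rewrite (anticommC y) // smulNr sq0 oppr0.
have baW : b ** (a ** c) = - W by rewrite alternating.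
have cabW : c ** (a ** b) = W.
  by rewrite alternating // (anticommC c b) // smulNr opprK.
have bW : b ** W = 0.
  have -> : W = b ** (c ** a) by rewrite (anticommC c) // smulNr baW opprK.
  exact: sq0.
have cW : c ** W = 0 by rewrite -cabW sq0.
have W0 t : t *: W = 0 -> t = 0 by move/eqP; rewrite scaler_eq0 (negPf w0) orbF => /eqP.
apply: coef_free => h; rewrite !lincomb_cons lincomb_nil addr0 /= => E.
have Ea : h 1%N *: (a ** b) + (h 2%N *: (a ** c) + h 3%N *: W) = 0.
  have := congr1 (smul mu a) E; rewrite !smulDr !smulZr am !sq0 !scaler0 !addr0 add0r.
  by rewrite smul0r.
have h2 : h 2%N = 0.
  have := congr1 (smul mu b) Ea; rewrite !smulDr !smulZr sq0' bW baW smul0r !scaler0.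
  by rewrite addr0 add0r scalerN -scaleNr => /W0/eqP; rewrite oppr_eq0 => /eqP.
have h1 : h 1%N = 0.
  have := congr1 (smul mu c) Ea; rewrite !smulDr !smulZr sq0' cW cabW smul0r !scaler0.
  by rewrite !addr0 => /W0.
have h3 : h 3%N = 0 by move: Ea; rewrite h1 h2 !scale0r !add0r => /W0.
move: E; rewrite h1 h2 h3 !scale0r !add0r => E.
have h0 : h 0%N = 0.
  have := congr1 (smul mu c) (congr1 (smul mu b) E).
  rewrite !smulDr !smulZr sq0' baW !smulNr cW (anticommC b a) // !smulNr cabW !smul0r.
  rewrite !scaler0 oppr0 scaler0 !addr0 scalerN -scaleNr => /W0/eqP.
  by rewrite oppr_eq0 => /eqP.
have h5 : h 5%N = 0.
  have := congr1 (smul mu b) E; rewrite h0 scale0r add0r !smulDr !smulZr sq0' baW smul0r.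
  by rewrite scaler0 add0r scalerN -scaleNr => /W0/eqP; rewrite oppr_eq0 => /eqP.
have h4 : h 4%N = 0.
  have := congr1 (smul mu c) E; rewrite h0 h5 !scale0r add0r addr0 !smulZr cabW smul0r.
  by move/W0.
by move=> [|[|[|[|[|[|i]]]]]].
Qed.

Lemma jordan3 a b : a ** (a ** b) != 0 ->
  exists b', free [:: a; b'; a ** b'; a ** (a ** b')] /\ a ** (a ** (a ** b')) = 0.
Proof.
move=> ab; have [b' [b2 b3]] := @jordan_exists a b 2 isT ab.
by exists b'; split => //; apply: (@jordan_free a b' 2).
Qed.

Lemma not_cube0 : ~ cube0 mu ->
  ((6 <= n)%N /\ degen mu (T22_eps23 k n)) \/
  exists a b, free [:: a; b; a ** b; a ** (a ** b)] /\ a ** (a ** (a ** b)) = 0.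
Proof.
move=> nc; have [[a [b ab]]|sq] := classic (exists a b, a ** (a ** b) != 0).
  by right; exists a; apply: jordan3 ab.
left; have [[a [b [c abc]]]|no] := classic (exists a b c, a ** (b ** c) != 0).
  apply: (square0_eps23 _ abc) => x y; apply/eqP/negPn/negP => xy.
  by apply: sq; exists x, y.
case: nc => x y z; apply/eqP/negPn/negP => xyz.
by apply: no; exists x, y, z.
Qed.

(** * Dimension four *)

Section Dim4.
Hypothesis n4 : n = 4%N.

(** Otherwise x together with a Jordan chain of length four would give five independent vectors. *)
Lemma dim4_nil3 x y : x ** (x ** (x ** y)) = 0.
Proof.
apply/eqP/negPn/negP => xy; have [b [b3 b4]] := @jordan_exists x y 3 isT xy.
have := free_size (@jordan_free x b 3 isT b3 b4).
by rewrite /= n4.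
Qed.

(** The cube of the left multiplication by x + t y is t P1 + t^2 P2 on z. Its vanishing at t = 1 and
    at a further nonzero scalar gives P1 = 0 without any division by integers. *)
Lemma dim4_linearized x y z :
  y ** (x ** (x ** z)) + x ** (y ** (x ** z)) + x ** (x ** (y ** z)) = 0.
Proof.
have [s s0 s1] := fresh_scalar k.
pose P1 := y ** (x ** (x ** z)) + x ** (y ** (x ** z)) + x ** (x ** (y ** z)).
pose P2 := x ** (y ** (y ** z)) + y ** (x ** (y ** z)) + y ** (y ** (x ** z)).
have H t : t *: P1 + (t * t) *: P2 = 0.
  have := dim4_nil3 (x + t *: y) z; rewrite !(smulDl, smulDr, smulZl, smulZr).
  rewrite /P1 /P2 (dim4_nil3 x z) (dim4_nil3 y z) => E; rewrite -[RHS]E.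
  move: (y ** (x ** (x ** z))) (x ** (y ** (x ** z))) (x ** (x ** (y ** z)))
    (x ** (y ** (y ** z))) (y ** (x ** (y ** z))) (y ** (y ** (x ** z))).
  move=> u1 u2 u3 u4 u5 u6; rewrite !scaler0 !addr0 add0r !scalerDr !scalerA.
  by apply/rowP => j; rewrite !mxE; ring.
change (P1 = 0); clearbody P1 P2; have := H 1; rewrite mulr1 !scale1r => H1.
have := H s; rewrite -[P1](addrK P2) H1 sub0r scalerN addrC -scalerBl.
have -> : s * s - s = s * (s - 1) by ring.
move/eqP; rewrite scaler_eq0 mulf_eq0 (negPf s0) subr_eq0 (negPf s1) => /eqP P20.
by rewrite P20 oppr0.
Qed.

(** In the basis a, b, c = ab, d = ac, only bc, bd and cd are unknown. The linearized identity
    expresses bd and cd through bc, the Engel condition and L_b^3 = 0 reduce bc to a multiple of d,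
    and a shift of b removes it. *)
Lemma dim4_T3 a b : free [:: a; b; a ** b; a ** (a ** b)] -> a ** (a ** (a ** b)) = 0 ->
  orbit mu (T3 k n).
Proof.
move=> fX ad; set c := a ** b in fX ad; set d := a ** c in fX ad.
have ab : a ** b = c by [].
have ac : a ** c = d by [].
clearbody d; clearbody c.
have nz (h : nat -> k) : h 0%N *: a + (h 1%N *: b + (h 2%N *: c + h 3%N *: d)) = 0 ->
    [/\ h 0%N = 0, h 1%N = 0, h 2%N = 0 & h 3%N = 0].
  move=> E; have := free_coef (c := h) fX; rewrite !lincomb_cons lincomb_nil addr0 /=.
  by move=> /(_ E) H; split; [apply: (H 0%N) | apply: (H 1%N) | apply: (H 2%N) | apply: (H 3%N)].
have d0 : d != 0 by apply: (free_not0 fX); rewrite !inE eqxx !orbT.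
have [p] := lincomb_full (b ** c) (esym n4 : size [:: a; b; c; d] = n) fX.
rewrite !lincomb_cons lincomb_nil addr0 /= => bc.
have abc : a ** (b ** c) = p 1%N *: c + p 2%N *: d.
  by rewrite bc !smulDr !smulZr am ab ac ad !scaler0 add0r addr0.
have bd : b ** d = - (p 1%N *: c + p 2%N *: d).
  apply/eqP; rewrite -addr_eq0 -abc; have := dim4_linearized a b b.
  by rewrite am !smul0r addr0 ab ac => ->.
have aabc : a ** (a ** (b ** c)) = p 1%N *: d.
  by rewrite abc !smulDr !smulZr ad ac scaler0 addr0.
(* Linearizing in the direction c and applying the result to b makes d an eigenvector of L_c, so p1
   = 0. *)
have cd : c ** d = p 1%N *: d.
  have := dim4_linearized a c b; rewrite ab ac am smul0r addr0 (anticommC c b) //.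
  by rewrite !smulNr aabc => /eqP; rewrite subr_eq0 => /eqP.
have p1 := engel_eigen cd d0.
have bbc : b ** (b ** c) = 0.
  have := dim4_nil3 b a; rewrite (anticommC b a) // ab !smulNr => /eqP.
  by rewrite oppr_eq0 => /eqP.
move: bd cd bc; rewrite p1 !scale0r !add0r => bd cd bc.
have E : p 0%N *: c = p 2%N *: (b ** c) + p 3%N *: (b ** d).
  apply/eqP; rewrite -subr_eq0 -oppr_eq0 -bbc {2}bc !smulDr !smulZr (anticommC b a) // ab.
  by rewrite scalerN opprB addrC.
have [p2 p0] : p 2%N = 0 /\ p 0%N = 0.
  (* After bc and bd are substituted, the relation reads p2 p0 a + (p2^2 - p0) c = 0, whence p2^3 =
     0. *)
  have [|h0 _ h2 _] := nz (nth 0 [:: p 2%N * p 0%N; 0; p 2%N * p 2%N - p 0%N; 0]).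
    rewrite /= !scale0r add0r addr0 scalerBl E bc bd; apply/rowP => j.
    by rewrite !mxE; ring.
  have p0 : p 0%N = p 2%N * p 2%N by move/eqP: h2; rewrite /= subr_eq0 => /eqP.
  move: h0 => /= /eqP; rewrite p0 !mulf_eq0 !orbb => /eqP p2.
  by rewrite p2 mulr0.
move: bc bd; rewrite p2 p0 !scale0r !add0r oppr0 => bc bd.
(* At this point bc = p3 d; the shift of b kills this product and preserves ab = c. *)
pose A := [:: a; b - p 3%N *: a; c].
have fX' : free (A ++ [:: d]).
  apply: coef_free => h; rewrite !lincomb_cons lincomb_nil addr0 /= => H.
  have [|h0 h1 h2 h3] := nz (nth 0 [:: h 0%N - h 1%N * p 3%N; h 1%N; h 2%N; h 3%N]).
    rewrite -[RHS]H /= scalerBl scalerBr scalerA; apply/rowP => j.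
    by rewrite !mxE; ring.
  move: h0; rewrite /= in h1 h2 h3 *; rewrite h1 mul0r subr0 => h0.
  by move=> [|[|[|[|i]]]].
have sX : size (A ++ [:: d]) = n := esym n4.
apply: (recognize_ann am sX fX') => [x||].
- rewrite inE => /eqP ->; apply/annvP => y; rewrite anticommC //.
  have [h ->] := lincomb_full y (esym n4 : size [:: a; b; c; d] = n) fX.
  rewrite !lincomb_cons lincomb_nil addr0 !(smulDl, smulZl) bd cd am.
  by rewrite ad !scaler0 !addr0 oppr0.
- by rewrite /= n4.
have n3 : n.-1 = 3%N by rewrite n4.
have X3 : (A ++ [:: d])`_n.-1 = d by rewrite n3.
by move=> i j /andP[]; move: i j => [|[|[|i]]] [|[|[|j]]] //= _ _; rewrite !table_prodE /=
  ?X3 // ?smulBr ?smulBl ?smulZr ?smulZl ?am ?scaler0 ?subr0 // bc ac subrr.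
Qed.

End Dim4.
End Engel.

(** * Levels *)

Section Levels.
Variables (k : closedFieldType) (n : nat).
Implicit Types (mu chi rho : structure k n).

Fixpoint structure_chain m mu := if m is m'.+1 then
  exists chi, [/\ degen mu chi, ~ orbit mu chi & structure_chain m' chi] else True.

Lemma structure_chainW m mu : structure_chain m.+1 mu -> structure_chain m mu.
Proof.
elim: m mu => // m IH mu [chi [mc nmc cm]]; exists chi; split=> //; exact: IH.
Qed.

Lemma structure_chain_le m m' mu : (m' <= m)%N -> structure_chain m mu -> structure_chain m' mu.
Proof. by move=> /subnK <-; elim: (m - m')%N => // i IH /structure_chainW. Qed.

Lemma structure_chain_orbit m mu chi :
  orbit mu chi -> structure_chain m mu -> structure_chain m chi.
Proof.
case: m => // m mc [rho [mr nmr rm]]; exists rho; split=> //.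
  exact: degen_trans (orbit_degen (orbit_sym mc)) mr.
by move=> cr; apply/nmr/(orbit_trans mc).
Qed.

Definition anticomm_engel mu := anticomm mu /\ exists m, engel_index m mu.

Lemma anticomm_engel_degen mu chi : degen mu chi -> anticomm_engel mu -> anticomm_engel chi.
Proof.
move=> mc [am [m em]]; split; first exact: anticomm_degen am.
by exists m; apply: engel_degen em.
Qed.

(** * Levels determined by a list of representatives *)

Section Abstract.
Variable L : nat -> structure k n -> Prop.
Hypothesis cover : forall mu, anticomm_engel mu ->
  (exists2 j, (j < 3)%N & exists2 x, L j x & orbit mu x) \/
  (exists2 x, L 3 x & degen mu x).
Hypothesis step : forall j x, (j < 3)%N -> L j.+1 x ->
  exists y, [/\ L j y, degen x y & ~ orbit x y].
Hypothesis anti : forall j x y, (j <= 3)%N -> L j x -> L j y -> degen x y -> orbit x y.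

(** By descent from level 3: a representative of level j+1 degenerates to one of level j. *)
Lemma cover_from j mu : (j <= 3)%N -> anticomm_engel mu ->
  (exists2 i, (i < j)%N & exists2 x, L i x & orbit mu x) \/ (exists2 x, L j x & degen mu x).
Proof.
move=> j3 gm; rewrite -[j](subKn j3).
elim: (3 - j)%N (leq_subr j 3) => [|d IH] d3; first exact: cover.
have e3 : (3 - d = (3 - d.+1).+1)%N by lia.
case: (IH (ltnW d3)) => [[i]|[x]]; rewrite e3.
  rewrite ltnS leq_eqVlt => /predU1P[-> [x Lx mx]|id Li]; last by left; exists i.
  by right; exists x => //; apply: orbit_degen.
move=> Lx mx; right; have [|y [Ly xy _]] := step _ Lx; first by lia.
by exists y => //; apply: degen_trans mx xy.
Qed.

Lemma level_chain j x : (j <= 3)%N -> L j x -> structure_chain j x.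
Proof.
elim: j x => // j IH x j3 Lx; have [y [Ly xy nxy]] := step j3 Lx.
by exists y; split=> //; apply: IH; rewrite // ltnW.
Qed.

(** After the first step mu -> chi, either chi has a representative of smaller level and induction
    applies, or chi degenerates to some y of the same level. Then x degenerates to y, so both lie in
    one orbit and chi degenerates back to mu; by antisymmetry the step was trivial. *)
Lemma not_level_chain j mu x : (j <= 3)%N -> anticomm_engel mu -> L j x -> orbit mu x ->
  ~ structure_chain j.+1 mu.
Proof.
elim/ltn_ind: j mu x => j IH mu x j3 gm Lx mx [chi [mc nmc cj]].
have gc := anticomm_engel_degen mc gm.
have [[i ij [y Ly cy]]|[y Ly cy]] := cover_from j3 gc.
  have i3 : (i <= 3)%N := leq_trans (ltnW ij) j3.
  exact: (IH i ij chi y i3 gc Ly cy (structure_chain_le ij cj)).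
have xy : degen x y := degen_trans (orbit_degen (orbit_sym mx)) (degen_trans mc cy).
have ym : orbit y mu := orbit_sym (orbit_trans mx (anti j3 Lx Ly xy)).
apply: nmc; apply: degen_antisym => //.
exact: degen_trans cy (orbit_degen ym).
Qed.

Lemma chain3P mu : anticomm_engel mu ->
  (structure_chain 3 mu /\ ~ structure_chain 4 mu) <-> exists2 x, L 3 x & orbit mu x.
Proof.
move=> gm; split=> [[c3 c4]|[x Lx mx]]; last first.
  split; last exact: not_level_chain Lx mx.
  by apply: (structure_chain_orbit (orbit_sym mx)); apply: level_chain.
case: (cover gm) => [[j j3 [x Lx mx]]|[x Lx mx]].
  case: (@not_level_chain j mu x (ltnW j3) gm Lx mx).
  exact: structure_chain_le j3 c3.
exists x => //; apply: NNPP => nmx; apply: c4; exists x; split=> //.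
exact: level_chain.
Qed.

Lemma not_chain3 mu : anticomm_engel mu -> (forall x, ~ L 3 x) -> ~ structure_chain 3 mu.
Proof.
move=> gm noL; case: (cover gm) => [[j j3 [x Lx mx]] c3|[x /noL//]].
case: (@not_level_chain j mu x (ltnW j3) gm Lx mx).
exact: structure_chain_le j3 c3.
Qed.

End Abstract.
End Levels.

(** * Degenerations between the listed algebras *)

Section Concrete.
Variables (k : closedFieldType) (n : nat).
Implicit Types (mu chi rho : structure k n).
Local Notation b := (bvec k n).

Lemma free_bvec (I : seq nat) : uniq I -> all (fun i => 0 < i <= n)%N I ->
  free (map b I).
Proof.
move=> uI /allP In; apply: coef_free => c c0 i; rewrite size_map => iI.
have := congr1 (ev (b (nth 0%N I i))^T) c0.
rewrite ev_lincomb ev0 size_map (bigD1 (Ordinal iI)) //= (nth_map 0%N) //.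
rewrite {1}/ev bvec_dot ?In ?mem_nth // eqxx mulr1 big1 ?addr0 // => j.
rewrite -val_eqE /= => ji; rewrite (nth_map 0%N) // /ev bvec_dot ?In ?mem_nth //.
by rewrite nth_uniq // (negPf ji) mulr0.
Qed.

Lemma smul_bvec s i j : (0 < i <= n)%N -> (0 < j <= n)%N ->
  smul (anticomm_structure k n s) (b i) (b j) =
  \sum_(t <- s) (((i == t.1.1) && (j == t.1.2))%:R - ((i == t.1.2) && (j == t.1.1))%:R)
    *: b t.2.
Proof.
move=> iN jN; rewrite smul_anticomm_structure; apply: eq_bigr => -[[a c] l] _ /=.
by rewrite !bvec_dot // -!natrM !mulnb.
Qed.

(** With the empty table and the same weight on all basis vectors, every product is too heavy and
    tends to zero. *)
Lemma degen0 mu : anticomm mu -> degen mu 0.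
Proof.
move=> am; have [Z [sX fX]] := @complete k n [::] [::] (nil_free _).
have := @weight_degen4 k n mu _ [::] [::] am sX fX isT isT.
rewrite /anticomm_structure big_nil; exact.
Qed.

Ltac prods := rewrite !smul_bvec ?big_cons ?big_nil /= ?eqxx; try lia;
  rewrite ?(subrr, subr0, scale1r, scale0r, addr0, add0r).

Lemma eta2_eta1 : (5 <= n)%N -> degen (eta k n 2) (eta k n 1).
Proof.
move=> n5; have [|_ //] := @eta1_degen k n (eta k n 2) (b 1) (b 2) (anticomm_anticomm_structure _).
by prods; apply: (@free_bvec [:: 1; 2; 5]%N) => //=; lia.
Qed.

Lemma T22_eta1 : (5 <= n)%N -> degen (T22 k n) (eta k n 1).
Proof.
move=> n5; have [|_ //] := @eta1_degen k n (T22 k n) (b 1) (b 2) (anticomm_anticomm_structure _).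
by prods; apply: (@free_bvec [:: 1; 2; n - 1]%N) => /=; rewrite ?inE; lia.
Qed.

Lemma T3_eta1 : (4 <= n)%N -> degen (T3 k n) (eta k n 1).
Proof.
move=> n4; have [|_ //] := @eta1_degen k n (T3 k n) (b 1) (b 2) (anticomm_anticomm_structure _).
by prods; apply: (@free_bvec [:: 1; 2; 3]%N) => /=; rewrite ?inE; lia.
Qed.

Lemma eps23_T22 : (6 <= n)%N -> degen (T22_eps23 k n) (T22 k n).
Proof.
move=> n6; have [|_ //] :=
  @T22_degen k n (T22_eps23 k n) (b 1) (b 2) (b 3) (anticomm_anticomm_structure _).
by prods; apply: (@free_bvec [:: 1; 2; 3; n - 1; n]%N) => /=; rewrite ?inE; lia.
Qed.

Lemma eps24_T22 : (6 <= n)%N -> degen (T22_eps24 k n) (T22 k n).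
Proof.
move=> n6; have [|_ //] :=
  @T22_degen k n (T22_eps24 k n) (b 1) (b 2) (b 3) (anticomm_anticomm_structure _).
by prods; apply: (@free_bvec [:: 1; 2; 3; n - 1; n]%N) => /=; rewrite ?inE; lia.
Qed.

Lemma T222_T22 : (7 <= n)%N -> degen (T222 k n) (T22 k n).
Proof.
move=> n7; rewrite T222E //; have [|_ //] :=
  @T22_degen k n (anticomm_structure k n [:: (1, 2, n - 2); (1, 3, n - 1); (1, 4, n)]%N)
    (b 1) (b 2) (b 3) (anticomm_anticomm_structure _).
by prods; apply: (@free_bvec [:: 1; 2; 3; n - 2; n - 1]%N) => /=; rewrite ?inE; lia.
Qed.

(** In T^3 the product e1 e2 = e3 is itself a factor. Replacing e3 by e3 + e4 separates factor from
    product, since e1 e4 = 0 leaves e1 (e3 + e4) = e_n. This needs e4 different from e_n, hence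
    dimension at least 5. *)
Lemma T3_T22 : (5 <= n)%N -> degen (T3 k n) (T22 k n).
Proof.
move=> n5; have [|_ //] :=
  @T22_degen k n (T3 k n) (b 1) (b 2) (b 3 + b 4) (anticomm_anticomm_structure _).
rewrite smulDr; prods.
apply: coef_free => c; rewrite !lincomb_cons lincomb_nil addr0 /= => c0.
have fX : free (map b [:: 1; 2; 3; 4; n]%N) by apply: free_bvec => /=; rewrite ?inE; lia.
have := @free_coef _ _ _ (nth 0 [:: c 0%N; c 1%N; c 2%N + c 3%N; c 2%N; c 4%N]) fX.
rewrite !lincomb_cons lincomb_nil addr0 /= => H.
have {}H := H (etrans _ c0).
have E : c 0%N *: b 1 + (c 1%N *: b 2 + ((c 2%N + c 3%N) *: b 3 + (c 2%N *: b 4 + c 4%N *: b n))) =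
  c 0%N *: b 1 + (c 1%N *: b 2 + (c 2%N *: (b 3 + b 4) + (c 3%N *: b 3 + c 4%N *: b n))).
  by apply/rowP => j; move: (b 1) (b 2) (b 3) (b 4) (b n) => *; rewrite !mxE; ring.
have {}H := H E; have c2 : c 2%N = 0 := H 3%N isT.
move=> [|[|[|[|[|i]]]]] // _; [exact: (H 0%N)|exact: (H 1%N)| |exact: (H 4%N)].
by have := H 2%N isT; rewrite /= c2 add0r.
Qed.

(** Two of the three hyperbolic pairs of the coordinate form of e7 are kept. *)
Lemma eta3_eta2 : (7 <= n)%N -> degen (eta k n 3) (eta k n 2).
Proof.
move=> n7; have [] // := @eta_degen k n (eta k n 3) (anticomm_anticomm_structure _) 2
  (b 7)^T (map b [:: 1; 2; 3; 4]%N) (b 7) erefl.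
- move=> i j /andP[]; move: i j => [|[|[|[|i]]]] [|[|[|[|j]]]] //= _ _;
  rewrite /form; prods; rewrite ?ev0 // /ev bvec_dot ?eqxx //; lia.
- apply/annvP => y; rewrite smul_anticomm_structure !big_cons big_nil !bvec_dot //=.
  by rewrite !mul0r subrr scale0r !addr0.
by rewrite /ev bvec_dot ?eqxx //; lia.
Qed.

End Concrete.

(** * Representatives of the levels and their separation *)

Section LevelRepresentatives.
Variables (k : closedFieldType) (n : nat).
Implicit Types (mu chi rho : structure k n).

Definition level_rep j mu : Prop :=
  match j with
  | 0 => mu = 0
  | 1 => (3 <= n)%N /\ mu = eta k n 1
  | 2 => ((5 <= n)%N /\ (mu = eta k n 2 \/ mu = T22 k n)) \/ (n = 4%N /\ mu = T3 k n)
  | 3 => [\/ (5 <= n)%N /\ mu = T3 k n,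
             (6 <= n)%N /\ (mu = T22_eps23 k n \/ mu = T22_eps24 k n) |
             (7 <= n)%N /\ (mu = eta k n 3 \/ mu = T222 k n)]
  | _ => False
  end.

Lemma level_cover mu : anticomm_engel mu ->
  (exists2 j, (j < 3)%N & exists2 x, level_rep j x & orbit mu x) \/
  (exists2 x, level_rep 3 x & degen mu x).
Proof.
move=> [am [m em]]; have [cm|ncm] := classic (cube0 mu).
  case: (cube0_classification am cm) => [->|n3 mc|n5 mc|n5 mc|n7 mc|n6 mc|n6 mc|n7 mc].
  - by left; exists 0%N => //; exists 0 => //; apply: orbit_refl.
  - by left; exists 1%N => //; exists (eta k n 1).
  - by left; exists 2%N => //; exists (eta k n 2) => //; left; split=> //; left.
  - by left; exists 2%N => //; exists (T22 k n) => //; left; split=> //; right.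
  - by right; exists (eta k n 3) => //; apply: Or33; split=> //; left.
  - by right; exists (T22_eps23 k n) => //; apply: Or32; split=> //; left.
  - by right; exists (T22_eps24 k n) => //; apply: Or32; split=> //; right.
  by right; exists (T222 k n) => //; apply: Or33; split=> //; right.
case: (not_cube0 am em ncm) => [[n6 mc]|[a [b [fX ad]]]].
  by right; exists (T22_eps23 k n) => //; apply: Or32; split=> //; left.
have [n4 mc] := T3_degen am fX; have [n5|] := ltnP 4 n.
  by right; exists (T3 k n) => //; apply: Or31.
move=> n4'; have e4 : n = 4%N by apply/eqP; rewrite eqn_leq n4' n4.
left; exists 2%N => //; exists (T3 k n); first by right.
exact: dim4_T3 em e4 _ _ fX ad.
Qed.

Lemma square_lt1_0 : square_lt 1 (0 : structure k n).
Proof.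
apply: (@square_lt_bound k n 1 0 0 (fun _ _ _ => 0) (fun _ => 0)) => // x y.
by rewrite big_ord0 /smul mulmx0.
Qed.

Lemma eta1_forms : forms_lt4 (eta k n 1).
Proof. by apply: (forms_lt4_bound (w := _)) => x y; apply: row_table. Qed.

Lemma T222_forms : (7 <= n)%N -> forms_lt4 (T222 k n).
Proof.
by move=> n7; rewrite T222E //; apply: (forms_lt4_bound (w := _)) => x y; apply: row_table.
Qed.

Lemma T222_triple : (7 <= n)%N -> triple_dep (T222 k n).
Proof.
by move=> n7; rewrite T222E //; apply: (triple_dep_bound (w := _)) => x y; apply: row_table.
Qed.

Lemma eps23_coann : (6 <= n)%N -> coann_lt 4 (T22_eps23 k n).
Proof. by move=> n6; apply: (@coann_lt_table _ _ 4 _ [:: 1; 2; 3]%N) => //=; lia. Qed.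

Lemma T3_coann : (5 <= n)%N -> coann_lt 4 (T3 k n).
Proof. by move=> n6; apply: (@coann_lt_table _ _ 4 _ [:: 1; 2; 3]%N) => //=; lia. Qed.

Lemma T22_coann : (5 <= n)%N -> coann_lt 4 (T22 k n).
Proof. by move=> n6; apply: (@coann_lt_table _ _ 4 _ [:: 1; 2; 3]%N) => //=; lia. Qed.

Lemma eps24_coann5 : (6 <= n)%N -> coann_lt 5 (T22_eps24 k n).
Proof. by move=> n6; apply: (@coann_lt_table _ _ 5 _ [:: 1; 2; 3; 4]%N) => //=; lia. Qed.

Lemma eta2_coann5 : (5 <= n)%N -> coann_lt 5 (eta k n 2).
Proof. by move=> n6; apply: (@coann_lt_table _ _ 5 _ [:: 1; 2; 3; 4]%N) => //=; lia. Qed.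

(** The table has three entries but only two distinct values, so counting entries does not
    suffice. *)
Lemma eps24_square : square_lt 3 (T22_eps24 k n).
Proof.
pose m i j (x y : 'rV[k]_n) := (x *m (bvec k n i)^T) 0 0 * (y *m (bvec k n j)^T) 0 0
   - (x *m (bvec k n j)^T) 0 0 * (y *m (bvec k n i)^T) 0 0.
apply: (@square_lt_bound k n 3 2 _
  (fun i x y => if i == 0%N then m 1%N 2%N x y else m 1%N 3%N x y + m 2%N 4%N x y)
  (fun i => if i == 0%N then bvec k n (n - 1) else bvec k n n)) => // x y.
rewrite smul_anticomm_structure !big_cons big_nil !big_ord_recl big_ord0 /=.
by rewrite !addr0 -scalerDl.
Qed.

Lemma eta1_cube : (3 <= n)%N -> cube0 (eta k n 1).
Proof. by move=> n3; apply: cube0_table; rewrite /table_ok /=; lia. Qed.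

Lemma T22_cube : (5 <= n)%N -> cube0 (T22 k n).
Proof. by move=> n5; apply: cube0_table; rewrite /table_ok /=; lia. Qed.

Lemma eps23_cube : (6 <= n)%N -> cube0 (T22_eps23 k n).
Proof. by move=> n6; apply: cube0_table; rewrite /table_ok /=; lia. Qed.

Lemma eps24_cube : (6 <= n)%N -> cube0 (T22_eps24 k n).
Proof. by move=> n6; apply: cube0_table; rewrite /table_ok /=; lia. Qed.

Lemma T222_cube : (7 <= n)%N -> cube0 (T222 k n).
Proof. by move=> n7; rewrite T222E //; apply: cube0_table; rewrite /table_ok /=; lia. Qed.

Lemma no_orbit_det r a b c mu chi :
  det_cond r a b c chi -> ~ det_cond r a b c mu -> ~ orbit mu chi.
Proof.
by move=> cc ncm /orbit_sym/orbit_degen/det_cond_degen/(_ cc).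
Qed.

Lemma no_orbit_cube mu chi : cube0 chi -> ~ cube0 mu -> ~ orbit mu chi.
Proof. by move=> cc ncm /orbit_sym/orbit_degen/cube0_degen/(_ cc). Qed.

Lemma level_step j mu : (j < 3)%N -> level_rep j.+1 mu ->
  exists chi, [/\ level_rep j chi, degen mu chi & ~ orbit mu chi].
Proof.
case: j => [|[|[|//]]] _.
- case=> n3 ->; exists 0; split=> //.
    exact/degen0/anticomm_anticomm_structure.
  exact: no_orbit_det square_lt1_0 (eta1_square n3).
- case=> [[n5]|[n4 ->]].
    have n3 : (3 <= n)%N by lia.
    case=> ->; exists (eta k n 1); split=> //.
    + exact: eta2_eta1.
    + exact: no_orbit_det eta1_forms (eta2_forms n5).
    + exact: T22_eta1.
    exact: no_orbit_det (@square_lt_eta _ _ 1) (T22_square n5).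
  exists (eta k n 1); split; first by split=> //; rewrite n4.
    by apply: T3_eta1; rewrite n4.
  by apply: no_orbit_cube; [apply: eta1_cube|apply: T3_cube]; rewrite n4.
have T : (5 <= n)%N -> level_rep 2 (T22 k n) by move=> n5; left; split=> //; right.
case=> [[n5 ->]|[n6]|[n7]].
- exists (T22 k n); split; [exact: T|exact: T3_T22|].
  by apply: no_orbit_cube (T22_cube n5) _; apply: T3_cube; lia.
- have n5 : (5 <= n)%N by lia.
  case=> ->; exists (T22 k n); split; try exact: T.
  + exact: eps23_T22.
  + by apply: no_orbit_det (eps23_square3 n6); apply: square_lt_table.
  + exact: eps24_T22.
  exact: no_orbit_det (T22_coann n5) (eps24_coann n6).
have n5 : (5 <= n)%N by lia.
case=> ->.
  exists (eta k n 2); split; first by left; split=> //; left.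
    exact: eta3_eta2.
  exact: no_orbit_det (eta2_coann5 n5) (eta3_coann5 n7).
exists (T22 k n); split; [exact: T|exact: T222_T22|].
by apply: no_orbit_det (T222_square3 n7); apply: square_lt_table.
Qed.

(** For two distinct representatives, a closed condition holds for the source and fails for the
    target. A one-dimensional square isolates the eta_m as sources, a(bc) = 0 protects T^3 as a
    target, and the remaining pairs differ in the dimension of the square, the codimension of the
    annihilator, the rank of the forms or the dependence of cyclic products. *)
Lemma level_anti j mu chi : (j <= 3)%N -> level_rep j mu -> level_rep j chi ->
  degen mu chi -> orbit mu chi.
Proof.
have det r a b c x y : det_cond r a b c x -> ~ det_cond r a b c y -> degen x y -> orbit x y.
  by move=> cx ncy /det_cond_degen/(_ cx)/ncy.
have cub (x y : structure k n) : cube0 x -> ~ cube0 y -> degen x y -> orbit x y.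
  by move=> cx ncy /cube0_degen/(_ cx)/ncy.
have refl x : degen x x -> orbit x x by move=> _; apply: orbit_refl.
case: j => [|[|[|[|//]]]] _ /=.
- by move=> -> ->; apply: refl.
- by move=> [_ ->] [_ ->]; apply: refl.
- case=> [[n5 H]|[n4 ->]]; last first.
    by case=> [[n5]|[_ ->]]; [move: (n5); rewrite {1}n4 | apply: refl].
  case=> [[_ H']|[n4]]; last by move: (n5); rewrite {1}n4.
  case: H => ->; case: H' => ->; try exact: refl.
    exact: det (@square_lt_eta _ _ 2) (T22_square n5).
  exact: det (T22_coann n5) (eta2_coann n5).
move=> H H' mc; have n5 : (5 <= n)%N by case: H => -[] //; lia.
have n4 : (4 <= n)%N by lia.
have sq3 s : (size s <= 2)%N -> square_lt 3 (anticomm_structure k n s).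
  by move=> ?; apply: square_lt_table.
move: mc; case: H => [[_ ->]|[n6 [] ->]|[n7 [] ->]];
  case: H' => [[_ ->]|[n6' [] ->]|[n7' [] ->]]; try exact: refl.
- by apply: det (eps23_square3 n6'); apply: sq3.
- exact: det (T3_coann n5) (eps24_coann n6').
- exact: det (T3_coann n5) (eta3_coann n7').
- by apply: det (T222_square3 n7'); apply: sq3.
- exact: cub (eps23_cube n6) (T3_cube n4).
- exact: det (eps23_coann n6) (eps24_coann n6).
- exact: det (eps23_coann n6) (eta3_coann n7').
- exact: det (eps23_coann n6) (T222_coann n7').
- exact: cub (eps24_cube n6) (T3_cube n4).
- exact: det eps24_square (eps23_square3 n6').
- exact: det (eps24_coann5 n6) (eta3_coann5 n7').
- exact: det eps24_square (T222_square3 n7').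
- exact: det (@square_lt_eta _ _ 3) (T3_square2 n4).
- exact: det (@square_lt_eta _ _ 3) (eps23_square2 n6').
- exact: det (@square_lt_eta _ _ 3) (eps24_square2 n6').
- exact: det (@square_lt_eta _ _ 3) (T222_square2 n7').
- exact: cub (T222_cube n7) (T3_cube n4).
- exact: det (T222_triple n7) (eps23_triple n6').
- exact: det (T222_forms n7) (eps24_forms n6').
exact: det (T222_forms n7) (eta3_forms n7).
Qed.

Lemma level3_chainP mu : anticomm_engel mu ->
  (structure_chain 3 mu /\ ~ structure_chain 4 mu) <-> exists2 x, level_rep 3 x & orbit mu x.
Proof. exact: chain3P level_cover level_step level_anti mu. Qed.

Lemma dim4_not_chain3 mu : anticomm_engel mu -> (n <= 4)%N -> ~ structure_chain 3 mu.
Proof.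
move=> gm n4; apply: (not_chain3 level_cover level_step level_anti gm) => x.
by case=> -[] nN _; lia.
Qed.

End LevelRepresentatives.

(** * From structures to algebras *)

Import passmx.

Section Algebras.
Variable k : fieldType.
Implicit Types A B C : algebra k.

Lemma alg_isomorphic_sym A B : alg_isomorphic A B -> alg_isomorphic B A.
Proof.
case=> f [[g fK gK] fM]; have g_lin : linear g.
  by move=> a x y; apply: (can_inj fK); rewrite linearP !gK.
pose g' := GRing.isLinear.Build k B A _ g g_lin.
pose gL : {linear B -> A} := HB.pack g g'.
exists gL; split=> [|x y]; first by exists f.
by apply: (can_inj fK); rewrite fM !gK.
Qed.

Lemma alg_isomorphic_trans A B C :
  alg_isomorphic A B -> alg_isomorphic B C -> alg_isomorphic A C.
Proof.
case=> f [fbij fM] [g [gbij gM]]; exists (g \o f); split; first exact: bij_comp.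
by move=> x y /=; rewrite fM gM.
Qed.

Lemma alg_isomorphic_dim A B : alg_isomorphic A B -> \dim {:A} = \dim {:B}.
Proof.
case=> f [[g fK gK] _]; pose F := linfun f.
have kF : (lker F == 0)%VS.
  apply/lker0P => x y; rewrite !lfunE /=; exact: (can_inj fK).
have <- : (F @: {:A})%VS = {:B}%VS.
  apply/eqP; rewrite eqEsubv subvf; apply/subvP => y _.
  by rewrite -[y]gK -[f _](lfunE f) memv_img ?memvf.
by rewrite limg_dim_eq // (eqP kF) capv0.
Qed.

Lemma represents_dim n (mu : structure k n) A : represents mu A -> \dim {:A} = n.
Proof. by move=> /alg_isomorphic_dim ->; apply: dim_rV. Qed.

Lemma represents_exists A n : \dim {:A} = n -> exists mu : structure k n, represents mu A.
Proof.
move=> <-; pose e := vbasis {:A}; have be : basis_of {:A} e := vbasisP _.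
exists (of_tensor (fun i j => rVof e (alg_mul A (vecof e 'e_i) (vecof e 'e_j)))).
exists (rVof e); split.
  by exists (vecof e); [apply: rVofK | apply: vecofK].
move=> x y /=; rewrite smul_expand1.
have eE u : u = \sum_i rVof e u 0 i *: e`_i by rewrite -{1}(rVofK be u).
rewrite {1}(eE x) {1}(eE y) linear_sumlz linear_sum.
apply: eq_bigr => i _; rewrite linear_sumr linear_sum; apply: eq_bigr => j _.
by rewrite smul_of_tensor !vecof_delta linearZl_LR linearZr_LR scalerA linearZ.
Qed.

Lemma isomorphic_orbit n (mu chi : structure k n) :
  alg_isomorphic (structure_algebra mu) (structure_algebra chi) <-> orbit mu chi.
Proof.
split=> [[f [[g fK gK] fM]]|/orbitP[g gU ->]].
  pose G := lin1_mx f; have xG x : x *m G = f x by apply: mul_rV_lin1.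
  have GU : G \in unitmx.
    rewrite -row_free_unit; apply: inj_row_free => v; rewrite xG => fv.
    by apply: (can_inj fK); rewrite fv linear0.
  exists G => // x y; rewrite xG.
  have := fM (x *m invmx G) (y *m invmx G); rewrite -!xG !mulmxKV // => ->.
exists (mulmxr g); split.
  by exists (mulmxr (invmx g)) => x /=; [rewrite mulmxK | rewrite mulmxKV].
by move=> x y /=; rewrite smul_act !mulmxK.
Qed.

Lemma represents_orbit n (mu chi : structure k n) A :
  represents mu A -> represents chi A <-> orbit mu chi.
Proof.
move=> mA; rewrite -isomorphic_orbit; split=> [cA|mc].
  exact: alg_isomorphic_trans (alg_isomorphic_sym mA) cA.
exact: alg_isomorphic_trans mA mc.
Qed.

Lemma represents_isomorphic n (mu chi : structure k n) A B :
  represents mu A -> represents chi B -> alg_isomorphic A B <-> orbit mu chi.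
Proof.
move=> mA cB; rewrite -isomorphic_orbit; split=> [AB|mc].
  apply: alg_isomorphic_trans (alg_isomorphic_sym mA) _.
  exact: alg_isomorphic_trans AB cB.
apply: alg_isomorphic_trans mA _; apply: alg_isomorphic_trans mc _.
exact: alg_isomorphic_sym.
Qed.

(** A degeneration of algebras comes with its own dimension and structures; isomorphism invariance
    of the dimension and a change of representative bring it to the given [mu]. *)
Lemma represents_degen n (mu : structure k n) A B : represents mu A ->
  degenerates A B -> exists2 chi, represents chi B & degen mu chi.
Proof.
move=> mA [n' [mu' [chi [mA' cB mc]]]].
have nn : n' = n by rewrite -(represents_dim mA) (represents_dim mA').
subst n'; exists chi => //.
exact: degen_trans (orbit_degen ((represents_orbit mu' mA).1 mA')) mc.
Qed.

Lemma structure_algebra_represents n (mu : structure k n) :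
  represents mu (structure_algebra mu).
Proof. by apply/isomorphic_orbit/orbit_refl. Qed.

End Algebras.

(** * Chains of algebras and the level *)

Section Chains.
Variables (k : closedFieldType) (n : nat).
Implicit Types (A B : algebra k) (mu chi : structure k n).

Lemma degeneration_chainP m mu A : represents mu A ->
  degeneration_chain A m <-> structure_chain m mu.
Proof.
elim: m mu A => [|m IH] mu A mA; first by split=> // _; exists (fun=> A).
split=> [[C [CA CP]]|[chi [mc nmc cm]]].
  have [] := CP m (leqnn _); rewrite CA => AB nAB.
  have [chi cB mc] := represents_degen mA AB; exists chi; split=> //.
    by move/(represents_isomorphic mA cB).
  apply/(IH chi (C m) cB); exists C; split=> // i im.
  exact/CP/ltnW.
pose B := structure_algebra chi; have cB : represents chi B.
  exact: structure_algebra_represents.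
have [C [CB CP]] := (IH chi B cB).2 cm.
(* Chains are indexed from the bottom, so the new algebra is put at position m+1, where [C] is
   unconstrained. *)
exists (fun i => if i == m.+1 then A else C i); rewrite eqxx; split=> // i.
rewrite ltnS eqSS leq_eqVlt => /predU1P[->|im].
  rewrite eqxx ltn_eqF // CB; split; last by move/(represents_isomorphic mA cB).
  by exists n, mu, chi.
by rewrite !ltn_eqF //; [apply: CP | apply: ltnW].
Qed.

Lemma has_level3P mu A : represents mu A ->
  has_level A 3 <-> structure_chain 3 mu /\ ~ structure_chain 4 mu.
Proof.
move=> mA; rewrite /has_level (degeneration_chainP 3 mA); split=> -[c3 c4]; split=> //.
  by move=> /(degeneration_chainP 4 mA)/c4.
move=> m' /(degeneration_chainP m' mA) cm'; rewrite leqNgt; apply/negP => m4.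
exact/c4/(structure_chain_le m4).
Qed.

Lemma has_level_le2 mu A : represents mu A -> ~ structure_chain 3 mu ->
  exists2 m : nat, has_level A m & (m <= 2)%N.
Proof.
move=> mA nc3.
have max m : structure_chain m mu -> ~ structure_chain m.+1 mu -> has_level A m.
  move=> cm ncm; split; first exact/(degeneration_chainP m mA).
  move=> m' /(degeneration_chainP m' mA) cm'; rewrite leqNgt; apply/negP => mm'.
  exact/ncm/(structure_chain_le mm').
have [c2|nc2] := classic (structure_chain 2 mu); first by exists 2%N => //; apply: max.
have [c1|nc1] := classic (structure_chain 1 mu); first by exists 1%N => //; apply: max.
by exists 0%N => //; apply: max.
Qed.

Lemma represents_anticomm_engel mu A : represents mu A -> anticommutative A -> engel A ->
  anticomm_engel mu.
Proof.
move=> mA aA [m _ eA]; have [f [[g fK gK] fM]] := mA.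
split=> [x|]; first by rewrite -[x]gK -[LHS]fM aA linear0.
exists m => a b; rewrite -[a]gK -[b]gK -[RHS](linear0 f) -(eA (g a) (g b)).
by elim: m {eA} => //= m ->; rewrite -[LHS]fM.
Qed.

End Chains.

Theorem theorem9p1 (k : closedFieldType) (n : nat) (A : algebra k)
    (dimA : \dim {:A} = n) (antiA : anticommutative A) (engelA : engel A) :
  [/\ (n <= 4)%N -> exists2 m : nat, has_level A m & (m <= 2)%N,
      n = 5%N -> (has_level A 3 <-> represents (T3 k n) A),
      n = 6%N ->
        (has_level A 3 <->
         [\/ represents (T22_eps23 k n) A,
             represents (T22_eps24 k n) A |
             represents (T3 k n) A]) &
      (7 <= n)%N ->
        (has_level A 3 <->
         [\/ represents (eta k n 3) A,
             represents (T22_eps23 k n) A,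
             represents (T22_eps24 k n) A |
             represents (T3 k n) A \/ represents (T222 k n) A])].
Proof.
have [mu mA] := represents_exists dimA.
have gm := represents_anticomm_engel mA antiA engelA.
have lev : has_level A 3 <-> exists2 x : structure k n, level_rep 3 x & represents x A.
  apply: (iff_trans (has_level3P mA)); apply: (iff_trans (level3_chainP gm)).
  by split=> -[x Lx xA]; exists x => //; apply/(represents_orbit x mA).
split=> [n4|n5|n6|n7].
- exact: has_level_le2 mA (dim4_not_chain3 gm n4).
- rewrite lev; split=> [[x Lx xA]|TA].
    by case: Lx xA => [[_ ->]|[n6]|[n7]] //; [move: n6|move: n7]; rewrite {1}n5.
  by exists (T3 k n) => //; apply: Or31; rewrite {1}n5.
- have n6' : (6 <= n)%N by rewrite n6.
  have n5 : (5 <= n)%N by rewrite n6.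
  rewrite lev; split=> [[x Lx xA]|].
    case: Lx xA => [[_ ->]|[_ [] ->]|[n7]]; try by constructor.
    by move: n7; rewrite {1}n6.
  case=> xA; [exists (T22_eps23 k n)|exists (T22_eps24 k n)|exists (T3 k n)] => //.
  + by apply: Or32; split=> //; left.
  + by apply: Or32; split=> //; right.
  by apply: Or31.
have n6 : (6 <= n)%N by apply: leq_trans n7.
have n5 : (5 <= n)%N by apply: leq_trans n7.
rewrite lev; split=> [[x Lx xA]|].
  by case: Lx xA => [[_ ->]|[_ [] ->]|[_ [] ->]] xA;
    [apply: Or44; left|apply: Or42|apply: Or43|apply: Or41|apply: Or44; right].
case=> [xA|xA|xA|[xA|xA]].
- by exists (eta k n 3) => //; apply: Or33; split=> //; left.
- by exists (T22_eps23 k n) => //; apply: Or32; split=> //; left.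
- by exists (T22_eps24 k n) => //; apply: Or32; split=> //; right.
- by exists (T3 k n) => //; apply: Or31.
by exists (T222 k n) => //; apply: Or33; split=> //; right.
Qed.
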